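(* Let $T>0$, let $k$ be an integer with $1\le k\le 3$, let $\alpha$ be a real number with $k-1\le \alpha<k$, and let $1\le q\le\infty$, $1\le p<\infty$ satisfy $$[(3-\alpha)p-2]\,q<2 .$$ Then there exist a force $f\in L^q(0,T;L^p(D))$ and a corresponding unique solution $v\in L^\infty(0,T;L^2(D))\cap L^2(0,T;H^1(D))$ (with pressure $P$) of the Navier-Stokes equations $$\Delta v-v\cdot\nabla v-\nabla P-\partial_t v=f,\qquad \nabla\cdot v=0\qquad\text{in } D\times[0,T),$$ which satisfies the no slip boundary condition $v=0$ on the vertical boundary of $D$ and the Navier total slip boundary condition on the horizontal boundary of $D$, such that: (i) $\|\nabla^{k-1}v(\cdot,t)\|_{L^\infty(D)}\to+\infty$ as $t\to T$; (ii) $v\in L^{\tilde q}(0,T;L^{\tilde p}(D))$ for all pairs $\tilde p\in[1,\infty)$, $\tilde q\in[1,\infty]$ satisfying $[(1-\alpha)\tilde p-2]\,\tilde q<2$; (iii) $f$ and $v$ are smooth in $D\times[0,T)$; (iv) if $k\ge 2$, then also $v\in C^{k-2}(D\times[0,T])$.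
   Context: $D=B_2(0,1)\times[0,1]\subset\mathbb{R}^3$ is the cylinder, where $B_2(0,1)$ is the unit ball of $\mathbb{R}^2$ centred at the origin. Its vertical boundary is the lateral surface $\{x_1^2+x_2^2=1,\ 0\le x_3\le 1\}$ and its horizontal boundary consists of the top and bottom faces $x_3\in\{0,1\}$. With cylindrical components $v_r=v\cdot e_r$, $v_\theta=v\cdot e_\theta$, $v_3=v\cdot e_3$, the Navier total slip boundary condition on the horizontal boundary is $\partial_{x_3}v_r=\partial_{x_3}v_\theta=0$, $v_3=0$. The velocity $v$ and force $f$ are $\mathbb{R}^3$-valued and $P$ is scalar; the Navier-Stokes problem carries the initial condition $v(x,0)=v_0(x)$, where $v_0$ is the value of $v$ at $t=0$. ''Unique'' means that $v$ is the only velocity field, among solutions smooth for $t<T$, solving the problem with the given $f$, the given initial value and the given boundary conditions. When $q=\infty$, the inequality $[(3-\alpha)p-2]q<2$ is read as $(3-\alpha)p-2<0$ (i.e. $(3-\alpha)p-2<2/q$ with $2/\infty=0$), and similarly for $\tilde q=\infty$. *)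

(* Defs.v *)
From mathcomp Require Import all_boot all_order all_algebra.
From mathcomp Require Import all_classical all_reals all_analysis.
Import Order.TTheory GRing.Theory Num.Theory.
Import numFieldNormedType.Exports.

Set Implicit Arguments.
Unset Strict Implicit.
Unset Printing Implicit Defensive.

Local Open Scope classical_set_scope.
Local Open Scope ring_scope.

Section Smoothness.
Context {R : realType} {V W : normedModType R}.

Definition iter_derive (ws : seq V) (f : V -> W) : V -> W :=
  foldr (fun w g z => 'D_w g z) f ws.

Definition Cn_open (n : nat) (U : set V) (f : V -> W) : Prop :=
  (forall ws z, (size ws <= n)%N -> U z -> {for z, continuous (iter_derive ws f)})
  /\ (forall ws w z, (size ws < n)%N -> U z -> derivable (iter_derive ws f) z w).

(* On a set that is not open, regularity means regularity on a neighbourhood,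
   so the two-sided 'D_w is also meaningful at boundary points. *)
Definition Cn_on (n : nat) (A : set V) (f : V -> W) : Prop :=
  exists U : set V, [/\ open U, A `<=` U & Cn_open n U f].

Definition smooth_on (A : set V) (f : V -> W) : Prop :=
  exists U : set V, [/\ open U, A `<=` U & forall n, Cn_open n U f].

End Smoothness.

Section Cylinder.
Context {R : realType}.

(* The coordinates x_1, x_2, x_3 have indices 0, 1, 2. *)
Definition i1 : 'I_3 := @Ordinal 3 0 isT.
Definition i2 : 'I_3 := @Ordinal 3 1 isT.
Definition i3 : 'I_3 := @Ordinal 3 2 isT.

Definition row3 (a b c : R) : 'rV[R]_3 := \row_(j < 3) [:: a; b; c]`_j.

Definition radius (x : 'rV[R]_3) : R := Num.sqrt (x 0 i1 ^+ 2 + x 0 i2 ^+ 2).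

Definition cyl : set 'rV[R]_3 :=
  [set x | radius x <= 1 /\ 0 <= x 0 i3 <= 1].
Definition vertical_boundary : set 'rV[R]_3 :=
  [set x | radius x = 1 /\ 0 <= x 0 i3 <= 1].
Definition horizontal_boundary : set 'rV[R]_3 :=
  [set x | radius x <= 1 /\ (x 0 i3 = 0 \/ x 0 i3 = 1)].

Definition e_ (j : 'I_3) : 'rV[R]_3 := delta_mx 0 j.
Definition e_r (x : 'rV[R]_3) : 'rV[R]_3 :=
  row3 (x 0 i1 / radius x) (x 0 i2 / radius x) 0.
Definition e_theta (x : 'rV[R]_3) : 'rV[R]_3 :=
  row3 (- (x 0 i2 / radius x)) (x 0 i1 / radius x) 0.

Definition dotp (a b : 'rV[R]_3) : R := \sum_(i < 3) a 0 i * b 0 i.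

(* D x I, for a set I of times; the time coordinate comes first. *)
Definition cylT (I : set R) : set (R * 'rV[R]_3) :=
  [set z | I z.1 /\ cyl z.2].

End Cylinder.

Section DifferentialOperators.
Context {R : realType}.
Implicit Types u : 'rV[R]_3 -> 'rV[R]_3.

Definition divergence u (x : 'rV[R]_3) : R := \sum_(j < 3) 'D_(e_ j) u x 0 j.

Definition laplacian u (x : 'rV[R]_3) : 'rV[R]_3 :=
  \sum_(j < 3) iter_derive [:: e_ j; e_ j] u x.

Definition convection u (x : 'rV[R]_3) : 'rV[R]_3 :=
  \sum_(j < 3) u x 0 j *: 'D_(e_ j) u x.

Definition gradient (P : 'rV[R]_3 -> R) (x : 'rV[R]_3) : 'rV[R]_3 :=
  \row_(j < 3) 'D_(e_ j) P x.

(* The Euclidean norm of the tensor (d_{s_1} ... d_{s_m} u_i)_{i, s}. *)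
Definition nabla_norm (m : nat) u (x : 'rV[R]_3) : R :=
  Num.sqrt (\sum_(i < 3) \sum_(s : m.-tuple 'I_3)
    (iter_derive [seq e_ j | j <- s] u x 0 i) ^+ 2).

End DifferentialOperators.

Section NavierStokes.
Context {R : realType}.
Implicit Types (f v : R -> 'rV[R]_3 -> 'rV[R]_3) (P : R -> 'rV[R]_3 -> R).

Definition smooth_vf (T : R) v : Prop :=
  smooth_on (cylT `[0, T[) (fun z : R * 'rV[R]_3 => v z.1 z.2).

Definition navier_stokes (T : R) f v P : Prop :=
  forall t x, 0 <= t < T -> cyl x ->
    [/\ differentiable (P t) x,
        laplacian (v t) x - convection (v t) x - gradient (P t) x
          - derive1 (fun s => v s x) t = f t x
      & divergence (v t) x = 0].

Definition no_slip (T : R) v : Prop :=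
  forall t x, 0 <= t < T -> vertical_boundary x -> v t x = 0.

(* v_r and v_theta are not defined on the axis, hence radius x != 0. *)
Definition total_slip (T : R) v : Prop :=
  forall t x, 0 <= t < T -> horizontal_boundary x ->
    (radius x != 0 ->
       'D_(e_ i3) (fun y => dotp (v t y) (e_r y)) x = 0 /\
       'D_(e_ i3) (fun y => dotp (v t y) (e_theta y)) x = 0) /\
    dotp (v t x) (e_ i3) = 0.

Definition NS_solution (T : R) f (v0 : 'rV[R]_3 -> 'rV[R]_3) v P : Prop :=
  [/\ smooth_vf T v,
      navier_stokes T f v P,
      (forall x, cyl x -> v 0 x = v0 x),
      no_slip T v
    & total_slip T v].

End NavierStokes.

Section FunctionSpaces.
Context {R : realType}.

Local Notation mR := (measurableTypeR R).

(* 'rV[R]_3 carries no measure in the library: integrals over R^3 are taken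
   over the product type and transported by pt. *)
Definition pt (x : mR * mR * mR) : 'rV[R]_3 := row3 x.1.1 x.1.2 x.2.

Definition leb1 : {measure set mR -> \bar R} := @lebesgue_measure R.
Definition leb3 : {measure set (mR * mR * mR) -> \bar R} :=
  ((@lebesgue_measure R \x @lebesgue_measure R) \x @lebesgue_measure R)%E.

Definition cyl3 : set (mR * mR * mR) := pt @^-1` cyl.

(* Euclidean (Frobenius) norm; the library's norm on matrices is the sup norm. *)
Definition enorm m n (A : 'M[R]_(m, n)) : R :=
  Num.sqrt (\sum_(i < m) \sum_(j < n) A i j ^+ 2).

Definition Lp_norm (p : \bar R) (g : 'rV[R]_3 -> R) : \bar R :=
  'N[leb3]_p[(EFin \o g \o pt) \_ cyl3].

Definition LqLp_norm (T : R) (q p : \bar R) m n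
    (u : R -> 'rV[R]_3 -> 'M[R]_(m, n)) : \bar R :=
  'N[leb1]_q[(fun t : mR => Lp_norm p (fun x => enorm (u t x)))
               \_ (`]0, T[%classic)].

(* For p < +oo, which covers every use below, Bochner measurability with values
   in L^p(D) amounts to joint measurability in (t, x). *)
Definition in_LqLp (T : R) (q p : \bar R) m n
    (u : R -> 'rV[R]_3 -> 'M[R]_(m, n)) : Prop :=
  (forall i j, measurable_fun
     [set z : mR * (mR * mR * mR) | (z.1 \in `]0, T[) /\ cyl3 z.2]
     (fun z => u z.1 (pt z.2) i j : mR)) /\
  (LqLp_norm T q p u < +oo)%E.

Definition test_function (phi : 'rV[R]_3 -> R) : Prop :=
  smooth_on setT phi /\
  exists K : set 'rV[R]_3,
    [/\ compact K, K `<=` interior cyl & forall x, ~ K x -> phi x = 0].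

Definition weak_partial (j : 'I_3) (u g : 'rV[R]_3 -> R) : Prop :=
  forall phi, test_function phi ->
    (\int[leb3]_(x in cyl3) (u (pt x) * 'D_(e_ j) phi (pt x))%:E =
     - \int[leb3]_(x in cyl3) (g (pt x) * phi (pt x))%:E)%E.

Definition in_L2H1 (T : R) (u : R -> 'rV[R]_3 -> 'rV[R]_3) : Prop :=
  in_LqLp T 2%:E 2%:E u /\
  exists g : R -> 'rV[R]_3 -> 'M[R]_3,
    in_LqLp T 2%:E 2%:E g /\
    {ae leb1, forall t, t \in `]0, T[ -> forall i j : 'I_3,
       weak_partial j (fun x => u t x 0 i) (fun x => g t x i j)}.

(* [c p - 2] q < 2, read as c p - 2 < 2 / q with 2 / +oo = 0. *)
Definition admissible (c p : R) (q : \bar R) : Prop :=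
  match q with
  | r%:E => (c * p - 2) * r < 2
  | +oo%E => c * p - 2 < 0
  | -oo%E => False
  end.

End FunctionSpaces.

(* Main.v *)
From HB Require Import structures.
Require Import Defs.
From mathcomp Require Import all_boot all_order all_algebra.
From mathcomp Require Import all_classical all_reals all_analysis.
From mathcomp Require Import measurable_realfun ess_sup_inf ring lra.
Import Order.TTheory GRing.Theory Num.Theory.
Import numFieldNormedType.Exports.

Set Implicit Arguments.
Unset Strict Implicit.
Unset Printing Implicit Defensive.

Local Open Scope classical_set_scope.
Local Open Scope ring_scope.

(** The solution is an explicit swirl around the axis of the cylinder. With
    r^2 = x_1^2 + x_2^2 and A = (T - t)^n + r^2, take

      v = (1 - r^2) A^(-m) (- x_2, x_1, 0),    P = 0.

    Such a field is divergence free, it vanishes for r = 1, it does not depend on x_3 and it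
    has no vertical component, so it obeys all the boundary conditions. The force is defined
    as the residual of the equation, hence what must be shown is that this residual is small
    enough. The quantity A is positive for t < T and vanishes only on the axis at time T,
    which is the only place where regularity is lost.

    All fields in play are polynomials in T - t, in the coordinates and in real powers of A.
    They are written in a small language of expressions ([expr]), closed under partial
    derivatives, and their size is read off a weight ([weighs]): an expression of weight s is
    bounded by a multiple of A^s ([weighs_bound]). A coordinate x_1 or x_2 weighs 1/2, T - t
    weighs 1/n, a space derivative costs 1/2 ([weighs_space]) and a time derivative 1/n
    ([weighs_time]). The velocity thus weighs 1/2 - m and the force one less. The bounds
    A >= (T - t)^n and A >= 2 |x_1 x_2| split a negative power of A into a power of T - t and
    an integrable power of |x_1 x_2|; the L^q L^p norms then reduce to integrals of one
    variable ([in_LqLp_weight]).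

    With a small eps > 0 and m = eps + 1 - k/2, the derivatives of order k - 1 of v weigh
    - eps, so they may blow up, but barely; they do, as the value of one of them at one point
    shows ([blow_up_of_lower_bound], [lower_bound1] to [lower_bound3]). The force weighs
    k/2 - 3/2 - eps, and the strict inequalities of the hypotheses leave room for eps
    ([exponent_choice]). For k = 1 one takes n = 1: the weight of the force is below - 1, and
    a power of A that is not integrable in x must cost as little as possible in t. For
    k = 2, 3 one takes n = 2: A is then positive off the singular points after the time T as
    well, a time derivative costs no more than a space derivative, and v and its derivatives
    of order up to k - 2, which have positive weight, are continuous at the singular points
    with the value 0 ([C0_swirl], [C1_swirl]).

    Uniqueness is the classical energy argument ([NS_unique]). The difference of two
    solutions is smooth up to the boundary, at each time before T. The energy balance involves
    only derivatives along the axes, and a line parallel to an axis meets the cylinder in a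
    segment, so integrating by parts one variable at a time is enough
    ([integral_partial_cyl]). *)

(** * Slices of space-time derivatives *)
Section Slices.
Context {R : realType} {W : normedModType R}.
Implicit Types (V : R * 'rV[R]_3 -> W) (t : R) (x w : 'rV[R]_3).

(** The operators of the problem act at fixed t or at fixed x, while regularity is a property
    of functions of (t, x). The difference quotients are the same, so passing from one side to
    the other requires no differentiability. *)
Lemma space_growth V t x w :
  (fun h : R => h^-1 *: (((fun y => V (t, y)) \o shift x) (h *: w) - V (t, x))) =
  (fun h : R => h^-1 *: ((V \o shift (t, x)) (h *: ((0, w) : R * 'rV[R]_3)) - V (t, x))).
Proof.
apply/funext => h /=; congr (_ *: (V _ - _)); congr pair.
by rewrite /= scaler0 add0r.
Qed.

Lemma derive_space V t x w :
  'D_w (fun y => V (t, y)) x = 'D_((0, w) : R * 'rV[R]_3) V (t, x).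
Proof. by rewrite /derive space_growth. Qed.

Lemma derivable_space V t x w :
  derivable (fun y => V (t, y)) x w = derivable V (t, x) ((0, w) : R * 'rV[R]_3).
Proof. by rewrite /derivable space_growth. Qed.

Lemma time_growth V t x :
  (fun h : R => h^-1 *: (((fun s => V (s, x)) \o shift t) (h *: (1 : R)) - V (t, x))) =
  (fun h : R => h^-1 *: ((V \o shift (t, x)) (h *: ((1, 0) : R * 'rV[R]_3)) - V (t, x))).
Proof.
apply/funext => h /=; congr (_ *: (V _ - _)); congr pair.
by rewrite /= scaler0 add0r.
Qed.

Lemma derive1_time V t x :
  derive1 (fun s => V (s, x)) t = 'D_((1, 0) : R * 'rV[R]_3) V (t, x).
Proof. by rewrite derive1E /derive time_growth. Qed.

Lemma derivable_time V t x :
  derivable (fun s => V (s, x)) t 1 = derivable V (t, x) ((1, 0) : R * 'rV[R]_3).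
Proof. by rewrite /derivable time_growth. Qed.

Lemma iter_derive_space V t x (ws : seq 'rV[R]_3) :
  iter_derive ws (fun y => V (t, y)) x =
  iter_derive [seq ((0, w) : R * 'rV[R]_3) | w <- ws] V (t, x).
Proof.
elim: ws x => [//|w ws IH] x /=.
rewrite -derive_space; congr ('D_w _ x); exact/funext.
Qed.

End Slices.

(** * Expressions in the self-similar variable *)

Section PowChain.
Context {R : realType} {V : normedModType R}.

(** Directional derivatives satisfy no chain rule in general; for an outer function of one
    variable it is recovered by restricting to a line. *)
Lemma is_derive_line (f : V -> R) (x v : V) (df : R) :
  is_derive x v f df <-> is_derive (0 : R) (1 : R) (fun h : R => f (h *: v + x)) df.
Proof.
have E : 'D_1 (fun h : R => f (h *: v + x)) 0 = 'D_v f x.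
  rewrite /derive; set g1 := fun h => h^-1 *: _; set g2 := fun h => h^-1 *: _.
  suff -> : g1 = g2 by [].
  by apply/funext => h; rewrite /g1 /g2/= addr0 scale0r add0r [_%:A]mulr1.
by split=> -[H1 H2]; split; rewrite ?E// -?E//; [exact/(derivable1P _ _ _).1|exact/(derivable1P _ _ _).2].
Qed.

Lemma is_derive_powR (g : V -> R) (z w : V) (dg a : R) :
  0 < g z -> is_derive z w g dg ->
  is_derive z w (fun y => g y `^ a) (a * g z `^ (a - 1) * dg).
Proof.
move=> gz0 /is_derive_line[gd gE]; apply/is_derive_line.
have g00 : g (0 *: w + z) = g z by rewrite scale0r add0r.
have pd : derivable (fun s : R => s `^ a) (g z) 1 by apply: derivable_powR; rewrite in_itv/= andbT.
split.
  apply/derivable1_diffP; apply: (@differentiable_comp _ _ _ _ (fun h : R => g (h *: w + z)) (fun s : R => s `^ a)).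
    exact/derivable1_diffP.
  by apply/derivable1_diffP; rewrite g00.
rewrite -derive1E -[LHS]/(derive1 ((fun s : R => s `^ a) \o (fun h : R => g (h *: w + z))) 0).
by rewrite derive1_comp ?g00// powR_derive1 ?in_itv/= ?andbT// derive1E gE.
Qed.

End PowChain.

Section Expressions.
Context {R : realType}.
Variables (T : R) (n : nat).
Local Notation X := 'rV[R]_3.
Local Notation Z := (R * 'rV[R]_3)%type.

(** The velocity, the force and all their derivatives are denoted by such expressions, so that
    smoothness and bounds are proved for all of them at once by structural induction. *)
Inductive expr : Type :=
| Cst of R
| Tau of nat
| Crd of 'I_3
| Add of expr & expr
| Mul of expr & expr
| PowA of R.

Definition scale (z : Z) : R :=
  (T - z.1) ^+ n + z.2 0 i1 ^+ 2 + z.2 0 i2 ^+ 2.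

Lemma scaleE z : scale z = (T - z.1) ^+ n + z.2 0 i1 ^+ 2 + z.2 0 i2 ^+ 2.
Proof. by []. Qed.

Fixpoint sem (e : expr) (z : Z) : R :=
  match e with
  | Cst c => c
  | Tau k => (T - z.1) ^+ k
  | Crd i => z.2 0 i
  | Add a b => sem a z + sem b z
  | Mul a b => sem a z * sem b z
  | PowA a => scale z `^ a
  end.

(** For the argument [d] of [dscale] and [partial], [None] is the time. *)
Definition dscale (d : option 'I_3) : expr :=
  match d with
  | None => Mul (Cst (- n%:R)) (Tau n.-1)
  | Some j => if j == i3 then Cst 0 else Mul (Cst 2) (Crd j)
  end.

Fixpoint partial (d : option 'I_3) (e : expr) : expr :=
  match e with
  | Cst _ => Cst 0
  | Tau k => if d is None then Mul (Cst (- k%:R)) (Tau k.-1) else Cst 0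
  | Crd i => if d is Some j then Cst (i == j)%:R else Cst 0
  | Add a b => Add (partial d a) (partial d b)
  | Mul a b => Add (Mul (partial d a) b) (Mul a (partial d b))
  | PowA a => Mul (PowA (a - 1)) (Mul (Cst a) (dscale d))
  end.

Definition directional (w : Z) (e : expr) : expr :=
  Add (Mul (Cst w.1) (partial None e))
    (Add (Mul (Cst (w.2 0 i1)) (partial (Some i1) e))
      (Add (Mul (Cst (w.2 0 i2)) (partial (Some i2) e))
        (Mul (Cst (w.2 0 i3)) (partial (Some i3) e)))).

Lemma ord3P (P : 'I_3 -> Prop) : P i1 -> P i2 -> P i3 -> forall i, P i.
Proof.
move=> P1 P2 P3 [[|[|[|//]]] Hi].
- by rewrite (_ : Ordinal Hi = i1)//; exact/val_inj.
- by rewrite (_ : Ordinal Hi = i2)//; exact/val_inj.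
- by rewrite (_ : Ordinal Hi = i3)//; exact/val_inj.
Qed.

Lemma is_derive_affine (f : Z -> R) (z w : Z) (d : R) :
  (forall h : R, f (h *: w + z) = h * d + f z) -> is_derive z w f d.
Proof.
move=> fE; suff H : h^-1 *: ((f \o shift z) (h *: w) - f z) @[h --> 0^'] --> d.
  by split; [apply/cvg_ex; exists d|exact: cvg_lim].
apply: cvg_near_cst; near=> h.
have h0 : h != 0 by near: h; exact: nbhs_dnbhs_neq.
by rewrite /= fE addrK [_ *: _]mulrA mulVf// mul1r.
Unshelve. all: by end_near. Qed.

Lemma is_derive_coord (i : 'I_3) (z w : Z) : is_derive z w (fun y : Z => y.2 0 i) (w.2 0 i).
Proof. by apply: is_derive_affine => h; rewrite !mxE. Qed.

Lemma is_derive_tau (z w : Z) : is_derive z w (fun y : Z => T - y.1) (- w.1).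
Proof. by apply: is_derive_affine => h /=; rewrite /GRing.scale/=; ring. Qed.

Lemma is_derive_Xn (f : Z -> R) k (z w : Z) (df : R) :
  is_derive z w f df -> is_derive z w (fun y => f y ^+ k) (k%:R * f z ^+ k.-1 * df).
Proof.
move=> H; have -> : (fun y => f y ^+ k) = f ^+ k.
  by apply/funext => y; rewrite exprfctE.
exact: is_deriveX.
Qed.

Lemma is_derive_scale (z w : Z) :
  is_derive z w scale (w.1 * sem (dscale None) z
    + (w.2 0 i1 * sem (dscale (Some i1)) z + w.2 0 i2 * sem (dscale (Some i2)) z)).
Proof.
have H1 := is_derive_Xn n (is_derive_tau z w).
have H2 := is_derive_Xn 2 (is_derive_coord i1 z w).
have H3 := is_derive_Xn 2 (is_derive_coord i2 z w).
apply: (is_derive_eq (is_deriveD (is_deriveD H1 H2) H3)) => /=.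
by rewrite !expr1 -!mulrA; ring.
Qed.

Lemma is_derive_sem e z w : 0 < scale z ->
  is_derive z w (sem e) (sem (directional w e) z).
Proof.
move=> Az; elim: e => [c|k|i|a IHa b IHb|a IHa b IHb|a] /=.
- by apply: (is_derive_eq (is_derive_cst c z w)); rewrite !mulr0 !addr0.
- apply: (is_derive_eq (is_derive_Xn k (is_derive_tau z w))).
  by rewrite !mulr0 !addr0; ring.
- apply: (is_derive_eq (is_derive_coord i z w)).
  rewrite mulr0 add0r; elim/ord3P: i; rewrite /= !mulr1 !mulr0; ring.
- by apply: (is_derive_eq (is_deriveD IHa IHb)) => /=; ring.
- apply: (is_derive_eq (is_deriveM IHa IHb)) => /=.
  by rewrite /GRing.scale/=; ring.
- apply: (is_derive_eq (is_derive_powR a Az (is_derive_scale z w))) => /=.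
  ring.
Qed.

Lemma continuous_coord (i : 'I_3) : continuous (fun z : Z => z.2 0 i).
Proof.
move=> z; apply: (@continuous_comp _ _ _ snd (fun x : X => x 0 i)); first exact: cvg_snd.
exact: coord_continuous.
Qed.

Lemma continuous_tau : continuous (fun z : Z => T - z.1).
Proof. by move=> z; apply: cvgB; [exact: cvg_cst|exact: cvg_fst]. Qed.

Lemma continuous_pow (f : Z -> R) k z : {for z, continuous f} ->
  {for z, continuous (fun y => f y ^+ k)}.
Proof.
by move=> cf; apply: (@continuous_comp _ _ _ f (fun s : R => s ^+ k)) => //; exact: exprn_continuous.
Qed.

Lemma continuous_scale : continuous scale.
Proof.
move=> z; apply: cvgD; [apply: cvgD|]; apply: continuous_pow.
- exact: continuous_tau.
- exact: continuous_coord.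
- exact: continuous_coord.
Qed.

Lemma continuous_sem e z : 0 < scale z -> {for z, continuous (sem e)}.
Proof.
move=> Az; elim: e => [c|k|i|a IHa b IHb|a IHa b IHb|a] /=.
- exact: cvg_cst.
- by apply: continuous_pow; exact: continuous_tau.
- exact: continuous_coord.
- exact: cvgD.
- exact: cvgM.
- apply: (@continuous_comp _ _ _ scale (fun s : R => s `^ a)); first exact: continuous_scale.
  apply: differentiable_continuous; apply/derivable1_diffP.
  by apply: derivable_powR; rewrite in_itv/= andbT.
Qed.

Lemma open_scale_gt0 : open [set z | 0 < scale z].
Proof.
have /continuousP/(_ _ (@open_gt R 0)) := continuous_scale.
by rewrite /preimage/=.
Qed.

End Expressions.

(** * Fields with expressions as components *)

Lemma continuous_row {R : realType} {V : topologicalType} (f : V -> 'rV[R]_3) (z : V) :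
  (forall j, {for z, continuous (fun y => f y 0 j)}) -> {for z, continuous f}.
Proof.
move=> cf; apply/cvgrPdist_le => /= e e0; near=> x.
rewrite /Num.Def.normr/= mx_normrE (bigmax_le _ (ltW e0))//= => -[i j] _.
rewrite !mxE ord1/=; move: j; near: x; apply: filter_forall => /= j.
exact: ((cvgrPdist_le _ _).1 (cf j)).
Unshelve. all: by end_near. Qed.

Section Fields.
Context {R : realType}.
Variables (T : R) (n : nat).
Local Notation X := 'rV[R]_3.
Local Notation Z := (R * 'rV[R]_3)%type.
Local Notation sem := (sem T n).
Local Notation scale := (scale T n).
Local Notation partial := (partial n).
Local Notation directional := (directional n).

Definition field (e : 'I_3 -> expr) (z : Z) : X := \row_j sem (e j) z.

Definition directionals (ws : seq Z) (e : expr) : expr := foldr directional e ws.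

Lemma is_derive_field e z w : 0 < scale z ->
  is_derive z w (field e) (field (fun j => directional w (e j)) z).
Proof.
move=> Az.
have d j : is_derive z w (fun y => field e y 0 j) (sem (directional w (e j)) z).
  rewrite (_ : (fun y => _) = sem (e j)); first exact: is_derive_sem.
  by apply/funext => y; rewrite mxE.
have df : derivable (field e) z w.
  by apply/derivable_mxP => i j; rewrite ord1; exact: (@ex_derive _ _ _ _ _ _ _ (d j)).
split=> //; rewrite derive_mx//; apply/matrixP => i j; rewrite ord1 !mxE.
exact: (@derive_val _ _ _ _ _ _ _ (d j)).
Qed.

Lemma iter_derive_field e ws z : 0 < scale z ->
  iter_derive ws (field e) z = field (fun j => directionals ws (e j)) z.
Proof.
elim: ws z => [//|w ws IH] z Az /=.
rewrite (@near_eq_derive _ _ _ _ (field (fun j => directionals ws (e j)))).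
  exact: (@derive_val _ _ _ _ _ _ _ (is_derive_field _ _ Az)).
have := open_nbhs_nbhs (conj (@open_scale_gt0 R T n) Az).
by apply: filterS => y; exact: IH.
Qed.

Lemma derivable_iter_field e ws w z : 0 < scale z ->
  derivable (iter_derive ws (field e)) z w.
Proof.
move=> Az; apply: (@near_eq_derivable _ _ _ (field (fun j => directionals ws (e j)))).
  have := open_nbhs_nbhs (conj (@open_scale_gt0 R T n) Az).
  by apply: filterS => y /(iter_derive_field e ws) ->.
exact: (@ex_derive _ _ _ _ _ _ _ (is_derive_field _ _ Az)).
Qed.

Lemma continuous_field e z : 0 < scale z -> {for z, continuous (field e)}.
Proof.
move=> Az; apply: continuous_row => j.
rewrite (_ : (fun y => _) = sem (e j)); first exact: continuous_sem.
by apply/funext => y; rewrite mxE.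
Qed.

Lemma continuous_iter_field e ws z : 0 < scale z ->
  {for z, continuous (iter_derive ws (field e))}.
Proof.
move=> Az; rewrite /prop_for /continuous_at (iter_derive_field e ws Az).
apply: (@cvg_trans _ (field (fun j => directionals ws (e j)) @ z)); last exact: continuous_field.
apply: near_eq_cvg.
have := open_nbhs_nbhs (conj (@open_scale_gt0 R T n) Az).
by apply: filterS => y /(iter_derive_field e ws) ->.
Qed.

Lemma Cn_field e m : Cn_open m [set z | 0 < scale z] (field e).
Proof.
by split=> *; [exact: continuous_iter_field|exact: derivable_iter_field].
Qed.

Lemma smooth_field e A : A `<=` [set z | 0 < scale z] -> smooth_on A (field e).
Proof.
move=> sA; exists [set z | 0 < scale z].
by split=> //; [exact: open_scale_gt0|move=> m; exact: Cn_field].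
Qed.

Definition axis (d : option 'I_3) : Z := if d is Some j then (0, e_ j) else (1, 0).

Lemma sem_axis d e z : sem (directional (axis d) e) z = sem (partial d e) z.
Proof.
case: d => [j|] /=; last by rewrite !mxE !mul0r mul1r !addr0.
rewrite mul0r add0r !mxE; elim/ord3P: j => /=;
  by rewrite ?mul0r ?mul1r ?addr0 ?add0r.
Qed.

(** Expressions with the same meaning may be syntactically different, so the first step
    cannot be rewritten under [directional]; it is replaced through the uniqueness of the
    derivative. *)
Lemma sem_axes2 d d' e z : 0 < scale z ->
  sem (directional (axis d) (directional (axis d') e)) z = sem (partial d (partial d' e)) z.
Proof.
move=> Az; have H1 := is_derive_sem (directional (axis d') e) (axis d) Az.
have := is_derive_sem (partial d' e) (axis d) Az.
rewrite -(_ : sem (directional (axis d') e) = sem (partial d' e)); last first.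
  by apply/funext => y; exact: sem_axis.
move=> [_ E2]; case: H1 => _ <-.
by rewrite E2 sem_axis.
Qed.

End Fields.

(** * Weights *)

Section Weights.
Context {R : realType}.
Variables (T : R) (n : nat).
Hypothesis n_gt0 : (0 < n)%N.
Local Notation X := 'rV[R]_3.
Local Notation Z := (R * 'rV[R]_3)%type.
Local Notation sem := (sem T n).
Local Notation scale := (scale T n).
Local Notation partial := (partial n).
Local Notation directional := (directional n).

(** An admissible exponent s in the bound |e| <= C A^s. It is a relation rather than a computed
    degree so that a vanishing constant can be given every weight: derivatives leave many terms
    with a factor 0, and these must not lower the weight of the others. *)
Fixpoint weighs (e : expr) (s : R) : Prop :=
  match e with
  | Cst c => c = 0 \/ s <= 0
  | Tau k => s <= k%:R / n%:R
  | Crd i => s <= if i == i3 then 0 else 2^-1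
  | Add a b => weighs a s /\ weighs b s
  | Mul a b => exists s1 s2, [/\ weighs a s1, weighs b s2 & s <= s1 + s2]
  | PowA a => s <= a
  end.

Lemma weighs_le e s s' : s' <= s -> weighs e s -> weighs e s'.
Proof.
move=> le_s's; elim: e => [c|k|i|a IHa b IHb|a IHa b IHb|a] /=.
- by case=> [->|s0]; [left|right; exact: le_trans s0].
- exact: le_trans.
- exact: le_trans.
- by case=> /IHa ? /IHb.
- by case=> s1 [s2 [W1 W2 le12]]; exists s1, s2; split=> //; exact: le_trans le12.
- exact: le_trans.
Qed.

(** The derivative of A^a is a A^(a - 1) times 2 x_j: the factor x_j gives back 1/2 of the
    exponent that is lost. *)
Lemma weighs_space e s j : weighs e s -> weighs (partial (Some j) e) (s - 2^-1).
Proof.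
elim: e s => [c|k|i|a IHa b IHb|a IHa b IHb|a] s /=.
- by move=> _; left.
- by move=> _; left.
- case: (eqVneq i j) => [->|] /=; last by left.
  by right; move: H; case: ifP => _; lra.
- by case=> /IHa ? /IHb.
- case=> s1 [s2 [W1 W2 le12]]; split.
    by exists (s1 - 2^-1), s2; split=> //; [exact: IHa|lra].
  by exists s1, (s2 - 2^-1); split=> //; [exact: IHb|lra].
- move=> sa; exists (a - 1), 2^-1; split=> //; last lra.
  exists 0, 2^-1; split; [by right| |by rewrite add0r].
  case: ifPn => [_|/negbTE j3] /=; first by left.
  by exists 0, 2^-1; rewrite j3 add0r; split=> //; right.
Qed.

(** As in [weighs_space], the derivative - n (T - t)^(n - 1) of A gives back 1 - 1/n. *)
Lemma weighs_time e s : weighs e s -> weighs (partial None e) (s - n%:R^-1).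
Proof.
have n0 : 0 < (n%:R : R) by rewrite ltr0n.
elim: e s => [c|k|i|a IHa b IHb|a IHa b IHb|a] s /=.
- by move=> _; left.
- case: k => [|k] sk.
    exists (s - n%:R^-1), 0; split; [by left; rewrite oppr0| |by rewrite addr0].
    by rewrite mul0r.
  exists 0, (k%:R / n%:R); split; [by right|by []|].
  by move: sk; rewrite -natr1 mulrDl mul1r; lra.
- by move=> _; left.
- by case=> /IHa ? /IHb.
- case=> s1 [s2 [W1 W2 le12]]; split.
    by exists (s1 - n%:R^-1), s2; split=> //; [exact: IHa|lra].
  by exists s1, (s2 - n%:R^-1); split=> //; [exact: IHb|lra].
- have E : n.-1%:R / n%:R = 1 - n%:R^-1 :> R.
    apply: (mulIf (lt0r_neq0 n0)); rewrite mulrBl mul1r mulVf ?gt_eqF// divfK ?gt_eqF//.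
    by rewrite -[in RHS](prednK n_gt0) -natr1 addrK.
  move=> sa; exists (a - 1), (1 - n%:R^-1); split=> //; last lra.
  exists 0, (1 - n%:R^-1); split; [by right| |by rewrite add0r].
  by exists 0, (1 - n%:R^-1); rewrite E add0r; split=> //; right.
Qed.

Lemma powR_le_weight (A M b s : R) : 0 < A -> A <= M -> s <= b ->
  A `^ b <= M `^ (b - s) * A `^ s.
Proof.
move=> A0 AM sb; rewrite (_ : A `^ b = A `^ (b - s) * A `^ s); last by rewrite -powRD ?subrK// (gt_eqF A0) implybT.
rewrite ler_wpM2r ?powR_ge0// ge0_ler_powR ?subr_ge0// nnegrE ltW//.
exact: lt_le_trans AM.
Qed.

(** The region in which weights are bounds. The third condition is a restriction after
    the time T only, and there only for odd n. *)
Definition tame (M : R) (z : Z) : Prop :=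
  [/\ 0 < scale z, scale z <= M, 0 <= (T - z.1) ^+ n & `|z.2 0 i3| <= M].

(** By induction on e. The surplus of exponent in each case is absorbed by a power of the
    upper bound M of A. *)
Lemma weighs_bound M e s : 0 <= M -> weighs e s ->
  exists2 C, 0 <= C & forall z, tame M z -> `|sem e z| <= C * scale z `^ s.
Proof.
move=> M0; elim: e s => [c|k|i|a IHa b IHb|a IHa b IHb|a] s /=.
- case=> [->|s0]; first by exists 0 => // z _; rewrite normr0 mul0r.
  exists (`|c| * M `^ (- s)); first by rewrite mulr_ge0// powR_ge0.
  move=> z [z0 zM _ _]; rewrite -mulrA ler_peMr//.
  by have := powR_le_weight z0 zM s0; rewrite powRr0 sub0r.
- move=> sk; exists (M `^ (k%:R / n%:R - s)); first exact: powR_ge0.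
  move=> z [z0 zM t0 _]; apply: le_trans (powR_le_weight z0 zM sk).
  have tA : `|T - z.1| <= scale z `^ n%:R^-1.
    have -> : `|T - z.1| = (`|T - z.1| ^+ n) `^ n%:R^-1.
      by rewrite -powR_mulrn// -powRrM mulfV ?powRr1// pnatr_eq0 -lt0n.
    rewrite ge0_ler_powR ?invr_ge0// ?nnegrE ?exprn_ge0 ?(ltW z0)//.
    by rewrite -normrX ger0_norm// scaleE -addrA lerDl addr_ge0// sqr_ge0.
  rewrite normrX mulrC powRrM powR_mulrn ?powR_ge0//.
  by rewrite lerXn2r// nnegrE// powR_ge0.
- case: (eqVneq i i3) => [-> s0|i3' s2].
    exists (M * M `^ (- s)); first by rewrite mulr_ge0// powR_ge0.
    move=> z [z0 zM _ zM3]; apply: (le_trans zM3); rewrite -mulrA ler_peMr//.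
    by have := powR_le_weight z0 zM s0; rewrite powRr0 sub0r.
  exists (M `^ (2^-1 - s)); first exact: powR_ge0.
  move=> z [z0 zM t0 _]; apply: le_trans (powR_le_weight z0 zM s2).
  rewrite powR12_sqrt ?(ltW z0)// -sqrtr_sqr ler_sqrt ?(ltW z0)// scaleE.
  move: t0 i3' (sqr_ge0 (z.2 0 i1)) (sqr_ge0 (z.2 0 i2)).
  by elim/ord3P: i => //; lra.
- case=> /IHa[Ca Ca0 Ha] /IHb[Cb Cb0 Hb]; exists (Ca + Cb); first exact: addr_ge0.
  move=> z tz; rewrite mulrDl (le_trans (ler_normD _ _))// lerD//; [exact: Ha|exact: Hb].
- case=> s1 [s2 [/IHa[Ca Ca0 Ha] /IHb[Cb Cb0 Hb] le12]].
  exists (Ca * Cb * M `^ (s1 + s2 - s)); first by rewrite !mulr_ge0// powR_ge0.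
  move=> z /[dup] tz [z0 zM _ _]; rewrite normrM.
  apply: (@le_trans _ _ ((Ca * scale z `^ s1) * (Cb * scale z `^ s2))).
    by rewrite ler_pM//; [exact: Ha|exact: Hb].
  rewrite mulrACA -mulrA [leRHS](_ : _ = Ca * (Cb * (M `^ (s1 + s2 - s) * scale z `^ s))); last ring.
  rewrite -powRD; last by rewrite (gt_eqF z0) implybT.
  rewrite !ler_wpM2l//; exact: powR_le_weight.
- move=> sa; exists (M `^ (a - s)); first exact: powR_ge0.
  move=> z [z0 zM _ _]; rewrite ger0_norm ?powR_ge0//; exact: powR_le_weight.
Qed.

End Weights.

(** * Integrals of functions of one variable *)

Section Monotone.
Context d (X : measurableType d) {R : realType}.
Variable mu : {measure set X -> \bar R}.

(** Every simple function below f is below g: comparing the suprema that define the integrals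
    requires no measurability. *)
Lemma le_integral_ge0 (f g : X -> \bar R) :
  (forall x, (0 <= f x)%E) -> (forall x, (f x <= g x)%E) ->
  (\int[mu]_x f x <= \int[mu]_x g x)%E.
Proof.
move=> f0 fg; rewrite !ge0_integralTE//; last by move=> x; exact: le_trans (fg x).
by apply: le_ereal_sup => _ [h hf <-]; exists h => // x; exact: le_trans (fg x).
Qed.

End Monotone.

Section OneVariable.
Context {R : realType}.
Notation mu := (@lebesgue_measure R).

Lemma integral_derive (f F : R -> R) (a b : R) : a <= b ->
  (forall x, a <= x <= b -> is_derive x 1 F (f x)) ->
  (forall x, a <= x <= b -> {for x, continuous f}) ->
  (\int[mu]_(x in `[a, b]) (f x)%:E = (F b - F a)%:E)%E.
Proof.
rewrite le_eqVlt => /predU1P[<- _ _|ab dF cf].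
  by rewrite set_itv1 integral_set1 subrr.
have cF x : a <= x <= b -> {for x, continuous F}.
  move=> /dF [dx _]; apply: differentiable_continuous.
  exact/derivable1_diffP.
rewrite (@continuous_FTC2 _ f F)//.
- apply: continuous_in_subspaceT => x; rewrite inE/= in_itv/=; exact: cf.
- split.
  + by move=> x; rewrite in_itv/= => /andP[/ltW ax /ltW xb]; case: (dF x) => //; rewrite ax.
  + by apply: cvg_at_right_filter; apply: cF; rewrite lexx ltW.
  + by apply: cvg_at_left_filter; apply: cF; rewrite lexx ltW.
- move=> x; rewrite in_itv/= => /andP[/ltW ax /ltW xb].
  by rewrite derive1E; case: (dF x) => //; rewrite ax.
Qed.

(** The fundamental theorem of calculus bounds the integrals over the closed intervals
    [a + h, b - h] by 2 M, uniformly in h; monotone convergence does the rest. *)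
Lemma integral_oo_lty (f F : R -> R) (a b M : R) : a < b ->
  (forall x, a < x < b -> is_derive x 1 F (f x)) ->
  (forall x, a < x < b -> {for x, continuous f}) ->
  (forall x, a < x < b -> 0 <= f x) ->
  (forall x, a < x < b -> `|F x| <= M) ->
  (\int[mu]_(x in `]a, b[) (f x)%:E < +oo)%E.
Proof.
move=> ab dF cf f0 FM.
pose h k : R := (b - a) / k.+3%:R.
have h0 k : 0 < h k by rewrite divr_gt0// subr_gt0.
have hd k : h k * k.+3%:R = b - a by rewrite /h divfK.
have hlt k : h k + h k < b - a.
  have k3 : (3 : R) <= k.+3%:R by rewrite ler_nat.
  by rewrite -(hd k); have := h0 k; nra.
pose E k : set (measurableTypeR R) := `[a + h k, b - h k]%classic.
have Eoo k x : E k x -> a < x < b.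
  rewrite /E/= in_itv/= => /andP[ax xb].
  by have ? := h0 k; apply/andP; split; lra.
have EE : \bigcup_k E k = `]a, b[%classic.
  apply/seteqP; split=> x /=.
    by move=> [k _ /Eoo]; rewrite in_itv.
  rewrite in_itv/= => /andP[ax xb].
  have m0 : 0 < Num.min (x - a) (b - x) by rewrite lt_min !subr_gt0 ax.
  have [k Hk] : exists k, h k <= Num.min (x - a) (b - x).
    have := archi_boundP (ltW (divr_gt0 (ltac:(by rewrite subr_gt0) : 0 < b - a) m0)).
    set N := Num.bound _ => HN; exists N.
    rewrite ler_pdivrMr// mulrC -ler_pdivrMr//; apply: (le_trans (ltW HN)).
    by rewrite ler_nat ltnW// ltnW// ltnW.
  exists k => //; rewrite /E/= in_itv/=; move: Hk; rewrite le_min => /andP[].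
  by move=> ? ?; apply/andP; split; lra.
rewrite -EE; apply: (@le_lt_trans _ _ (M + M)%:E); last exact: ltry.
have mf k : measurable_fun (E k) (EFin \o f).
  apply/measurable_EFinP; apply: subspace_continuous_measurable_fun; first exact: measurable_itv.
  by apply: continuous_in_subspaceT => x; rewrite inE => /Eoo; exact: cf.
have nd : nondecreasing_seq E.
  move=> i j ij; apply/subsetPset => x; rewrite /E/= !in_itv/= => /andP[ax xb].
  have hij : h j <= h i by rewrite ler_pM2l ?subr_gt0// lef_pV2 ?posrE// ler_nat.
  by apply/andP; split; lra.
have mE i : measurable (E i) by exact: measurable_itv.
have fE0 i x : E i x -> (0 <= (EFin \o f) x)%E by move=> /Eoo /f0; rewrite lee_fin.
have := @ge0_nondecreasing_set_cvg_integral _ (measurableTypeR R) _ E (EFin \o f) mu nd mE mf fE0.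
move=> /cvg_lim <-//.
apply: lime_le.
  apply: ereal_nondecreasing_is_cvgn.
  exact: (@ge0_nondecreasing_set_nondecreasing_integral _ (measurableTypeR R) _ E (EFin \o f) mu).
apply: nearW => k.
have EkE x : a + h k <= x <= b - h k -> E k x by rewrite /E/= in_itv.
have le_k : a + h k <= b - h k by have := hlt k; lra.
have -> : (\int[mu]_(x in E k) (EFin \o f) x = (F (b - h k) - F (a + h k))%:E)%E.
  by apply: integral_derive => // x /EkE/Eoo; [exact: dF|exact: cf].
have H c : E k c -> `|F c| <= M by move=> /Eoo; exact: FM.
have h1 : `|F (b - h k)| <= M by apply/H/EkE; rewrite lexx le_k.
have h2 : `|F (a + h k)| <= M by apply/H/EkE; rewrite lexx le_k.
by rewrite lee_fin (le_trans (ler_norm _))// (le_trans (ler_normB _ _))// lerD.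
Qed.

Lemma is_derive_powR_affine (c s b x : R) : b != 1 -> 0 < c + s * x ->
  s ^+ 2 = 1 ->
  is_derive x 1 (fun y : R => s / (1 - b) * (c + s * y) `^ (1 - b)) ((c + s * x) `^ (- b)).
Proof.
move=> b1 cx s2.
have H0 : is_derive x 1 (fun y : R => c + s * y) s.
  have := is_deriveD (is_derive_cst c x 1) (is_deriveZ s (is_derive_id x (1 : R))).
  by move/is_derive_eq; apply; rewrite add0r [_ *: _]mulr1.
have H1 := @is_derive_powR _ _ (fun y : R => c + s * y) x 1 s (1 - b) cx H0.
apply: (is_derive_eq (is_deriveZ (s / (1 - b)) H1)).
have b0 : 1 - b != 0 by rewrite subr_eq0 eq_sym.
rewrite /GRing.scale/= [1 - b - 1]addrAC subrr add0r.
transitivity (s ^+ 2 * (c + s * x) `^ (- b)); last by rewrite s2 mul1r.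
by field.
Qed.

(** The sign s selects the end of the interval at which the singularity may lie. *)
Lemma integral_power_lty (c s b l u : R) : b < 1 -> s ^+ 2 = 1 -> l < u ->
  (forall x, l < x < u -> 0 < c + s * x) ->
  (\int[mu]_(x in `]l, u[) ((c + s * x) `^ (- b))%:E < +oo)%E.
Proof.
move=> b1 s2 lu pos.
have b1' : 0 < 1 - b by rewrite subr_gt0.
apply: (@integral_oo_lty _ (fun y : R => s / (1 - b) * (c + s * y) `^ (1 - b)) _ _
   ((1 - b)^-1 * (`|c| + `|l| + `|u|) `^ (1 - b))) => //.
- by move=> x /pos cx; apply: is_derive_powR_affine => //; rewrite lt_eqF.
- move=> x /pos cx.
  apply: (@continuous_comp _ _ _ (fun x => c + s * x) (fun y : R => y `^ (- b))).
    by apply: cvgD; [exact: cvg_cst|apply: cvgM; [exact: cvg_cst|exact: cvg_id]].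
  apply: differentiable_continuous; apply/derivable1_diffP.
  by apply: derivable_powR; rewrite in_itv/= andbT.
- by move=> x _; exact: powR_ge0.
- move=> x lxu; rewrite normrM [X in _ * X]ger0_norm ?powR_ge0//.
  have s1 : `|s| = 1 by apply/eqP; rewrite -(@eqrXn2 _ 2)// real_normK ?num_real// s2 expr1n.
  rewrite normrM s1 mul1r ger0_norm ?invr_ge0 ?(ltW b1')// ler_pM2l ?invr_gt0//.
  have cs : c + s * x <= `|c| + `|l| + `|u|.
    rewrite -addrA lerD ?ler_norm// (le_trans (ler_norm _))// normrM s1 mul1r.
    move: lxu => /andP[lx xu]; case: (ger0P x) => x0.
      have := ler_norm u; have := normr_ge0 l; lra.
    by have := ler_norm (- l); rewrite normrN; have := normr_ge0 u; lra.
  have c0 := ltW (pos _ lxu).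
  by rewrite ge0_ler_powR ?nnegrE ?(ltW b1')// !addr_ge0.
Qed.

End OneVariable.

(** * Lebesgue measure on products *)

Section ProductLebesgue.
Context {R : realType}.
Notation mR := (measurableTypeR R).
Notation mu := (@lebesgue_measure R).

(** A constant for the Lebesgue measure of the plane, to which sigma-finiteness is attached:
    Fubini's theorem asks for it when the plane is itself a factor of a product. *)
Definition lebesgue2 : set (mR * mR) -> \bar R := (mu \x mu)%E.

HB.instance Definition _ := Measure.on lebesgue2.

Lemma lebesgue2_sigma_finite : sigma_finite [set: mR * mR] lebesgue2.
Proof.
by case: (@lebesgue_integral_fubini.measure_function_Measure_isSigmaFinite__to__measure_function_isSigmaFinite
  _ _ mR mR R mu mu).
Qed.

HB.instance Definition _ := Measure_isSigmaFinite.Build _ _ _ lebesgue2 lebesgue2_sigma_finite.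

Definition lebesgue3 : set (mR * mR * mR) -> \bar R := (lebesgue2 \x mu)%E.

HB.instance Definition _ := Measure.on lebesgue3.

Lemma lebesgue3_sigma_finite : sigma_finite [set: mR * mR * mR] lebesgue3.
Proof.
by case: (@lebesgue_integral_fubini.measure_function_Measure_isSigmaFinite__to__measure_function_isSigmaFinite
  _ _ (mR * mR)%type mR R lebesgue2 mu).
Qed.

HB.instance Definition _ := Measure_isSigmaFinite.Build _ _ _ lebesgue3 lebesgue3_sigma_finite.

Lemma leb3E D (f : mR * mR * mR -> \bar R) :
  (\int[leb3]_(x in D) f x = \int[lebesgue3]_(x in D) f x)%E.
Proof. by []. Qed.

Lemma tonelli3 (f : mR * mR * mR -> \bar R) :
  measurable_fun [set: mR * mR * mR] f -> (forall x, 0 <= f x)%E ->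
  (\int[leb3]_x f x = \int[lebesgue2]_x \int[mu]_y f (x, y))%E.
Proof.
move=> mf f0; have H := @fubini_tonelli1 _ _ _ _ R lebesgue2 mu f mf f0.
by rewrite leb3E; transitivity (\int[(lebesgue2 \x mu)%E]_z f z)%E; [|rewrite H].
Qed.

Lemma tonelli2 (f : mR * mR -> \bar R) :
  measurable_fun [set: mR * mR] f -> (forall x, 0 <= f x)%E ->
  (\int[lebesgue2]_x f x = \int[mu]_x \int[mu]_y f (x, y))%E.
Proof.
move=> mf f0; have H := @fubini_tonelli1 _ _ _ _ R mu mu f mf f0.
by transitivity (\int[(mu \x mu)%E]_z f z)%E; [|rewrite H].
Qed.

End ProductLebesgue.

(** * Integrability of the singular weight *)

Section SingularWeight.
Context {R : realType}.
Notation mR := (measurableTypeR R).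
Notation mu := (@lebesgue_measure R).

(** Open intervals, as in [integral_oo_lty], that cover [-1, 1] up to the origin. *)
Definition punctured : set mR := `]-2, 0[ `|` `]0, 2[.

(** |x|^(-b) near the origin, with the value +oo at 0: a bound by it holds trivially on the
    coordinate planes, which therefore need not be removed as null sets. *)
Definition singular (b : R) : mR -> \bar R :=
  ((fun x : mR => (`|x| `^ (- b))%:E) \_ punctured \+ (cst +oo%E) \_ [set (0 : R)%R])%E.

Lemma singular_ge0 b x : (0 <= singular b x)%E.
Proof. by rewrite /singular adde_ge0// erestrict_ge0// => y _; rewrite ?lee_fin ?powR_ge0 ?leey. Qed.

Lemma singular0 b : singular b (0 : R) = +oo%E.
Proof.
rewrite /singular !patchE [X in _ + (if X then _ else _)]mem_set//.
rewrite memNset; first by rewrite add0e.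
by case=> /=; rewrite in_itv/= ltxx// andbF.
Qed.

Lemma singularE b (x : R) : x != 0 -> `|x| <= 1 -> singular b x = (`|x| `^ (- b))%:E.
Proof.
move=> x0 x1; rewrite /singular !patchE mem_set.
  by rewrite memNset ?adde0//= => /eqP; apply/negP.
have := lt_total x0; rewrite ler_norml in x1; case/orP => h; [left|right] => /=;
  rewrite in_itv/=; move/andP: x1 => [? ?]; apply/andP; split; lra.
Qed.

Lemma singular_gt0 b (x : R) : `|x| <= 1 -> (0 < singular b x)%E.
Proof.
have [->|x0 x1] := eqVneq (x : R) 0; first by rewrite singular0 ltry.
by rewrite singularE// lte_fin powR_gt0// normr_gt0.
Qed.

Lemma measurable_punctured : measurable punctured.
Proof. by apply: measurableU; exact: measurable_itv. Qed.

Lemma measurable_norm_powR b : measurable_fun [set: mR] (fun x : mR => (`|x| `^ (- b))%:E).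
Proof.
apply/measurable_EFinP.
apply: (measurableT_comp (@measurable_powR R (- b))).
exact: normr_measurable.
Qed.

Lemma measurable_singular b : measurable_fun [set: mR] (singular b).
Proof.
apply: emeasurable_funD.
- apply: (measurable_restrictT _ measurable_punctured).1.
  by apply: measurable_funTS; exact: measurable_norm_powR.
- apply: (measurable_restrictT _ (measurable_set1 _)).1.
  exact: measurable_cst.
Qed.

Lemma integral_singular_lty b : b < 1 -> (\int[mu]_x singular b x < +oo)%E.
Proof.
move=> b1; rewrite /singular ge0_integralD//; last 4 first.
- by move=> x _; apply: erestrict_ge0 => y _; rewrite lee_fin powR_ge0.
- apply: (measurable_restrictT _ measurable_punctured).1.
  by apply: measurable_funTS; exact: measurable_norm_powR.
- by move=> x _; apply: erestrict_ge0 => y _; rewrite leey.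
- apply: (measurable_restrictT _ (measurable_set1 _)).1.
  exact: measurable_cst.
rewrite -!integral_mkcond integral_cst; last exact: measurable_set1.
rewrite [X in (_ + _ * X)%E](_ : _ = 0%E); last exact: lebesgue_measure_set1.
rewrite mule0 adde0 /punctured.
rewrite ge0_integral_setU; last 5 first.
- exact: measurable_itv.
- exact: measurable_itv.
- by apply: measurable_funTS; exact: measurable_norm_powR.
- by move=> x _; rewrite lee_fin powR_ge0.
- apply/disj_setPS => x /= []; rewrite !in_itv/= => /andP[_ h1] /andP[h2 _].
  by have := lt_trans h1 h2; rewrite ltxx.
rewrite lte_add_pinfty//.
- rewrite (eq_integral (fun x : mR => ((0 + (-1) * x) `^ (- b))%:E)); last first.
    move=> x; rewrite inE/= in_itv/= => /andP[_ x0].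
    by rewrite ltr0_norm// add0r mulN1r.
  apply: integral_power_lty => //; first by rewrite sqrrN expr1n.
  by move=> x /andP[_ x0]; rewrite add0r mulN1r oppr_gt0.
- rewrite (eq_integral (fun x : mR => ((0 + 1 * x) `^ (- b))%:E)); last first.
    move=> x; rewrite inE/= in_itv/= => /andP[x0 _].
    by rewrite gtr0_norm// add0r mul1r.
  apply: integral_power_lty => //; first by rewrite expr1n.
  by move=> x /andP[x0 _]; rewrite add0r mul1r.
Qed.

Definition singular3 (b : R) (x : mR * mR * mR) : \bar R :=
  (singular b x.1.1 * singular b x.1.2 * (\1_(`[0, 1]%classic : set mR) x.2)%:E)%E.

Lemma measurable_singular3 b : measurable_fun [set: mR * mR * mR] (singular3 b).
Proof.
apply: emeasurable_funM; first apply: emeasurable_funM.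
- by apply: (measurableT_comp (measurable_singular b)); apply: measurableT_comp.
- by apply: (measurableT_comp (measurable_singular b)); apply: measurableT_comp.
- by apply/measurable_EFinP; apply: measurableT_comp.
Qed.

Lemma singular3_ge0 b x : (0 <= singular3 b x)%E.
Proof. by rewrite /singular3 !mule_ge0// ?singular_ge0// lee_fin. Qed.

Lemma integral_singular3_lty b : b < 1 -> (\int[leb3]_x singular3 b x < +oo)%E.
Proof.
move=> b1; have Ioo := integral_singular_lty b1.
have I0 : (0 <= \int[mu]_x singular b x)%E by apply: integral_ge0 => x _; exact: singular_ge0.
rewrite (tonelli3 (measurable_singular3 b) (singular3_ge0 b)).
have E1 (x : mR * mR) : (\int[mu]_y singular3 b (x, y) = singular b x.1 * singular b x.2)%E.
  rewrite /singular3/= ge0_integralZl//; last 2 first.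
  - by apply/measurable_EFinP; exact: measurable_indic.
  - by rewrite mule_ge0 ?singular_ge0.
  rewrite integral_indic// setIT [X in (_ * X)%E](_ : _ = 1%E) ?mule1//.
  by rewrite /= lebesgue_measure_itv/= lte_fin ltr01 oppr0 adde0.
have E2 (x : mR) : (\int[mu]_y (singular b x * singular b y)
    = (\int[mu]_y singular b y) * singular b x)%E.
  rewrite ge0_integralZl; first by rewrite muleC.
  - exact: measurableT.
  - exact: measurable_singular.
  - by move=> y _; exact: singular_ge0.
  - exact: singular_ge0.
rewrite (eq_integral (fun x : mR * mR => singular b x.1 * singular b x.2)%E); last first.
  by move=> x _; exact: E1.
rewrite tonelli2; last 2 first.
- by apply: emeasurable_funM; apply: (measurableT_comp (measurable_singular b)).
- by move=> x; rewrite mule_ge0 ?singular_ge0.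
rewrite (eq_integral (fun x : mR => (\int[mu]_y singular b y) * singular b x)%E); last first.
  by move=> x _; exact: E2.
rewrite ge0_integralZl//; last 2 first.
- exact: measurable_singular.
- by move=> y _; exact: singular_ge0.
by rewrite lte_mul_pinfty// ge0_fin_numE.
Qed.

End SingularWeight.

(** * Mixed norms of fields with a weight bound *)

Section MixedNorm.
Context {R : realType}.
Notation mR := (measurableTypeR R).

Lemma cyl_coord (x : 'rV[R]_3) : cyl x -> [/\ x 0 i1 ^+ 2 + x 0 i2 ^+ 2 <= 1, `|x 0 i1| <= 1,
  `|x 0 i2| <= 1 & 0 <= x 0 i3 <= 1].
Proof.
move=> [r1 x3].
have r2 : x 0 i1 ^+ 2 + x 0 i2 ^+ 2 <= 1.
  have s0 : 0 <= x 0 i1 ^+ 2 + x 0 i2 ^+ 2 by rewrite addr_ge0 ?sqr_ge0.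
  rewrite -(sqr_sqrtr s0) -/(Defs.radius x).
  by rewrite exprn_ile1// sqrtr_ge0.
by split=> //; rewrite -(expr_le1 (n := 2))// real_normK ?num_real//;
  have := sqr_ge0 (x 0 i1); have := sqr_ge0 (x 0 i2); lra.
Qed.

Lemma pt1 (y : mR * mR * mR) : pt y 0 i1 = y.1.1. Proof. by rewrite !mxE. Qed.
Lemma pt2 (y : mR * mR * mR) : pt y 0 i2 = y.1.2. Proof. by rewrite !mxE. Qed.
Lemma pt3 (y : mR * mR * mR) : pt y 0 i3 = y.2. Proof. by rewrite !mxE. Qed.

(** J is the integral of the singular weight; that it serves for all K and g makes the bound
    usable uniformly in time. *)
Lemma Lp_norm_singular (b p : R) : b < 1 -> 0 < p ->
  exists2 J : R, 0 <= J & forall (K : R) (g : 'rV[R]_3 -> R), 0 < K ->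
    (forall x, cyl x -> x 0 i1 != 0 -> x 0 i2 != 0 ->
      `|g x| `^ p <= K * (`|x 0 i1| `^ (- b) * `|x 0 i2| `^ (- b))) ->
    (Lp_norm p%:E g <= ((K * J) `^ p^-1)%:E)%E.
Proof.
move=> b1 p0; have Joo := integral_singular3_lty b1.
have J0 : (0 <= \int[leb3]_x singular3 b x)%E.
  by apply: integral_ge0 => x _; exact: singular3_ge0.
exists (fine (\int[leb3]_x singular3 b x)); first exact: fine_ge0.
move=> K g K0 gK; rewrite /Lp_norm unlock /=.
have le1 : (\int[leb3]_x (`|((EFin \o g \o pt) \_ cyl3) x| `^ p)%E <=
           \int[leb3]_x (K%:E * singular3 b x))%E.
  apply: le_integral_ge0 => y; first exact: poweR_ge0.
  rewrite patchE; case: ifPn => [|_]; last first.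
    by rewrite abse0 poweR0r ?gt_eqF// mule_ge0 ?singular3_ge0// lee_fin ltW//.
  rewrite inE /cyl3/= => cy; have [_ y1 y2 y3] := cyl_coord cy.
  rewrite pt1 in y1; rewrite pt2 in y2; rewrite pt3 in y3.
  have -> : singular3 b y = (singular b y.1.1 * singular b y.1.2)%E.
    by rewrite /singular3 indicE mem_set ?mule1//= in_itv.
  have [y10|y10] := eqVneq (y.1.1 : R) 0.
    by rewrite y10 singular0 gt0_mulye ?singular_gt0// gt0_muley ?lte_fin// leey.
  have [y20|y20] := eqVneq (y.1.2 : R) 0.
    by rewrite y20 singular0 gt0_muley ?singular_gt0// gt0_muley ?lte_fin// leey.
  rewrite !singularE// -!EFinM lee_fin.
  by have := gK _ cy; rewrite pt1 pt2; apply.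
have : (\int[leb3]_x (`|((EFin \o g \o pt) \_ cyl3) x| `^ p)%E <=
        (K * fine (\int[leb3]_x singular3 b x))%:E)%E.
  apply: (le_trans le1); rewrite ge0_integralZl//; last 3 first.
  - exact: measurable_singular3.
  - by move=> x _; exact: singular3_ge0.
  - by rewrite lee_fin ltW.
  by rewrite EFinM fineK// ge0_fin_numE.
have I0 : (0 <= \int[leb3]_x (`|((EFin \o g \o pt) \_ cyl3) x| `^ p))%E.
  by apply: integral_ge0 => x _; exact: poweR_ge0.
have KJ0 : 0 <= K * fine (\int[leb3]_x singular3 b x).
  by apply: mulr_ge0; [exact: ltW|exact: fine_ge0].
move=> le2; rewrite -poweR_EFin; apply: gt0_ler_poweR le2.
- by rewrite invr_ge0 ltW.
- by rewrite in_itv; apply/andP; split; [exact: I0|exact: leey].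
- by rewrite in_itv; apply/andP; split; [exact: KJ0|exact: leey].
Qed.

End MixedNorm.

(** Under this condition A^(-s) belongs to L^q(0, T; L^p(D)); see [in_LqLp_weight]. *)
Definition subcritical {R : realType} (n : nat) (s p : R) (q : \bar R) : Prop :=
  match q with r%:E => n%:R * (s * p - 1) * r < p | _ => s * p < 1 end.

Section WeightedFields.
Context {R : realType}.
Notation mR := (measurableTypeR R).
Notation mu := (@lebesgue_measure R).

Lemma ler_powRN (x y a : R) : 0 < x -> x <= y -> 0 <= a -> y `^ (- a) <= x `^ (- a).
Proof.
move=> x0 xy a0; have y0 := lt_le_trans x0 xy.
by rewrite !powRN lef_pV2 ?posrE ?powR_gt0// ge0_ler_powR// nnegrE ltW.
Qed.

Lemma enorm_le m k (A : 'M[R]_(m, k)) (c : R) : 0 <= c ->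
  (forall i j, `|A i j| <= c) -> enorm A <= (m * k)%:R * c.
Proof.
move=> c0 Ac.
have mkc0 : 0 <= (m * k)%:R * c by rewrite mulr_ge0.
rewrite /enorm -(ger0_norm mkc0) -sqrtr_sqr ler_wsqrtr//.
apply: (@le_trans _ _ (\sum_(i < m) \sum_(j < k) c ^+ 2)).
  apply: ler_sum => i _; apply: ler_sum => j _.
  by rewrite -(@real_normK _ (A i j)) ?num_real// lerXn2r ?nnegrE.
rewrite !sumr_const !card_ord -mulrnA mulnC exprMn -[leLHS]mulr_natl.
by rewrite ler_wpM2r ?sqr_ge0// expr2 -natrM ler_nat; case: (m * k)%N => // a; rewrite leq_pmulr.
Qed.

Lemma enorm_ge0 m k (A : 'M[R]_(m, k)) : 0 <= enorm A.
Proof. exact: sqrtr_ge0. Qed.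

(** The exponent s p is split into b, used for the integration in space, and theta, used for
    the integration in time. If s p < 1 nothing is left to the time; otherwise b is taken just
    below 1, the deficit eta being at most half of what the strict inequality allows. *)
Lemma split_exponent (s p : R) (n : nat) (q : \bar R) :
  1 <= p -> 0 <= s -> (0 < n)%N -> (1 <= q)%E -> subcritical n s p q ->
  exists b theta : R, [/\ 0 <= b < 1, 0 <= theta, s * p <= theta + b &
    match q return Prop with r%:E => n%:R * theta * r < p | _ => theta = 0 end].
Proof.
move=> p1 s0 n0 q1; have := mulr_ge0 s0 (le_trans ler01 p1).
rewrite /subcritical; move: (s * p) => a a0 H; have n0' : 0 < (n%:R : R) by rewrite ltr0n.
have [a1|a1] := ltP a 1.
  exists a, 0; split; rewrite ?a0 ?add0r//.
  by case: q {q1 H} => [r| |]//; rewrite mulr0 mul0r (lt_le_trans ltr01).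
case: q q1 H => [r| |]//; last by rewrite ltNge a1.
rewrite lee_fin => r1 H; have r0 : 0 < r by exact: lt_le_trans r1.
have nr0 : 0 < 2 * (n%:R * r) by rewrite !mulr_gt0.
pose eta := Num.min 1 ((p - n%:R * (a - 1) * r) / (2 * (n%:R * r))).
have eta0 : 0 < eta by rewrite lt_min ltr01 divr_gt0// subr_gt0.
have eta1 : eta <= 1 by rewrite ge_min lexx.
have eta2 : eta * (2 * (n%:R * r)) <= p - n%:R * (a - 1) * r.
  by rewrite -ler_pdivlMr// ge_min lexx orbT.
exists (1 - eta), (a - (1 - eta)); split; [apply/andP; split; lra|lra|lra|].
have : 0 < eta * (n%:R * r) by rewrite !mulr_gt0.
rewrite (_ : n%:R * (a - (1 - eta)) * r = n%:R * (a - 1) * r + eta * (n%:R * r)); last ring.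
have -> : eta * (n%:R * r) = (eta * (2 * (n%:R * r))) / 2 by field.
lra.
Qed.

Lemma LqLp_norm_lty m k (u : R -> 'rV[R]_3 -> 'M[R]_(m, k)) (T p c C : R) (q : \bar R) :
  0 < T -> (1 <= q)%E -> 0 <= C ->
  (match q return Prop with r%:E => c * r < 1 | _ => c = 0 end) ->
  (forall t : R, 0 < t < T -> (Lp_norm p%:E (fun x => enorm (u t x)) <= (C * (T - t) `^ (- c))%:E)%E) ->
  (LqLp_norm T q p%:E u < +oo)%E.
Proof.
move=> T0 q1 C0 cq H; rewrite /LqLp_norm unlock.
case: q q1 cq => [r| |]//=.
- rewrite lee_fin => r1 cr; have r0 : 0 < r by exact: lt_le_trans r1.
  apply: poweR_lty.
  pose I : set mR := `]0, T[%classic.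
  pose G (t : mR) : \bar R := ((C `^ r)%:E * ((T + (-1) * t) `^ (- (c * r)))%:E)%E.
  have : (\int[mu]_(t in I) G t < +oo)%E.
    rewrite /G ge0_integralZl; last 4 first.
    - exact: measurable_itv.
    - apply/measurable_EFinP; apply: (measurableT_comp (@measurable_powR R (- (c * r)))).
      by apply: measurable_funD => //; apply: measurable_funM.
    - by move=> x _; rewrite lee_fin powR_ge0.
    - by rewrite lee_fin powR_ge0.
    rewrite lte_mul_pinfty ?lee_fin ?powR_ge0//.
    apply: integral_power_lty => //; first by rewrite sqrrN expr1n.
    by move=> x /andP[_ xT]; rewrite mulN1r subr_gt0.
  apply: le_lt_trans.
  rewrite [leRHS]integral_mkcond; apply: le_integral_ge0 => t; first exact: poweR_ge0.
  rewrite !patchE; case: ifPn => [|_]; last by rewrite abse0 poweR0r ?gt_eqF.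
  rewrite inE/= in_itv/= => tT; rewrite gee0_abs ?Lnorm_ge0//.
  have -> : G t = ((C * (T - t) `^ (- c))%:E `^ r)%E.
    by rewrite /G poweR_EFin powRM ?powR_ge0// -powRrM mulN1r mulNr EFinM.
  apply: gt0_ler_poweR; last exact: H.
  + exact: ltW.
  + by rewrite in_itv; apply/andP; split; [exact: Lnorm_ge0|exact: leey].
  + by rewrite in_itv; apply/andP; split; [rewrite /= lee_fin mulr_ge0 ?powR_ge0|exact: leey].
- move=> _ c0; case: ifP => // _; apply: (@le_lt_trans _ _ C%:E); last exact: ltry.
  apply/ess_supP/nearW => t /=; rewrite patchE; case: ifPn => [|_]; last by rewrite abse0 lee_fin.
  rewrite inE/= in_itv/= => tT; rewrite gee0_abs ?Lnorm_ge0//.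
  by apply: (le_trans (H _ tT)); rewrite c0 oppr0 powRr0 mulr1.
Qed.

(** From A >= (T - t)^n and A >= 2 |x_1 x_2|, one gets, when s p <= theta + b,
    A^(-s p) <= C (T - t)^(- n theta) |x_1|^(-b) |x_2|^(-b), which is integrable in space for
    b < 1 and leaves a power of T - t for the norm in time. *)
Lemma in_LqLp_weight m k (u : R -> 'rV[R]_3 -> 'M[R]_(m, k)) (T s p C : R) (n : nat) (q : \bar R) :
  0 < T -> (0 < n)%N -> 1 <= p -> (1 <= q)%E -> 0 <= s ->
  (forall i j, measurable_fun
     [set z : mR * (mR * mR * mR) | (z.1 \in `]0, T[) /\ cyl3 z.2]
     (fun z => u z.1 (pt z.2) i j : mR)) ->
  (forall (t : R) x, 0 < t < T -> cyl x -> forall i j, `|u t x i j| <= C * scale T n (t, x) `^ (- s)) ->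
  subcritical n s p q ->
  in_LqLp T q p%:E u.
Proof.
move=> T0 n0 p1 q1 s0 mu_ uC cond; split=> //.
have p0 : 0 < p by exact: lt_le_trans p1.
have [b [th [/andP[b0 b1] th0 sp_le thq]]] := split_exponent p1 s0 n0 q1 cond.
have [J J0 HJ] := Lp_norm_singular b1 p0.
pose M := T ^+ n + 1.
pose C1 := (m * k)%:R * `|C| + 1.
have C10 : 0 < C1 by rewrite ltr_wpDl// mulr_ge0.
pose L := C1 `^ p * M `^ (th + b - s * p).
have M0 : 0 < M by rewrite ltr_wpDl// exprn_ge0// ltW.
have L0 : 0 < L by rewrite mulr_gt0// powR_gt0.
apply: (@LqLp_norm_lty _ _ _ _ _ (n%:R * th / p) ((L * J) `^ p^-1)) => //.
- exact: powR_ge0.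
- case: q q1 thq {cond} => [r| |]// _.
    by move=> h; rewrite mulrAC ltr_pdivrMr// mul1r.
  by move=> ->; rewrite mulr0 mul0r.
move=> t /[dup] tT /andP[t0 tT'].
have tau0 : 0 < T - t by rewrite subr_gt0.
have d0 : 0 < (T - t) ^+ n by rewrite exprn_gt0.
have -> : (L * J) `^ p^-1 * (T - t) `^ (- (n%:R * th / p)) =
    (L * ((T - t) `^ (- (n%:R * th))) * J) `^ p^-1.
  rewrite [L * _ * J]mulrAC [RHS]powRM ?powR_ge0 ?(mulr_ge0 (ltW L0) J0)//.
  by rewrite -powRrM mulNr.
apply: (HJ (L * (T - t) `^ (- (n%:R * th))) (fun x => enorm (u t x))); first by rewrite mulr_gt0 ?powR_gt0.
move=> x cx x1 x2; have [r1 _ _ _] := cyl_coord cx.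
set A := scale T n (t, x).
have dA : (T - t) ^+ n <= A by rewrite /A /scale/= -addrA lerDl addr_ge0 ?sqr_ge0.
have A0 : 0 < A by exact: lt_le_trans dA.
have AM : A <= M.
  rewrite /A /scale/= -addrA lerD// lerXn2r ?nnegrE ?ltW//.
  by rewrite gtrBl.
have le1 : `|enorm (u t x)| <= C1 * A `^ (- s).
  rewrite ger0_norm ?enorm_ge0//.
  apply: (@le_trans _ _ ((m * k)%:R * (`|C| * A `^ (- s)))).
    apply: enorm_le => [|i j]; first by rewrite mulr_ge0 ?powR_ge0.
    by apply: (le_trans (uC _ _ tT cx i j)); rewrite ler_wpM2r ?powR_ge0 ?ler_norm.
  by rewrite mulrA ler_wpM2r ?powR_ge0// lerDl.
apply: (@le_trans _ _ ((C1 * A `^ (- s)) `^ p)).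
  by rewrite ge0_ler_powR ?(ltW p0)// nnegrE mulr_ge0 ?powR_ge0 ?(ltW C10).
rewrite powRM ?powR_ge0 ?(ltW C10)// -powRrM /L -!mulrA ler_wpM2l ?powR_ge0//.
apply: (@le_trans _ _ (M `^ (- s * p - - (th + b)) * A `^ (- (th + b)))).
  by apply: powR_le_weight => //; rewrite mulNr lerN2.
rewrite mulNr opprK addrC ler_wpM2l ?powR_ge0// opprD powRD; last by rewrite (gt_eqF A0) implybT.
rewrite ler_pM ?powR_ge0//.
  rewrite -mulrN powRrM powR_mulrn ?(ltW tau0)//.
  exact: ler_powRN.
rewrite -powRM ?normr_ge0//; apply: ler_powRN => //.
  by rewrite mulr_gt0 ?normr_gt0.
rewrite /A /scale/=; apply: (@le_trans _ _ (x 0 i1 ^+ 2 + x 0 i2 ^+ 2)); last first.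
  by rewrite -addrA lerDr ltW.
rewrite -(@real_normK _ (x 0 i1)) ?num_real// -(@real_normK _ (x 0 i2)) ?num_real//.
by have := sqr_ge0 (`|x 0 i1| - `|x 0 i2|); have := normr_ge0 (x 0 i1); have := normr_ge0 (x 0 i2); nra.
Qed.

End WeightedFields.

(** * The swirling flow *)

Lemma sum_ord3 (V : zmodType) (F : 'I_3 -> V) : \sum_(j < 3) F j = F i1 + (F i2 + F i3).
Proof.
rewrite !big_ord_recl big_ord0 addr0.
by congr (F _ + (F _ + F _)); exact: val_inj.
Qed.

Section Swirl.
Context {R : realType}.
Variables (T : R) (n : nat) (m : R).
Notation mR := (measurableTypeR R).
Local Notation X := 'rV[R]_3.
Local Notation Z := (R * 'rV[R]_3)%type.
Local Notation sem := (sem T n).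
Local Notation scale := (scale T n).
Local Notation partial := (partial n).
Local Notation field := (field T n).

(** The angular velocity (1 - r^2) A^(-m). *)
Definition profile : @expr R :=
  Mul (Add (Cst 1) (Mul (Cst (-1)) (Add (Mul (Crd i1) (Crd i1)) (Mul (Crd i2) (Crd i2)))))
      (PowA (- m)).

Definition swirl (j : 'I_3) : @expr R :=
  if j == i1 then Mul (Mul (Cst (-1)) (Crd i2)) profile
  else if j == i2 then Mul (Crd i1) profile else Cst 0.

Definition sum3 (f : 'I_3 -> @expr R) : @expr R := Add (f i1) (Add (f i2) (f i3)).

Definition lap_expr (j : 'I_3) : @expr R :=
  sum3 (fun d => partial (Some d) (partial (Some d) (swirl j))).

Definition conv_expr (j : 'I_3) : @expr R :=
  sum3 (fun d => Mul (swirl d) (partial (Some d) (swirl j))).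

(** The residual of the momentum equation of the swirl with zero pressure. *)
Definition force (j : 'I_3) : @expr R :=
  Add (lap_expr j)
    (Add (Mul (Cst (-1)) (conv_expr j)) (Mul (Cst (-1)) (partial None (swirl j)))).

Lemma derive_field e d z : 0 < scale z ->
  'D_(axis d) (field e) z = field (fun j => partial d (e j)) z.
Proof.
move=> Az; have [_ ->] := is_derive_field e (axis d) Az.
by apply/rowP => j; rewrite !mxE sem_axis.
Qed.

Lemma derive_field_space e j t x : 0 < scale (t, x) ->
  'D_(e_ j) (fun y => field e (t, y)) x = field (fun i => partial (Some j) (e i)) (t, x).
Proof. by move=> Az; rewrite derive_space (derive_field e (Some j)). Qed.

Lemma laplacian_field e t x : 0 < scale (t, x) ->
  laplacian (fun y => field e (t, y)) x =
  field (fun i => sum3 (fun d => partial (Some d) (partial (Some d) (e i)))) (t, x).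
Proof.
move=> Az; rewrite /laplacian sum_ord3.
have E d : iter_derive [:: e_ d; e_ d] (fun y => field e (t, y)) x =
    field (fun i => partial (Some d) (partial (Some d) (e i))) (t, x).
  rewrite iter_derive_space iter_derive_field//; apply/rowP => j; rewrite !mxE.
  exact: (@sem_axes2 _ _ _ (Some d) (Some d)).
by rewrite !E; apply/rowP => j; rewrite !mxE.
Qed.

Lemma convection_field e t x : 0 < scale (t, x) ->
  convection (fun y => field e (t, y)) x =
  field (fun i => sum3 (fun d => Mul (e d) (partial (Some d) (e i)))) (t, x).
Proof.
move=> Az; rewrite /convection sum_ord3 !derive_field_space//.
by apply/rowP => j; rewrite !mxE.
Qed.

Lemma divergence_swirl t x : 0 < scale (t, x) ->
  divergence (fun y => field swirl (t, y)) x = 0.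
Proof.
move=> Az; rewrite /divergence sum_ord3 !derive_field_space// !mxE /=.
ring.
Qed.

Lemma navier_stokes_swirl : navier_stokes T (fun t x => field force (t, x))
  (fun t x => field swirl (t, x)) (fun _ _ => 0).
Proof.
move=> t x /andP[t0 tT] cx.
have Az : 0 < scale (t, x).
  rewrite scaleE/= -addrA ltr_pwDl ?exprn_gt0 ?subr_gt0// addr_ge0 ?sqr_ge0//.
split; first exact: differentiable_cst.
- rewrite laplacian_field// convection_field// derive1_time (derive_field swirl None)//.
  have E (a b c : R) : a - b - c = a + (- 1 * b + - 1 * c) by ring.
  have -> : gradient (fun _ : 'rV[R]_3 => 0 : R) x = 0.
    by apply/rowP => j; rewrite !mxE; exact: derive_cst.
  by rewrite subr0; apply/rowP => j; rewrite !mxE; exact: E.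
- exact: divergence_swirl.
Qed.

(** This is what the factor 1 - r^2 of [profile] is for. *)
Lemma no_slip_swirl : no_slip T (fun t x => field swirl (t, x)).
Proof.
move=> t x _ [r1 _].
have r2 : x 0 i1 * x 0 i1 + x 0 i2 * x 0 i2 = 1.
  rewrite -!expr2 -[LHS]sqr_sqrtr ?addr_ge0 ?sqr_ge0//.
  by rewrite -[Num.sqrt _]/(Defs.radius x) r1 expr1n.
by apply/rowP => j; rewrite !mxE /swirl; case: ifP => _; [|case: ifP => _];
  rewrite //= r2 mulr1 subrr mul0r mulr0.
Qed.

(** Neither the swirl nor the frame (e_r, e_theta) depends on x_3. *)
Lemma total_slip_swirl : total_slip T (fun t x => field swirl (t, x)).
Proof.
have inv (f : X -> R) (x : X) : (forall y z : X, y 0 i1 = z 0 i1 -> y 0 i2 = z 0 i2 -> f y = f z) ->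
    'D_(e_ i3) f x = 0.
  move=> fE; rewrite /derive (_ : (fun h => _) = fun=> 0) ?lim_cst//.
  apply/funext => h /=; rewrite (fE _ x) ?subrr ?scaler0//; by rewrite !mxE/= mulr0 add0r.
have sE e j (y z : X) t : (forall j, e j = swirl j) -> y 0 i1 = z 0 i1 -> y 0 i2 = z 0 i2 ->
    field e (t, y) 0 j = field e (t, z) 0 j :> R.
  move=> eE y1 y2; rewrite !mxE eE /swirl; case: ifP => _; [|case: ifP => _];
    by rewrite //= !scaleE/= y1 y2.
move=> t x _ _; split; last first.
  rewrite /dotp sum_ord3 !mxE/=; ring.
move=> _; split; apply: inv => y z y1 y2; rewrite /dotp; apply: eq_bigr => j _;
  rewrite (sE _ _ _ _ _ _ y1 y2)// /e_r /e_theta /Defs.radius !mxE y1 y2//.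
Qed.

Lemma measurable_sem e :
  measurable_fun [set: mR * (mR * mR * mR)] (fun z => sem e (z.1, pt z.2) : mR).
Proof.
have mT : measurable_fun [set: mR * (mR * mR * mR)] (fun z => T - z.1 : mR).
  apply: measurable_funB. exact: measurable_cst. exact: measurable_fst.
have mC i : measurable_fun [set: mR * (mR * mR * mR)] (fun z => pt z.2 0 i : mR).
  elim/ord3P: i.
  - under eq_fun do rewrite pt1.
    exact: (measurableT_comp measurable_fst (measurableT_comp measurable_fst measurable_snd)).
  - under eq_fun do rewrite pt2.
    exact: (measurableT_comp measurable_snd (measurableT_comp measurable_fst measurable_snd)).
  - under eq_fun do rewrite pt3.
    exact: (measurableT_comp measurable_snd measurable_snd).
have mS : measurable_fun [set: mR * (mR * mR * mR)] (fun z => scale (z.1, pt z.2) : mR).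
  apply: measurable_funD; [apply: measurable_funD|]; apply: measurable_funX.
  - exact: mT.
  - exact: mC.
  - exact: mC.
elim: e => [c|k|i|a IHa b IHb|a IHa b IHb|a] /=.
- exact: measurable_cst.
- exact: measurable_funX.
- exact: mC.
- exact: measurable_funD.
- exact: measurable_funM.
- exact: (measurableT_comp (@measurable_powR R a)).
Qed.

End Swirl.

Section SwirlBounds.
Context {R : realType}.
Variables (T : R) (n : nat) (m : R).
Hypotheses (T0 : 0 < T) (n0 : (0 < n)%N).
Notation mR := (measurableTypeR R).
Local Notation sem := (sem T n).
Local Notation weighs := (weighs n).

Lemma weighs_swirl j : weighs (swirl m j) (2^-1 - m).
Proof.
have Wh : weighs (profile m) (- m).
  exists 0, (- m); split; rewrite /= ?add0r//; split; first by right.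
  exists 0, 0; split; rewrite ?addr0//; first by right.
  by split; exists 0, 0; rewrite /= addr0; split.
rewrite /swirl; case: ifP => _; [|case: ifP => _]; last by left.
- exists (2^-1), (- m); split=> //.
  exists 0, (2^-1); split; [by right| |by rewrite add0r].
  exact: lexx.
- by exists (2^-1), (- m); split=> //; exact: lexx.
Qed.

(** Two derivatives in space cost 1, a derivative in time costs 1/n <= 1, and the convection
    term weighs 1/2 - 2 m, whence the condition m <= 1. *)
Lemma weighs_force j : m <= 1 -> weighs (force n m j) (2^-1 - m - 1).
Proof.
move=> m1; have W := weighs_swirl.
have n1 : (n%:R : R)^-1 <= 1 by rewrite invf_le1 ?ltr0n// ler1n.
have H2 d i : weighs (partial n (Some d) (partial n (Some d) (swirl m i))) (2^-1 - m - 1).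
  apply: (@weighs_le _ _ _ (2^-1 - m - 2^-1 - 2^-1)); first lra.
  by apply: weighs_space; apply: weighs_space; exact: W.
have H1 d i : weighs (Mul (swirl m d) (partial n (Some d) (swirl m i))) (2^-1 - m - 1).
  exists (2^-1 - m), (2^-1 - m - 2^-1); split; [exact: W|exact/weighs_space/W|].
  lra.
have H0 i : weighs (partial n None (swirl m i)) (2^-1 - m - 1).
  apply: (@weighs_le _ _ _ (2^-1 - m - n%:R^-1)); first lra.
  exact: (weighs_time n0 (W i)).
split; first by split; [|split]; exact: H2.
split.
  exists 0, (2^-1 - m - 1); rewrite add0r; split=> //; first by right.
by exists 0, (2^-1 - m - 1); rewrite add0r; split=> //; right.
Qed.

Lemma scale_gt0 t x : t < T -> 0 < scale T n (t, x).
Proof.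
by move=> tT; rewrite /scale/= -addrA ltr_pwDl ?exprn_gt0 ?subr_gt0// addr_ge0 ?sqr_ge0.
Qed.

Lemma tame_cyl t x : 0 <= t < T -> cyl x -> tame T n (T ^+ n + 1) (t, x).
Proof.
move=> /andP[t0 tT] cx; have [r1 _ _ /andP[x30 x31]] := cyl_coord cx.
have tau0 : 0 <= T - t by rewrite subr_ge0 ltW.
split; rewrite /=.
- exact: (scale_gt0 _ tT).
- by rewrite /scale/= -addrA lerD// lerXn2r ?nnegrE ?(ltW T0)// gerBl.
- exact: exprn_ge0.
- by rewrite ger0_norm// (le_trans x31)// lerDr exprn_ge0// ltW.
Qed.

Lemma in_LqLp_expr a b (E : 'I_a -> 'I_b -> @expr R) (s p : R) (q : \bar R) :
  1 <= p -> (1 <= q)%E -> 0 <= s -> (forall i j, weighs (E i j) (- s)) ->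
  subcritical n s p q ->
  in_LqLp T q p%:E (fun t x => \matrix_(i < a, j < b) sem (E i j) (t, x)).
Proof.
move=> p1 q1 s0 W cond.
have M0 : 0 <= T ^+ n + 1 by rewrite addr_ge0// exprn_ge0// ltW.
have HC ij := weighs_bound T n0 M0 (W ij.1 ij.2).
have {}HC (ij : 'I_a * 'I_b) : exists C, 0 <= C /\
    forall z, tame T n (T ^+ n + 1) z -> `|sem (E ij.1 ij.2) z| <= C * scale T n z `^ (- s).
  by have [C C0 H] := HC ij; exists C.
have [C HC'] := choice HC.
apply: (@in_LqLp_weight _ _ _ _ _ s p (\sum_ij C ij) n) => //.
- move=> i j; apply: measurable_funTS; under eq_fun do rewrite mxE.
  exact: measurable_sem.
- move=> t x /andP[t0 tT] cx i j; rewrite mxE.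
  have tz : tame T n (T ^+ n + 1) (t, x) by apply: tame_cyl => //; rewrite ltW.
  apply: (le_trans ((HC' (i, j)).2 _ tz)); rewrite ler_wpM2r ?powR_ge0//.
  rewrite (bigD1 (i, j))//= lerDl sumr_ge0// => ij _; exact: (HC' ij).1.
Qed.

End SwirlBounds.

(** * Borel sets of space-time *)

Section SpaceTimeMeasurability.
Context {R : realType}.
Notation mR := (measurableTypeR R).
Local Notation X := 'rV[R]_3.
Local Notation Z := (R * 'rV[R]_3)%type.

Definition pt4 (z : mR * (mR * mR * mR)) : Z := (z.1, pt z.2).

(** Boxes with rational centres form a countable base of the topology; their preimages are
    measurable in the product sigma-algebra, hence so are those of all open sets. *)
Definition box (r : R) (a : rat) (b1 b2 b3 : rat) : set Z :=
  [set z : Z | [/\ `|z.1 - ratr a| < r, `|z.2 0 i1 - ratr b1| < r,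
    `|z.2 0 i2 - ratr b2| < r & `|z.2 0 i3 - ratr b3| < r]].

Lemma measurable_pt4_coord (i : option 'I_3) :
  measurable_fun [set: mR * (mR * mR * mR)]
    (fun z => (if i is Some j then (pt4 z).2 0 j else (pt4 z).1) : mR).
Proof.
case: i => [j|]; last exact: measurable_fst.
exact: (@measurable_sem R 0 0 (Crd j)).
Qed.

Lemma measurable_box r a b1 b2 b3 : measurable (pt4 @^-1` box r a b1 b2 b3).
Proof.
have mB (c : mR * (mR * mR * mR) -> mR) (q : R) : measurable_fun setT c ->
    measurable [set z | `|c z - q| < r].
  move=> mc; rewrite (_ : [set z | _] = setT `&` (fun z => `|c z - q|) @^-1` `]-oo, r[).
    have mcq : measurable_fun setT (fun z => `|c z - q| : mR).
      by apply: (measurableT_comp (@normr_measurable R setT)); apply: measurable_funB.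
    by apply: mcq => //; exact: measurable_itv.
  by rewrite setTI; apply/seteqP; split=> z /=; rewrite in_itv.
rewrite (_ : _ @^-1` _ = [set z | `|(pt4 z).1 - ratr a| < r] `&`
   [set z | `|(pt4 z).2 0 i1 - ratr b1| < r] `&` [set z | `|(pt4 z).2 0 i2 - ratr b2| < r] `&`
   [set z | `|(pt4 z).2 0 i3 - ratr b3| < r]); last first.
  by apply/seteqP; split=> z /= => [[]|[[[]]]].
apply: measurableI; [apply: measurableI; [apply: measurableI|]|]; apply: mB.
- exact: (measurable_pt4_coord None).
- exact: (measurable_pt4_coord (Some i1)).
- exact: (measurable_pt4_coord (Some i2)).
- exact: (measurable_pt4_coord (Some i3)).
Qed.

Lemma measurable_open4 (O : set Z) : open O -> measurable (pt4 @^-1` O).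
Proof.
move=> oO.
pose F n a b1 b2 b3 : set (mR * (mR * mR * mR)) :=
  [set z | box n.+1%:R^-1 a b1 b2 b3 (pt4 z) /\ box n.+1%:R^-1 a b1 b2 b3 `<=` O].
rewrite (_ : _ @^-1` _ = \bigcup_n \bigcup_a \bigcup_b1 \bigcup_b2 \bigcup_b3 F n a b1 b2 b3).
  apply: bigcupT_measurable => n; apply: bigcupT_measurable_rat => a.
  apply: bigcupT_measurable_rat => b1; apply: bigcupT_measurable_rat => b2.
  apply: bigcupT_measurable_rat => b3.
  have [sO|nsO] := pselect (box n.+1%:R^-1 a b1 b2 b3 `<=` O).
    rewrite (_ : F _ _ _ _ _ = pt4 @^-1` box n.+1%:R^-1 a b1 b2 b3); first exact: measurable_box.
    by apply/seteqP; split=> [z []|z].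
  by rewrite (_ : F _ _ _ _ _ = set0)//; apply/seteqP; split=> [z []|z].
apply/seteqP; split=> z /=; last first.
  by move=> [n _ [a _ [b1 _ [b2 _ [b3 _ [bz sO]]]]]]; exact: sO.
move=> Oz; have /nbhs_ballP[e /= e0 eO] := open_nbhs_nbhs (conj oO Oz).
pose n := Num.bound (2 / e).
have ne : n.+1%:R^-1 + n.+1%:R^-1 <= e.
  have := archi_boundP (ltW (divr_gt0 (ltr0n R 2) e0)); rewrite -/n => H.
  have : 2 / e <= n.+1%:R by rewrite (le_trans (ltW H))// ler_nat.
  rewrite ler_pdivrMr// => h.
  have : 2 / n.+1%:R <= e by rewrite ler_pdivrMr ?ltr0n// mulrC.
  by rewrite mulr_natl mulr2n.
have r0 : 0 < n.+1%:R^-1 :> R by rewrite invr_gt0 ltr0n.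
have near_rat' (r x : R) : 0 < r -> exists q : rat, `|x - ratr q| < r.
  move=> r0'; have [|q] := @rat_in_itvoo R (x - r) (x + r); first lra.
  by rewrite in_itv/= => /andP[? ?]; exists q; rewrite ltr_norml; apply/andP; split; lra.
have near_rat x := near_rat' _ x r0.
have [a Ha] := near_rat (pt4 z).1; have [b1 H1] := near_rat ((pt4 z).2 0 i1).
have [b2 H2] := near_rat ((pt4 z).2 0 i2); have [b3 H3] := near_rat ((pt4 z).2 0 i3).
exists n => //; exists a => //; exists b1 => //; exists b2 => //; exists b3 => //.
split=> // y [ya y1 y2 y3]; apply: eO.
have tri (u v w : R) : `|u - w| < n.+1%:R^-1 -> `|v - w| < n.+1%:R^-1 -> `|u - v| < e.
  move=> uw vw; rewrite -(subrKA w) (le_lt_trans (ler_normD _ _))//.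
  by rewrite [X in _ + X]distrC; apply: lt_le_trans ne; exact: ltrD.
split; first exact: (tri _ _ (ratr a)).
split=> // i j; rewrite ord1; elim/ord3P: j.
- exact: (tri _ _ (ratr b1)).
- exact: (tri _ _ (ratr b2)).
- exact: (tri _ _ (ratr b3)).
Qed.

(** Continuity is known at the points of A only, so the preimage of a ray need not be open;
    its interior has the same trace on A. *)
Lemma measurable_preimage_continuous d (U : measurableType d) (V : topologicalType)
    (pi : U -> V) (A : set V) (g : V -> R) :
  (forall O, open O -> measurable (pi @^-1` O)) -> measurable (pi @^-1` A) ->
  (forall z, A z -> {for z, continuous g}) ->
  measurable_fun (pi @^-1` A) (fun z => g (pi z) : mR).
Proof.
move=> mO mA cg _; apply: (measurability _ (RGenOInfty.measurableE R)) => //.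
move=> /= _ [_ [y ->] <-].
rewrite (_ : _ `&` _ = pi @^-1` A `&` pi @^-1` ([set z | y < g z]^°)).
  by apply: measurableI => //; apply: mO; exact: open_interior.
apply/seteqP; split=> z /= [Az gz]; split=> //.
  rewrite in_itv/= andbT in gz.
  exact: (cg _ Az [set s | y < s] (lt_nbhsr gz)).
by rewrite in_itv/= andbT; exact: (interior_subset gz).
Qed.

Lemma measurable_continuous4 (A : set Z) (g : Z -> R) :
  measurable (pt4 @^-1` A) -> (forall z, A z -> {for z, continuous g}) ->
  measurable_fun (pt4 @^-1` A) (fun z => g (pt4 z) : mR).
Proof. by move=> mA cg; exact: (measurable_preimage_continuous (@measurable_open4) mA cg). Qed.

Lemma measurable_slice (t : R) (B : set (mR * (mR * mR * mR))) :
  measurable B -> measurable [set x | B (t, x)].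
Proof.
move=> mB; rewrite (_ : [set x | _] = xsection B (t : mR)); first exact: measurable_xsection.
by apply/seteqP; split=> x; rewrite /xsection/= inE.
Qed.

Lemma measurable_open3 (O : set X) : open O -> measurable (@pt R @^-1` O).
Proof.
move=> oO; have oO' : open ([set z : Z | O z.2]).
  have cs : continuous (snd : Z -> X) by move=> z; exact: cvg_snd.
  by move/continuousP: cs => /(_ _ oO).
exact: (measurable_slice 0 (measurable_open4 oO')).
Qed.

Lemma measurable_continuous3 (A : set X) (g : X -> R) :
  measurable (@pt R @^-1` A) -> (forall x, A x -> {for x, continuous g}) ->
  measurable_fun (@pt R @^-1` A) (fun x => g (pt x) : mR).
Proof. by move=> mA cg; exact: (measurable_preimage_continuous (@measurable_open3) mA cg). Qed.

Lemma cylP (x : X) : cyl x <-> x 0 i1 ^+ 2 + x 0 i2 ^+ 2 <= 1 /\ 0 <= x 0 i3 <= 1.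
Proof.
split=> [cx|[r1 x3]]; first by have [? _ _ ?] := cyl_coord cx.
by split=> //; rewrite /Defs.radius -sqrtr1 ler_wsqrtr.
Qed.

Lemma closed_cyl : closed (@cyl R).
Proof.
have cc i : continuous (fun x : X => x 0 i) by exact: coord_continuous.
have csq i : continuous (fun x : X => x 0 i ^+ 2).
  by move=> x; apply: (@continuous_comp _ _ _ (fun x : X => x 0 i) (fun s : R => s ^+ 2));
    [exact: cc|exact: exprn_continuous].
have cr : continuous (fun x : X => x 0 i1 ^+ 2 + x 0 i2 ^+ 2).
  by move=> x; exact: (continuousD (csq i1 x) (csq i2 x)).
rewrite (_ : cyl = [set x : X | x 0 i1 ^+ 2 + x 0 i2 ^+ 2 <= 1] `&`
    ([set x : X | 0 <= x 0 i3] `&` [set x : X | x 0 i3 <= 1])).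
  apply: closedI; [|apply: closedI].
  - by move/continuous_closedP: cr => /(_ _ (@closed_le R 1)).
  - by move/continuous_closedP: (cc i3) => /(_ _ (@closed_ge R 0)).
  - by move/continuous_closedP: (cc i3) => /(_ _ (@closed_le R 1)).
apply/seteqP; split=> x.
  by move=> /cylP[? /andP[]].
by move=> [? [? ?]]; apply/cylP; split=> //; apply/andP.
Qed.

Lemma compact_cyl : compact (@cyl R).
Proof.
apply: (subclosed_compact closed_cyl (B := [set x : X | forall i, `[-1, 1]%classic (x 0 i)])).
  by apply: (@rV_compact R 3 (fun=> `[-1, 1]%classic)) => i; exact: segment_compact.
move=> x /cyl_coord[_ x1 x2 /andP[x30 x31]] i.
by rewrite /= in_itv/= -ler_norml; elim/ord3P: i => //; rewrite ger0_norm.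
Qed.

Lemma measurable_cyl3 : measurable (@cyl3 R).
Proof.
rewrite -[cyl3]setCK; apply: measurableC.
have := measurable_open3 (closed_openC closed_cyl).
by [].
Qed.

Lemma compact_cylT (a b : R) : compact (cylT `[a, b]%classic : set Z).
Proof.
rewrite (_ : cylT _ = `[a, b]%classic `*` cyl); last by [].
by apply: compact_setX; [exact: segment_compact|exact: compact_cyl].
Qed.

Lemma compact_bound (U : topologicalType) (K : set U) (g : U -> R) : compact K ->
  (forall z, K z -> {for z, continuous g}) ->
  exists2 M, 0 <= M & forall z, K z -> `|g z| <= M.
Proof.
move=> cK cg.
have : compact (g @` K).
  apply: continuous_compact => //; apply: continuous_in_subspaceT => z; rewrite inE; exact: cg.
move=> /compact_bounded[M [_ HM]].
exists (`|M| + 1); first by rewrite addr_ge0.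
move=> z Kz; apply: HM; last by exists z.
by rewrite (le_lt_trans (ler_norm M))// ltrDl.
Qed.

End SpaceTimeMeasurability.

(** * Integration by parts on the cylinder *)

Section BoundedIntegrable.
Context d (U : measurableType d) {R : realType}.
Variable mu : {measure set U -> \bar R}.

Lemma integrable_bounded_support (f : U -> \bar R) (B : set U) (K : R) :
  measurable_fun [set: U] f -> measurable B -> (mu B < +oo)%E ->
  (forall x, (`|f x| <= (K * \1_B x)%:E)%E) -> mu.-integrable [set: U] f.
Proof.
move=> mf mB muB fK; apply: (@le_integrable _ _ _ mu _ measurableT f (fun x => K%:E * (\1_B x)%:E)%E) => //.
  move=> x _; apply: (le_trans (fK x)); rewrite -EFinM; exact: lee_abs.
apply: integrableZl => //.
apply/integrableP; split; first by apply/measurable_EFinP; exact: measurable_indic.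
rewrite (eq_integral (fun x => (\1_B x)%:E)) ?integral_indic ?setIT// => x _.
by rewrite gee0_abs// lee_fin.
Qed.

End BoundedIntegrable.

Section Boxes.
Context {R : realType}.
Notation mR := (measurableTypeR R).
Notation mu := (@lebesgue_measure R).

Definition segm (a b : R) : set mR := `[a, b]%classic.

Lemma measurable_segm a b : measurable (segm a b).
Proof. exact: measurable_itv. Qed.

Lemma lebesgue_segm_lty a b : (mu (segm a b) < +oo)%E.
Proof.
rewrite /segm lebesgue_measure_itv; case: ifP => // _.
by rewrite /= -EFinB ltry.
Qed.

Definition square : set (mR * mR) := segm (-1) 1 `*` segm (-1) 1.
Definition cube : set (mR * mR * mR) := square `*` segm 0 1.

Lemma measurable_square : measurable square.
Proof. by apply: measurableX; exact: measurable_segm. Qed.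

Lemma measurable_cube : measurable cube.
Proof. by apply: measurableX; [exact: measurable_square|exact: measurable_segm]. Qed.

Lemma lebesgue_square_lty : (lebesgue2 square < +oo)%E.
Proof.
rewrite /lebesgue2 /square product_measure1E; try exact: measurable_segm.
by rewrite lte_mul_pinfty// ?ge0_fin_numE// ?lebesgue_segm_lty.
Qed.

Lemma lebesgue_cube_lty : (lebesgue3 cube < +oo)%E.
Proof.
rewrite /lebesgue3 /cube product_measure1E.
- rewrite lte_mul_pinfty// ?ge0_fin_numE//; first exact: lebesgue_square_lty.
  exact: lebesgue_segm_lty.
- exact: measurable_square.
- exact: measurable_segm.
Qed.

Lemma cyl3_cube : cyl3 `<=` cube.
Proof.
move=> x /cyl_coord[_]; rewrite pt1 pt2 pt3 !ler_norml => x1 x2 x3.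
by split; [split|]; rewrite /segm/= in_itv.
Qed.

End Boxes.

Section Lines.
Context {R : realType}.
Notation mR := (measurableTypeR R).
Notation mu := (@lebesgue_measure R).
Local Notation X := 'rV[R]_3.

Definition upd (j : 'I_3) (x : X) (s : R) : X := \row_i if i == j then s else x 0 i.

Lemma updD j x (s h : R) : upd j x (h + s) = h *: e_ j + upd j x s.
Proof.
apply/rowP => i; rewrite !mxE /=; case: eqVneq => _ /=; first by rewrite mulr1.
by rewrite mulr0 add0r.
Qed.

Lemma is_derive_upd (F : X -> R) j x s d : is_derive (upd j x s) (e_ j) F d ->
  is_derive s 1 (fun r => F (upd j x r)) d.
Proof.
have E : (fun h : R => h^-1 *: ((F \o shift (upd j x s)) (h *: e_ j) - F (upd j x s))) =
   (fun h : R => h^-1 *: (((fun r => F (upd j x r)) \o shift s) (h *: (1 : R)) - F (upd j x s))).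
  by apply/funext => h /=; rewrite [_ *: (1 : R)]mulr1 updD.
by move=> [D1 D2]; split; [rewrite /derivable -E|rewrite /derive -E].
Qed.

Lemma continuous_upd j x : continuous (upd j x).
Proof.
move=> s; apply: continuous_row => i.
have [->|ij] := eqVneq i j.
  rewrite (_ : (fun y => _) = id); first exact: cvg_id.
  by apply/funext => y; rewrite mxE eqxx.
rewrite (_ : (fun y => _) = fun=> x 0 i); first exact: cvg_cst.
by apply/funext => y; rewrite mxE (negbTE ij).
Qed.

(** Where a line in direction j enters and leaves the cylinder. *)
Definition bdry (j : 'I_3) : set X :=
  if j == i3 then horizontal_boundary else vertical_boundary.

Lemma bdry_cyl j x : bdry j x -> cyl x.
Proof.
rewrite /bdry; case: ifP => _ [r1 H]; split=> //; last by rewrite r1.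
by case: H => ->; rewrite lexx ler01.
Qed.

(** The cylinder is convex in each coordinate direction: this is what allows integrating by
    parts one variable at a time, without a divergence theorem. *)
Lemma cyl_line j x : (forall s, ~ cyl (upd j x s)) \/
  exists a b, [/\ a <= b, (forall s, cyl (upd j x s) <-> a <= s <= b),
    bdry j (upd j x a) & bdry j (upd j x b)].
Proof.
have rad (y : X) : y 0 i1 ^+ 2 + y 0 i2 ^+ 2 = 1 -> Defs.radius y = 1.
  by rewrite /Defs.radius => ->; rewrite sqrtr1.
have sqle (rho s : R) : 0 <= rho -> (s ^+ 2 <= rho) = (- Num.sqrt rho <= s <= Num.sqrt rho).
  move=> r0; rewrite -ler_norml -[in LHS](sqr_sqrtr r0) -(@real_normK _ s) ?num_real//.
  by rewrite ler_sqr ?nnegrE ?sqrtr_ge0.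
elim/ord3P: j.
- have [r0|r0] := leP 0 (1 - x 0 i2 ^+ 2); last first.
    left => s /cylP[]; rewrite !mxE/= => h _.
    by have := sqr_ge0 s; lra.
  have [x3|x3] := boolP (0 <= x 0 i3 <= 1); last first.
    by left => s /cylP[_]; rewrite !mxE/= (negbTE x3).
  right; exists (- Num.sqrt (1 - x 0 i2 ^+ 2)), (Num.sqrt (1 - x 0 i2 ^+ 2)).
  have s0 := sqrtr_ge0 (1 - x 0 i2 ^+ 2).
  split; first lra.
  + move=> s; rewrite -sqle//; split=> [/cylP[]|h]; first by rewrite !mxE/= => h _; lra.
    by apply/cylP; rewrite !mxE/=; split=> //; lra.
  + split; last by rewrite !mxE.
    by apply: rad; rewrite !mxE/= sqrrN sqr_sqrtr// subrK.
  + split; last by rewrite !mxE.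
    by apply: rad; rewrite !mxE/= sqr_sqrtr// subrK.
- have [r0|r0] := leP 0 (1 - x 0 i1 ^+ 2); last first.
    left => s /cylP[]; rewrite !mxE/= => h _.
    by have := sqr_ge0 s; lra.
  have [x3|x3] := boolP (0 <= x 0 i3 <= 1); last first.
    by left => s /cylP[_]; rewrite !mxE/= (negbTE x3).
  right; exists (- Num.sqrt (1 - x 0 i1 ^+ 2)), (Num.sqrt (1 - x 0 i1 ^+ 2)).
  have s0 := sqrtr_ge0 (1 - x 0 i1 ^+ 2).
  split; first lra.
  + move=> s; rewrite -sqle//; split=> [/cylP[]|h]; first by rewrite !mxE/= => h _; lra.
    by apply/cylP; rewrite !mxE/=; split=> //; lra.
  + split; last by rewrite !mxE.
    by apply: rad; rewrite !mxE/= sqrrN sqr_sqrtr// addrC subrK.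
  + split; last by rewrite !mxE.
    by apply: rad; rewrite !mxE/= sqr_sqrtr// addrC subrK.
- have [r1|r1] := boolP (x 0 i1 ^+ 2 + x 0 i2 ^+ 2 <= 1); last first.
    by left => s /cylP[]; rewrite !mxE/= (negbTE r1).
  right; exists 0, 1; split; first exact: ler01.
  + move=> s; split=> [/cylP[_]|h]; first by rewrite !mxE.
    by apply/cylP; rewrite !mxE.
  + split; last by left; rewrite !mxE.
    by have [] : cyl (upd i3 x 0) by apply/cylP; rewrite !mxE/= r1 lexx ler01.
  + split; last by right; rewrite !mxE.
    by have [] : cyl (upd i3 x 1) by apply/cylP; rewrite !mxE/= r1 lexx ler01.
Qed.

Variables (F g : X -> R) (j : 'I_3).
Hypothesis dF : forall x, cyl x -> is_derive x (e_ j) F (g x).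
Hypothesis cg : forall x, cyl x -> {for x, continuous g}.
Hypothesis F0 : forall x, bdry j x -> F x = 0.

(** Extended by 0 outside the cylinder, g becomes integrable on the whole space, where
    Fubini's theorem holds with the variable j innermost. *)
Definition on_cyl (x : X) : R := g x * \1_cyl x.

Lemma integral_line x : (\int[mu]_s (on_cyl (upd j x s))%:E = 0)%E.
Proof.
rewrite /on_cyl; have [no|[a [b [ab ciff ba bb]]]] := cyl_line j x.
  rewrite integral0_eq// => s _; rewrite indicE memNset ?mulr0//.
rewrite (eq_integral ((fun s : mR => (g (upd j x s))%:E) \_ (segm a b))); last first.
  move=> s _; rewrite patchE indicE; case: ifPn => [|].
    rewrite inE /segm/= in_itv/= => /ciff cs; by rewrite mem_set// mulr1.
  rewrite notin_setE /segm/= in_itv/= => ns; rewrite memNset ?mulr0//.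
  by move=> /ciff /ns.
rewrite -integral_mkcond /segm.
have D s : a <= s <= b -> is_derive s 1 (fun r => F (upd j x r)) (g (upd j x s)).
  by move=> /ciff cs; apply: is_derive_upd; exact: dF.
have C s : a <= s <= b -> {for s, continuous (fun r => g (upd j x r))}.
  move=> /ciff cs; apply: (@continuous_comp _ _ _ (upd j x) g); first exact: continuous_upd.
  exact: cg.
by rewrite (integral_derive ab D C) !F0// subrr.
Qed.

Definition on_cyl3 (y : mR * mR * mR) : \bar R := (on_cyl (pt y))%:E.

Lemma measurable_on_cyl3 : measurable_fun [set: mR * mR * mR] on_cyl3.
Proof.
rewrite (_ : on_cyl3 = (fun y => (g (pt y))%:E) \_ cyl3); last first.
  apply/funext => y; rewrite patchE /on_cyl3 /on_cyl indicE.
  rewrite (_ : (pt y \in cyl) = (y \in cyl3)); last by apply/idP/idP; rewrite !inE.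
  by case: ifP => _; rewrite ?mulr1 ?mulr0.
apply: (measurable_restrictT _ (@measurable_cyl3 R)).1.
apply/measurable_EFinP; apply: (measurable_continuous3 (A := cyl)) => //.
exact: measurable_cyl3.
Qed.

Lemma on_cyl3_bound : exists K : R, forall y, (`|on_cyl3 y| <= (K * \1_cube y)%:E)%E.
Proof.
have [K K0 gK] := compact_bound (@compact_cyl R) cg.
exists K => y; rewrite /on_cyl3 /on_cyl /= lee_fin normrM.
have [cy|ncy] := pselect (cyl (pt y)).
  rewrite !indicE !mem_set//; last exact: cyl3_cube.
  by rewrite normr1 !mulr1; exact: gK.
by rewrite [X in _ * `|X|]indicE memNset//= normr0 mulr0 mulr_ge0.
Qed.

Lemma integrable_on_cyl3 : lebesgue3.-integrable [set: mR * mR * mR] on_cyl3.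
Proof.
have [K HK] := on_cyl3_bound.
apply: (integrable_bounded_support measurable_on_cyl3 (@measurable_cube R) _ HK).
exact: lebesgue_cube_lty.
Qed.

(** The integral of g over the chords in direction j is the difference of the values of F at
    their ends, both 0 as these lie on [bdry j]. *)
Lemma integral_partial_cyl : (\int[leb3]_(y in cyl3) (g (pt y))%:E = 0)%E.
Proof.
transitivity (\int[lebesgue3]_y on_cyl3 y)%E.
  rewrite leb3E integral_mkcond; apply: eq_integral => y _.
  rewrite patchE /on_cyl3 /on_cyl indicE.
  rewrite (_ : (pt y \in cyl) = (y \in cyl3)); last by apply/idP/idP; rewrite !inE.
  by case: ifP => _; rewrite ?mulr1 ?mulr0.
have I3 := integrable_on_cyl3.
have line x : (\int[mu]_s (on_cyl (upd j x s))%:E = 0)%E := integral_line x.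
have [j3|j3] := eqVneq j i3.
  have H := @integral12_prod_meas1 _ _ _ _ R lebesgue2 mu on_cyl3 I3.
  transitivity (\int[(lebesgue2 \x mu)%E]_z on_cyl3 z)%E; [by []|rewrite -H].
  apply: integral0_eq => -[x1 x2] _; rewrite /fubini_F -(line (row3 x1 x2 0)).
  apply: eq_integral => s _; rewrite /on_cyl3 j3; congr (on_cyl _)%:E.
  by apply/rowP; elim/ord3P; rewrite !mxE.
have H := @integral21_prod_meas1 _ _ _ _ R lebesgue2 mu on_cyl3 I3.
transitivity (\int[(lebesgue2 \x mu)%E]_z on_cyl3 z)%E; [by []|rewrite -H].
apply: integral0_eq => z _; rewrite /fubini_G.
pose f2 (y : mR * mR) := on_cyl3 (y, z).
have I2 : lebesgue2.-integrable [set: mR * mR] f2.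
  have [K HK] := on_cyl3_bound.
  apply: (@integrable_bounded_support _ _ _ _ f2 square `|K|).
  - exact: (measurableT_comp measurable_on_cyl3 (@pair2_measurable _ _ _ _ z)).
  - exact: measurable_square.
  - exact: lebesgue_square_lty.
  - move=> y; apply: (le_trans (HK _)); rewrite lee_fin.
    apply: (@le_trans _ _ (`|K| * \1_cube (y, z))); first by rewrite ler_wpM2r// ler_norm.
    rewrite ler_wpM2l// !indicE; case: (boolP ((y, z) \in cube)) => //.
    by rewrite inE => -[/= sq _]; rewrite mem_set.
have [j1|j1] := eqVneq j i1.
  have H2 := @integral21_prod_meas1 _ _ _ _ R mu mu f2 I2.
  transitivity (\int[(mu \x mu)%E]_y f2 y)%E; [by []|rewrite -H2].
  apply: integral0_eq => x2 _; rewrite /fubini_G -(line (row3 0 x2 z)).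
  apply: eq_integral => s _; rewrite /f2 /on_cyl3 j1; congr (on_cyl _)%:E.
  by apply/rowP; elim/ord3P; rewrite !mxE.
have j2 : j = i2.
  by move: j3 j1; elim/ord3P: j.
have H2 := @integral12_prod_meas1 _ _ _ _ R mu mu f2 I2.
transitivity (\int[(mu \x mu)%E]_y f2 y)%E; [by []|rewrite -H2].
apply: integral0_eq => x1 _; rewrite /fubini_F -(line (row3 x1 0 z)).
apply: eq_integral => s _; rewrite /f2 /on_cyl3 j2; congr (on_cyl _)%:E.
by apply/rowP; elim/ord3P; rewrite !mxE.
Qed.

End Lines.

(** * Integration of continuous functions over the cylinder *)

Section CylinderIntegral.
Context {R : realType}.
Notation mR := (measurableTypeR R).
Notation mu := (@lebesgue_measure R).
Local Notation X := 'rV[R]_3.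
Implicit Types g h : X -> R.

Definition continuous_cyl g : Prop := forall x, cyl x -> {for x, continuous g}.

Definition int_cyl g : \bar R := (\int[leb3]_(y in cyl3) (g (pt y))%:E)%E.

Lemma lebesgue_cyl3_lty : (lebesgue3 (@cyl3 R) < +oo)%E.
Proof.
apply: (@le_lt_trans _ _ (lebesgue3 (@cube R))); last exact: lebesgue_cube_lty.
by apply: le_measure; rewrite ?inE; [exact: measurable_cyl3|exact: measurable_cube|exact: cyl3_cube].
Qed.

Lemma integrable_cyl g : continuous_cyl g ->
  lebesgue3.-integrable cyl3 (fun y => (g (pt y))%:E).
Proof.
move=> cg; apply: (@measurable_bounded_integrable _ _ _ lebesgue3 (fun y => g (pt y)) cyl3).
- exact: measurable_cyl3.
- exact: lebesgue_cyl3_lty.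
- by apply: (measurable_continuous3 (A := cyl)) => //; exact: measurable_cyl3.
- have [K K0 gK] := compact_bound (@compact_cyl R) cg.
  exists K; split; first exact: num_real.
  by move=> M KM y cy; apply: (le_trans (gK _ cy)); exact: ltW.
Qed.

Lemma int_cylD g h : continuous_cyl g -> continuous_cyl h ->
  int_cyl (fun x => g x + h x) = (int_cyl g + int_cyl h)%E.
Proof.
move=> cg ch; rewrite /int_cyl !leb3E.
under eq_integral do rewrite EFinD.
exact: (integralD_EFin (@measurable_cyl3 R) (integrable_cyl cg) (integrable_cyl ch)).
Qed.

Lemma int_cylZ (k : R) g : continuous_cyl g ->
  int_cyl (fun x => k * g x) = (k%:E * int_cyl g)%E.
Proof.
move=> cg; rewrite /int_cyl !leb3E.
under eq_integral do rewrite EFinM.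
exact: (integralZl (@measurable_cyl3 R) (integrable_cyl cg)).
Qed.

Lemma int_cyl_le g h : continuous_cyl g -> continuous_cyl h ->
  (forall x, cyl x -> g x <= h x) -> (int_cyl g <= int_cyl h)%E.
Proof.
move=> cg ch gh; rewrite /int_cyl !leb3E.
apply: le_integral; [exact: measurable_cyl3|exact: integrable_cyl|exact: integrable_cyl|].
by move=> y; rewrite inE => cy; rewrite lee_fin; exact: gh.
Qed.

Lemma open_volume_gt0 (O : set X) : open O -> O !=set0 -> (0 < lebesgue3 (@pt R @^-1` O))%E.
Proof.
move=> oO [x Ox]; have /nbhs_ballP[e /= e0 eO] := open_nbhs_nbhs (conj oO Ox).
pose S i := segm (x 0 i - e / 2) (x 0 i + e / 2).
have mS i : measurable (S i) by exact: measurable_segm.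
have e20 : 0 < e / 2 by rewrite divr_gt0.
have SE i s : S i s -> `|x 0 i - s| < e.
  rewrite /S /segm/= in_itv/= => /andP[? ?]; rewrite ltr_norml.
  by apply/andP; split; lra.
have lS i : (mu (S i) = e%:E)%E.
  rewrite /S /segm lebesgue_measure_itv/= lte_fin ifT; last lra.
  by rewrite -EFinD; congr EFin; field.
have E : lebesgue3 ((S i1 `*` S i2) `*` S i3) = (e%:E * e%:E * e%:E)%E.
  have E2 : lebesgue2 (S i1 `*` S i2) = (e%:E * e%:E)%E.
    transitivity (mu (S i1) * mu (S i2))%E; last by rewrite !lS.
    exact: product_measure1E.
  transitivity (lebesgue2 (S i1 `*` S i2) * mu (S i3))%E; last by rewrite E2 lS.
  by rewrite /lebesgue3 product_measure1E//; exact: measurableX.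
apply: (@lt_le_trans _ _ (lebesgue3 ((S i1 `*` S i2) `*` S i3))).
  by rewrite E -!EFinM lte_fin !mulr_gt0.
apply: le_measure; rewrite ?inE.
- by apply: measurableX => //; exact: measurableX.
- exact: measurable_open3.
- move=> y [[y1 y2] y3] /=; apply: eO; split=> // i j; rewrite ord1; elim/ord3P: j.
  + by rewrite pt1; exact: SE.
  + by rewrite pt2; exact: SE.
  + by rewrite pt3; exact: SE.
Qed.

(** For x on the boundary a neighbourhood of x is not inside the cylinder. Interior points at
    which g > y are found on the segment from x to the centre c. *)
Lemma cyl_superlevel g x y : cyl x -> {for x, continuous g} -> y < g x ->
  exists B : set (mR * mR * mR), [/\ measurable B, (0 < lebesgue3 B)%E, B `<=` cyl3 &
    forall b, B b -> y < g (pt b)].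
Proof.
move=> /cylP[r1 /andP[x30 x31]] cg yg.
pose c : X := row3 0 0 (2^-1).
pose gam (s : R) : X := s *: (c - x) + x.
pose I : set X := [set z | z 0 i1 ^+ 2 + z 0 i2 ^+ 2 < 1 /\ (0 < z 0 i3 /\ z 0 i3 < 1)].
have oI : open I.
  have cc i : continuous (fun x : X => x 0 i) by exact: coord_continuous.
  have csq i : continuous (fun x : X => x 0 i ^+ 2).
    by move=> z; apply: (@continuous_comp _ _ _ (fun x : X => x 0 i) (fun s : R => s ^+ 2));
      [exact: cc|exact: exprn_continuous].
  have cr : continuous (fun x : X => x 0 i1 ^+ 2 + x 0 i2 ^+ 2).
    by move=> z; exact: (continuousD (csq i1 z) (csq i2 z)).
  apply: openI; first by move/continuousP: cr => /(_ _ (@open_lt R 1)).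
  apply: openI; first by move/continuousP: (cc i3) => /(_ _ (@open_gt R 0)).
  by move/continuousP: (cc i3) => /(_ _ (@open_lt R 1)).
pose O := [set z | y < g z]^° `&` I.
have oO : open O by apply: openI => //; exact: open_interior.
have O0 : O !=set0.
  have cgam : gam s @[s --> 0^'+] --> gam 0.
    apply: cvg_at_right_filter; apply: (@continuous_row _ _ gam (0 : R)) => j.
    rewrite (_ : (fun y => _) = (fun s => s * (c - x) 0 j + x 0 j)).
      by apply: cvgD; [apply: cvgM; [exact: cvg_id|exact: cvg_cst]|exact: cvg_cst].
    by apply/funext => s; rewrite !mxE.
  have g0 : gam 0 = x by rewrite /gam scale0r add0r.
  have N : nbhs (gam 0) [set z | y < g z]^°.
    rewrite g0; apply: open_nbhs_nbhs; split; first exact: open_interior.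
    exact: (cg [set s | y < s] (lt_nbhsr yg)).
  have N1 : \forall s \near 0^'+, [set z | y < g z]^° (gam s) by exact: (cgam _ N).
  have [s [Hs s0 s1]] : exists s : R, [/\ [set z | y < g z]^° (gam s), 0 < s & s < 1].
    near (0 : R)^'+ => s; exists s; split; near: s.
    - exact: N1.
    - exact: nbhs_right_gt.
    - exact: nbhs_right_lt.
  exists (gam s); split=> //; split.
    rewrite /gam /c !mxE/=.
    have -> : (s * (0 - x 0 i1) + x 0 i1) ^+ 2 + (s * (0 - x 0 i2) + x 0 i2) ^+ 2 =
       (1 - s) ^+ 2 * (x 0 i1 ^+ 2 + x 0 i2 ^+ 2) by ring.
    have q1 : (1 - s) ^+ 2 < 1 by nra.
    by apply: le_lt_trans q1; rewrite ler_piMr ?sqr_ge0.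
  rewrite /gam /c !mxE/=; split; nra.
exists (@pt R @^-1` O); split.
- exact: measurable_open3.
- exact: open_volume_gt0.
- move=> z [_ [h1 [h2 h3]]]; apply/cylP; split; first exact: ltW.
  by apply/andP; split; exact: ltW.
- by move=> b [+ _] => /interior_subset.
Unshelve. all: by end_near. Qed.

Lemma int_cyl_eq0 g : continuous_cyl g -> (forall x, cyl x -> 0 <= g x) ->
  (int_cyl g <= 0)%E -> forall x, cyl x -> g x = 0.
Proof.
move=> cg g0 Ig x cx; apply/eqP; rewrite eq_le g0// andbT leNgt; apply/negP => gx.
have gx2 : g x / 2 < g x by lra.
have gx20 : 0 < g x / 2 by lra.
have [B [mB B0 Bc Bg]] := cyl_superlevel cx (cg _ cx) gx2.
have : (0 < int_cyl g)%E.
  apply: (@lt_le_trans _ _ (\int[lebesgue3]_(y in B) (cst (g x / 2)%:E) y)%E).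
    by rewrite integral_cst// mule_gt0.
  apply: (@le_trans _ _ (\int[lebesgue3]_(y in B) (g (pt y))%:E)%E).
    apply: ge0_le_integral => //.
    - by move=> y _; rewrite lee_fin ltW.
    - apply: (measurable_funS (@measurable_cyl3 R) Bc).
      by have /integrableP[] := integrable_cyl cg.
    - by move=> y By; rewrite lee_fin ltW// Bg.
  rewrite /int_cyl leb3E; apply: ge0_subset_integral => //.
  - exact: measurable_cyl3.
  - by have /integrableP[] := integrable_cyl cg.
  - by move=> y cy; rewrite lee_fin; exact: g0.
by rewrite ltNge Ig.
Qed.

End CylinderIntegral.

(** * Uniqueness *)

Section Components.
Context {R : realType}.
Local Notation X := 'rV[R]_3.
Local Notation Z := (R * 'rV[R]_3)%type.
Implicit Types (W : Z -> X).

Definition comp W (i : 'I_3) (z : Z) : R := W z 0 i.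
Definition dcomp W (d : option 'I_3) (i : 'I_3) (z : Z) : R := ('D_(axis d) W z) 0 i.
Definition ddcomp W (j i : 'I_3) (z : Z) : R :=
  (iter_derive [:: axis (Some j); axis (Some j)] W z) 0 i.

Lemma is_derive_comp W (z w : Z) (i : 'I_3) : derivable W z w ->
  is_derive z w (fun y => W y 0 i) ('D_w W z 0 i).
Proof.
move=> dW; split; first by have /derivable_mxP := dW; apply.
by rewrite derive_mx// mxE.
Qed.

Lemma continuous_comp_at W (z : Z) (i : 'I_3) : {for z, continuous W} ->
  {for z, continuous (fun y => W y 0 i)}.
Proof.
move=> cW; apply: (@continuous_comp _ _ _ W (fun x : X => x 0 i)) => //.
exact: coord_continuous.
Qed.

(** The part of C^2 regularity that enters the energy balance: no mixed second derivatives and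
    no second derivative in time. *)
Definition C2_at W (z : Z) : Prop := forall i j d,
  [/\ {for z, continuous (comp W i)}, {for z, continuous (dcomp W d i)},
      {for z, continuous (ddcomp W j i)},
      is_derive z (axis d) (comp W i) (dcomp W d i z) &
      is_derive z (axis (Some j)) (dcomp W (Some j) i) (ddcomp W j i z)].

Lemma Cn_C2_at U W z : Cn_open 2 U W -> U z -> C2_at W z.
Proof.
move=> [CW DW] Uz i j d; split.
- by apply: continuous_comp_at; exact: (CW [::]).
- by apply: continuous_comp_at; exact: (CW [:: axis d]).
- by apply: continuous_comp_at; exact: (CW [:: axis (Some j); axis (Some j)]).
- by apply: is_derive_comp; exact: (DW [::]).
- by apply: is_derive_comp; exact: (DW [:: axis (Some j)]).
Qed.

Lemma is_derive_space (f : Z -> R) t x j d : is_derive (t, x) (axis (Some j)) f d ->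
  is_derive x (e_ j) (fun y => f (t, y)) d.
Proof. by move=> [D1 D2]; split; [rewrite derivable_space|rewrite derive_space]. Qed.

Lemma is_derive_time (f : Z -> R) t x d : is_derive (t, x) (axis None) f d ->
  is_derive t 1 (fun s => f (s, x)) d.
Proof. by move=> [D1 D2]; split; [rewrite derivable_time|rewrite -derive1E derive1_time]. Qed.

Lemma continuous_slice (f : Z -> R) t x : {for (t, x), continuous f} ->
  {for x, continuous (fun y => f (t, y))}.
Proof.
move=> cf; apply: (@continuous_comp _ _ _ (fun y : X => (t, y)) f) => //.
move=> P [[A B] /= [nA nB] sAB]; apply: filterS nB => y By; apply: sAB.
by split=> //=; exact: nbhs_singleton nA.
Qed.

Lemma continuous_slice_time (f : Z -> R) t x : {for (t, x), continuous f} ->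
  {for t, continuous (fun s => f (s, x))}.
Proof.
move=> cf; apply: (@continuous_comp _ _ _ (fun s : R => (s, x)) f) => //.
move=> P [[A B] /= [nA nB] sAB]; apply: filterS nA => s As; apply: sAB.
by split=> //=; exact: nbhs_singleton nB.
Qed.

End Components.

Section SmoothSolutions.
Context {R : realType}.
Local Notation X := 'rV[R]_3.
Local Notation Z := (R * 'rV[R]_3)%type.

Definition spacetime (v : R -> X -> X) (z : Z) : X := v z.1 z.2.

Lemma smooth_C2 T v : smooth_vf T v -> forall z, cylT `[0, T[%classic z -> C2_at (spacetime v) z.
Proof. by move=> [U [oU sU CU]] z /sU Uz; exact: (Cn_C2_at (CU 2%N)). Qed.

Lemma laplacianE v t x i :
  laplacian (v t) x 0 i = \sum_(j < 3) ddcomp (spacetime v) j i (t, x).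
Proof.
rewrite /laplacian summxE; apply: eq_bigr => j _.
by rewrite -[v t]/(fun y => spacetime v (t, y)) iter_derive_space.
Qed.

Lemma convectionE v t x i :
  convection (v t) x 0 i = \sum_(j < 3) v t x 0 j * dcomp (spacetime v) (Some j) i (t, x).
Proof.
rewrite /convection summxE; apply: eq_bigr => j _.
by rewrite mxE -[v t in LHS]/(fun y => spacetime v (t, y)) derive_space.
Qed.

Lemma divergenceE v t x :
  divergence (v t) x = \sum_(j < 3) dcomp (spacetime v) (Some j) j (t, x).
Proof.
rewrite /divergence; apply: eq_bigr => j _.
by rewrite -[v t]/(fun y => spacetime v (t, y)) derive_space.
Qed.

Lemma derive1E_time v t x i :
  (derive1 (fun s => v s x) t : X) 0 i = dcomp (spacetime v) None i (t, x).
Proof. by rewrite -[fun s => v s x]/(fun s => spacetime v (s, x)) derive1_time. Qed.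

Lemma navier_stokes_comp T f v P t x i : navier_stokes T f v P -> 0 <= t < T -> cyl x ->
  'D_(e_ i) (P t) x = \sum_(j < 3) ddcomp (spacetime v) j i (t, x)
    - \sum_(j < 3) comp (spacetime v) j (t, x) * dcomp (spacetime v) (Some j) i (t, x)
    - dcomp (spacetime v) None i (t, x) - f t x 0 i.
Proof.
move=> NS tT cx; have [_ E _] := NS t x tT cx.
rewrite -(laplacianE v t x i) -[X in _ - X - _ - _](convectionE v t x i) -derive1E_time.
rewrite -E !mxE; ring.
Qed.

(** Off the axis the frame (e_r, e_theta) is orthonormal and does not depend on x_3, so the
    slip condition gives back the vertical derivatives of the Cartesian components. On the
    axis, where the frame is undefined, they vanish by continuity along a radius. *)
Lemma total_slip_comp T v t x (i : 'I_3) :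
  total_slip T v -> (forall z, cylT `[0, T[%classic z -> C2_at (spacetime v) z) ->
  0 <= t < T -> horizontal_boundary x -> i != i3 ->
  dcomp (spacetime v) (Some i3) i (t, x) = 0.
Proof.
move=> slip C2 tT.
have zT y : horizontal_boundary y -> cylT `[0, T[%classic (t, y).
  by move=> hy; split=> /=; [rewrite in_itv|exact: (@bdry_cyl _ i3)].
have dv y j : horizontal_boundary y -> is_derive y (e_ i3) (fun y => v t y 0 j)
    (dcomp (spacetime v) (Some i3) j (t, y)).
  move=> hy; have [_ _ _ H _] := C2 _ (zT _ hy) j i3 (Some i3).
  exact: (is_derive_space H).
have off y : horizontal_boundary y -> Defs.radius y != 0 -> i != i3 ->
    dcomp (spacetime v) (Some i3) i (t, y) = 0.
  move=> hy ry; have [/(_ ry)[Hr Ht] _] := slip t y tT hy.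
  have dsum (a : X -> X) : (forall h : R, a (h *: e_ i3 + y) = a y) ->
      'D_(e_ i3) (fun y' => dotp (v t y') (a y')) y =
      \sum_(k < 3) dcomp (spacetime v) (Some i3) k (t, y) * a y 0 k.
    move=> ainv.
    have -> : 'D_(e_ i3) (fun y' => dotp (v t y') (a y')) y =
        'D_(e_ i3) (fun y' => dotp (v t y') (a y)) y.
      rewrite /derive; set g1 := fun h => h^-1 *: _; set g2 := fun h => h^-1 *: _.
      suff -> : g1 = g2 by [].
      by apply/funext => h; rewrite /g1 /g2 /= ainv.
    have D k := is_deriveZ (a y 0 k) (dv y k hy).
    have [_ E] := is_deriveD (D i1) (is_deriveD (D i2) (D i3)).
    rewrite sum_ord3 ![_ * a y 0 _]mulrC -E.
    congr ('D_ _ _ y); apply/funext => y'.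
    by rewrite /dotp sum_ord3 ![_ * a y 0 _]mulrC.
  have inv3 (h : R) : (h *: e_ i3 + y) 0 i1 = y 0 i1 /\ (h *: e_ i3 + y) 0 i2 = y 0 i2.
    by rewrite !mxE /= !mulr0 !add0r.
  move: Hr Ht; rewrite !dsum; last 2 first.
  - by move=> h; have [h1 h2] := inv3 h; rewrite /e_theta /Defs.radius h1 h2.
  - by move=> h; have [h1 h2] := inv3 h; rewrite /e_r /Defs.radius h1 h2.
  rewrite !sum_ord3 !mxE /= !mulr0 !addr0.
  set D1 := dcomp _ _ i1 _; set D2 := dcomp _ _ i2 _.
  set c := y 0 i1 / _; set s := y 0 i2 / _ => E1 E2.
  have cs : c ^+ 2 + s ^+ 2 = 1.
    have r2 : 0 < y 0 i1 ^+ 2 + y 0 i2 ^+ 2 by move: ry; rewrite sqrtr_eq0 -ltNge.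
    rewrite /c /s !expr_div_n -mulrDl /Defs.radius sqr_sqrtr ?(ltW r2)//.
    by rewrite divff// gt_eqF.
  have D10 : D1 = 0.
    transitivity ((c ^+ 2 + s ^+ 2) * D1); first by rewrite cs mul1r.
    transitivity (c * (D1 * c + D2 * s) - s * (D1 * - s + D2 * c)); first ring.
    by rewrite E1 E2; ring.
  have D20 : D2 = 0.
    transitivity ((c ^+ 2 + s ^+ 2) * D2); first by rewrite cs mul1r.
    transitivity (s * (D1 * c + D2 * s) + c * (D1 * - s + D2 * c)); first ring.
    by rewrite E1 E2; ring.
  by move: i; elim/ord3P.
move=> hx i_3; have [rx|] := eqVneq (Defs.radius x) 0; last by move=> rx; exact: off.
have r0 : x 0 i1 ^+ 2 + x 0 i2 ^+ 2 = 0.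
  apply/eqP; rewrite eq_le addr_ge0 ?sqr_ge0// andbT -sqrtr_eq0.
  by apply/eqP.
have /andP[/eqP x1 /eqP x2] : (x 0 i1 == 0) && (x 0 i2 == 0).
  by move/eqP: r0; rewrite paddr_eq0 ?sqr_ge0// !sqrf_eq0.
have hs (s : R) : 0 < s -> s <= 1 -> horizontal_boundary (upd i1 x s) /\ Defs.radius (upd i1 x s) != 0.
  move=> s0 s1; have rs : Defs.radius (upd i1 x s) = s.
    by rewrite /Defs.radius !mxE /= x2 expr0n addr0 sqrtr_sqr gtr0_norm.
  split; last by rewrite rs gt_eqF.
  by split; [rewrite rs|case: hx => _; rewrite !mxE].
have [_ cd _ _ _] := C2 _ (zT _ hx) i i3 (Some i3).
have u0 : upd i1 x 0 = x by apply/rowP; elim/ord3P; rewrite !mxE.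
have cl : (fun s => dcomp (spacetime v) (Some i3) i (t, upd i1 x s)) s @[s --> (0 : R)^'+] -->
    dcomp (spacetime v) (Some i3) i (t, x).
  apply: cvg_at_right_filter; rewrite -{2}u0.
  apply: (@continuous_comp _ _ _ (upd i1 x) (fun y => dcomp (spacetime v) (Some i3) i (t, y))).
    exact: continuous_upd.
  by rewrite u0; exact: continuous_slice.
have cl0 : (fun s => dcomp (spacetime v) (Some i3) i (t, upd i1 x s)) s @[s --> (0 : R)^'+] --> (0 : R).
  apply: cvg_near_cst; near=> s.
  have [h1 h2] : horizontal_boundary (upd i1 x s) /\ Defs.radius (upd i1 x s) != 0.
    by apply: hs; near: s; [exact: nbhs_right_gt|exact: nbhs_right_le].
  exact: off.
exact: (cvg_unique _ cl cl0).
Unshelve. all: by end_near. Qed.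

End SmoothSolutions.

Section Combinators.
Context {R : realType} {V : normedModType R}.
Implicit Types (f g : V -> R) (x w : V).

Lemma is_derive_mul f g x w df dg : is_derive x w f df -> is_derive x w g dg ->
  is_derive x w (fun y => f y * g y) (f x * dg + g x * df).
Proof. by move=> Hf Hg; exact: (is_deriveM Hf Hg). Qed.

Lemma is_derive_add f g x w df dg : is_derive x w f df -> is_derive x w g dg ->
  is_derive x w (fun y => f y + g y) (df + dg).
Proof. by move=> Hf Hg; exact: (is_deriveD Hf Hg). Qed.

Lemma is_derive_sub f g x w df dg : is_derive x w f df -> is_derive x w g dg ->
  is_derive x w (fun y => f y - g y) (df - dg).
Proof. by move=> Hf Hg; exact: (is_deriveB Hf Hg). Qed.

Lemma is_derive_const (c : R) x w : is_derive x w (fun _ : V => c) 0.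
Proof. exact: (is_derive_cst c x w). Qed.

End Combinators.

Section ContinuousCombinators.
Context {R : realType} {V : topologicalType}.
Implicit Types (f g : V -> R) (x : V).

Lemma continuous_mul f g x : {for x, continuous f} -> {for x, continuous g} ->
  {for x, continuous (fun y => f y * g y)}.
Proof. by move=> cf cg; exact: (continuousM cf cg). Qed.

Lemma continuous_add f g x : {for x, continuous f} -> {for x, continuous g} ->
  {for x, continuous (fun y => f y + g y)}.
Proof. by move=> cf cg; exact: (continuousD cf cg). Qed.

Lemma continuous_sub f g x : {for x, continuous f} -> {for x, continuous g} ->
  {for x, continuous (fun y => f y - g y)}.
Proof. by move=> cf cg; exact: (continuousB cf cg). Qed.

Lemma continuous_const (c : R) x : {for x, continuous (fun _ : V => c)}.
Proof. exact: cvg_cst. Qed.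

Lemma continuous_sum3 (F : 'I_3 -> V -> R) x : (forall i, {for x, continuous (F i)}) ->
  {for x, continuous (fun y => \sum_(i < 3) F i y)}.
Proof.
move=> cF; rewrite (_ : (fun y => _) = (fun y => F i1 y + (F i2 y + F i3 y))).
  by do 2! [apply: continuous_add; first exact: cF]; exact: cF.
by apply/funext => y; rewrite sum_ord3.
Qed.

End ContinuousCombinators.

Section DeriveSum.
Context {R : realType} {V : normedModType R}.
Lemma is_derive_sum3 (F : 'I_3 -> V -> R) x w (dF : 'I_3 -> R) :
  (forall i, is_derive x w (F i) (dF i)) ->
  is_derive x w (fun y => \sum_(i < 3) F i y) (\sum_(i < 3) dF i).
Proof.
move=> DF; rewrite (_ : (fun y => _) = (fun y => F i1 y + (F i2 y + F i3 y))).
  by rewrite sum_ord3; exact: (is_derive_add (DF i1) (is_derive_add (DF i2) (DF i3))).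
by apply/funext => y; rewrite sum_ord3.
Qed.
End DeriveSum.

Lemma integral_nonpos d (U : measurableType d) (R : realType) (mu : {measure set U -> \bar R})
  (D : set U) (f : U -> \bar R) : (forall x, D x -> (f x <= 0)%E) -> (\int[mu]_(x in D) f x <= 0)%E.
Proof.
move=> f0; rewrite integralE.
have -> : (\int[mu]_(x in D) f^\+ x = 0)%E.
  by apply: integral0_eq => x Dx; rewrite funeposE; apply/max_idPr; exact: f0.
by rewrite sub0e oppe_le0; apply: integral_ge0 => x _; exact: funeneg_ge0.
Qed.

Section SpaceTimeIntegral.
Context {R : realType}.
Notation mR := (measurableTypeR R).
Notation mu := (@lebesgue_measure R).
Local Notation X := 'rV[R]_3.
Local Notation Z := (R * 'rV[R]_3)%type.

(** Here D is the increment of a quantity with time derivative H; by Fubini's theorem, the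
    integral of D over the cylinder is at most 0 if that of H is at all times. *)
Lemma space_time_integral_le0 (H : Z -> R) (D : X -> R) (t0 : R) :
  (forall z, cylT `[0, t0]%classic z -> {for z, continuous H}) ->
  (forall t, 0 <= t <= t0 -> (int_cyl (fun x => H (t, x)) <= 0)%E) ->
  (forall x, cyl x -> (\int[mu]_(s in segm 0%R t0) (H (s, x))%:E = (D x)%:E)%E) ->
  (int_cyl D <= 0)%E.
Proof.
move=> cH Ht Hx.
pose S : set (mR * (mR * mR * mR)) := segm 0 t0 `*` cyl3.
have SE : S = @pt4 R @^-1` cylT `[0, t0]%classic by [].
have mS : measurable S by apply: measurableX; [exact: measurable_segm|exact: measurable_cyl3].
pose Ht4 (z : mR * (mR * mR * mR)) : \bar R := ((fun z => (H (pt4 z))%:E) \_ S) z.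
have mHt : measurable_fun [set: mR * (mR * mR * mR)] Ht4.
  apply: (measurable_restrictT _ mS).1; apply/measurable_EFinP.
  rewrite SE; apply: (measurable_continuous4 (A := cylT `[0, t0]%classic)) => //.
have [K K0 HK] := compact_bound (@compact_cylT R 0 t0) cH.
have bH z : (`|Ht4 z| <= (K * \1_(segm 0 t0 `*` cube) z)%:E)%E.
  rewrite /Ht4 patchE; case: ifPn => [|_]; last by rewrite abse0 lee_fin mulr_ge0.
  rewrite inE => -[z1 z2]; rewrite indicE mem_set ?mulr1.
    by rewrite lee_fin; apply: HK; split.
  by split=> //; exact: cyl3_cube.
have IH : (mu \x lebesgue3)%E.-integrable [set: mR * (mR * mR * mR)] Ht4.
  apply: (integrable_bounded_support mHt _ _ bH).
    by apply: measurableX; [exact: measurable_segm|exact: measurable_cube].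
  rewrite [X in (X < _)%E](_ : _ = (mu (segm 0 t0) * lebesgue3 (@cube R))%E); last first.
    by apply: product_measure1E; [exact: measurable_segm|exact: measurable_cube].
  by rewrite lte_mul_pinfty// ?ge0_fin_numE// ?lebesgue_segm_lty ?lebesgue_cube_lty.
have Fub := @Fubini _ _ _ _ R mu lebesgue3 Ht4 IH.
have -> : int_cyl D = (\int[lebesgue3]_y \int[mu]_s Ht4 (s, y))%E.
  rewrite /int_cyl leb3E integral_mkcond; apply: eq_integral => y _.
  rewrite patchE; case: ifPn => [|ny].
    rewrite inE => cy; rewrite -(Hx _ cy) integral_mkcond; apply: eq_integral => s _.
    rewrite /Ht4 !patchE; congr (if _ then _ else _).
    by apply/idP/idP; rewrite !inE; [move=> ss; split|case].
  rewrite integral0_eq// => s _; rewrite /Ht4 patchE memNset// => -[_ cy].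
  by move: ny; rewrite notin_setE.
rewrite -Fub.
apply: integral_nonpos => s _.
have [ss|ns] := pselect (0 <= s <= t0).
  rewrite (_ : (\int[_]_y _)%E = int_cyl (fun x => H (s, x))); first exact: Ht.
  rewrite /int_cyl leb3E [RHS]integral_mkcond; apply: eq_integral => y _.
  rewrite /Ht4 !patchE; congr (if _ then _ else _).
  apply/idP/idP; rewrite !inE; first by case.
  by move=> cy; split=> //; rewrite /segm/= in_itv.
rewrite integral0_eq// => y _; rewrite /Ht4 patchE memNset// => -[].
by rewrite /segm/= in_itv.
Qed.

End SpaceTimeIntegral.

Section Energy.
Context {R : realType}.
Local Notation X := 'rV[R]_3.
Local Notation Z := (R * 'rV[R]_3)%type.

(** The energy balance of u = w - v at a point. The bracket is the divergence of the flux
    u . du - |u|^2 w / 2 - q u, where q is the difference of the pressures. The remainder is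
    minus the dissipation |du|^2, minus the stretching u . (u . dv), and two terms with factor
    div u or div w. The stretching is at most M (|u_1| + |u_2| + |u_3|)^2 <= 3 M |u|^2. *)
Lemma energy_balance (u v w p dtu : 'I_3 -> R) (du dv dw ddu : 'I_3 -> 'I_3 -> R) (q M : R) :
  (forall i, w i = u i + v i) -> (forall j i, dw j i = du j i + dv j i) ->
  \sum_(j < 3) du j j = 0 -> \sum_(j < 3) dw j j = 0 ->
  (forall j i, `|dv j i| <= M) ->
  (forall i, dtu i = \sum_(j < 3) ddu j i
     - (\sum_(j < 3) w j * dw j i - \sum_(j < 3) v j * dv j i) - p i) ->
  \sum_(i < 3) u i * dtu i <=
  \sum_(j < 3) (\sum_(i < 3) (u i * ddu j i + du j i * du j i)
     - (w j * (\sum_(i < 3) (u i * du j i)) + 2^-1 * (\sum_(i < 3) u i * u i) * dw j j)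
     - (q * du j j + u j * p j))
   + 3 * M * \sum_(i < 3) u i * u i.
Proof.
move=> wE dwE divu divw dvM dtE.
have uv : - (3 * M * \sum_(i < 3) u i * u i) <= \sum_(i < 3) \sum_(j < 3) u i * (u j * dv j i).
  have key i j : - (M * (2^-1 * (u i * u i) + 2^-1 * (u j * u j))) <= u i * (u j * dv j i).
    rewrite lerNl -mulrN -mulrN; apply: (le_trans (ler_norm _)).
    rewrite normrM normrM normrN mulrA mulrC ler_pM//.
    rewrite -normrM ler_norml; apply/andP; split.
      by have := sqr_ge0 (u i + u j); lra.
    by have := sqr_ge0 (u i - u j); lra.
  rewrite !sum_ord3; have := key i1 i1; have := key i1 i2; have := key i1 i3.
  have := key i2 i1; have := key i2 i2; have := key i2 i3.
  have := key i3 i1; have := key i3 i2; have := key i3 i3.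
  lra.
have du0 : 0 <= \sum_(j < 3) \sum_(i < 3) du j i * du j i.
  by apply: sumr_ge0 => j _; apply: sumr_ge0 => i _; rewrite -expr2 sqr_ge0.
rewrite -subr_ge0 [leRHS](_ : _ = \sum_(j < 3) \sum_(i < 3) du j i * du j i
   + (\sum_(i < 3) \sum_(j < 3) u i * (u j * dv j i) + 3 * M * \sum_(i < 3) u i * u i)
   - q * (\sum_(j < 3) du j j) - 2^-1 * (\sum_(i < 3) u i * u i) * (\sum_(j < 3) dw j j)).
  by rewrite divu divw !mulr0 !subr0 addr_ge0// -lerBlDr sub0r.
rewrite !sum_ord3 !dtE !sum_ord3 !dwE !wE; ring.
Qed.

End Energy.

Section Uniqueness.
Context {R : realType}.
Notation mR := (measurableTypeR R).
Notation mu := (@lebesgue_measure R).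
Local Notation X := 'rV[R]_3.
Local Notation Z := (R * 'rV[R]_3)%type.
Variables (T : R) (f v w : R -> X -> X) (v0 : X -> X) (P Q : R -> X -> R).
Hypotheses (NSv : NS_solution T f v0 v P) (NSw : NS_solution T f v0 w Q).

Let V : Z -> X := spacetime v.
Let W : Z -> X := spacetime w.

Let C2V z : cylT `[0, T[%classic z -> C2_at V z.
Proof. by case: NSv => sv *; exact: (smooth_C2 sv). Qed.

Let C2W z : cylT `[0, T[%classic z -> C2_at W z.
Proof. by case: NSw => sw *; exact: (smooth_C2 sw). Qed.

Let u i z := comp W i z - comp V i z.
Let du d i z := dcomp W d i z - dcomp V d i z.
Let ddu j i z := ddcomp W j i z - ddcomp V j i z.

(** The pressures are only assumed differentiable in x. The equations express the gradient of
    their difference through the velocities, whence its continuity. *)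
Let pg i z := \sum_(j < 3) ddu j i z
  - (\sum_(j < 3) comp W j z * dcomp W (Some j) i z
     - \sum_(j < 3) comp V j z * dcomp V (Some j) i z) - du None i z.

Let q (t : R) x := Q t x - P t x.

Let flux j (t : R) x := (\sum_(i < 3) u i (t, x) * du (Some j) i (t, x))
  - 2^-1 * (\sum_(i < 3) u i (t, x) * u i (t, x)) * comp W j (t, x)
  - q t x * u j (t, x).

Let dflux j (t : R) x := (\sum_(i < 3) (u i (t, x) * ddu j i (t, x)
       + du (Some j) i (t, x) * du (Some j) i (t, x)))
  - (comp W j (t, x) * (\sum_(i < 3) (u i (t, x) * du (Some j) i (t, x)))
     + 2^-1 * (\sum_(i < 3) u i (t, x) * u i (t, x)) * dcomp W (Some j) j (t, x))
  - (q t x * du (Some j) j (t, x) + u j (t, x) * pg j (t, x)).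

Let cz (t : R) x : 0 <= t < T -> cyl x -> cylT `[0, T[%classic (t, x).
Proof. by move=> tT cx; split=> //=; rewrite in_itv. Qed.

Let cont_u i z : cylT `[0, T[%classic z -> {for z, continuous (u i)}.
Proof.
move=> zT; have [c1 _ _ _ _] := C2W zT i i None; have [c2 _ _ _ _] := C2V zT i i None.
exact: (continuous_sub c1 c2).
Qed.

Let cont_du d i z : cylT `[0, T[%classic z -> {for z, continuous (du d i)}.
Proof.
move=> zT; have [_ c1 _ _ _] := C2W zT i i d; have [_ c2 _ _ _] := C2V zT i i d.
exact: (continuous_sub c1 c2).
Qed.

Let cont_ddu j i z : cylT `[0, T[%classic z -> {for z, continuous (ddu j i)}.
Proof.
move=> zT; have [_ _ c1 _ _] := C2W zT i j None; have [_ _ c2 _ _] := C2V zT i j None.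
exact: (continuous_sub c1 c2).
Qed.

Let cont_pg i z : cylT `[0, T[%classic z -> {for z, continuous (pg i)}.
Proof.
move=> zT; apply: continuous_sub; last exact: cont_du.
apply: continuous_sub; first by apply: continuous_sum3 => j; exact: cont_ddu.
apply: continuous_sub; apply: continuous_sum3 => j; apply: continuous_mul.
- by have [c _ _ _ _] := C2W zT j j None.
- by have [_ c _ _ _] := C2W zT i j (Some j).
- by have [c _ _ _ _] := C2V zT j j None.
- by have [_ c _ _ _] := C2V zT i j (Some j).
Qed.

Let D_u i d z : cylT `[0, T[%classic z -> is_derive z (axis d) (u i) (du d i z).
Proof.
move=> zT; have [_ _ _ c1 _] := C2W zT i i d; have [_ _ _ c2 _] := C2V zT i i d.
exact: (is_derive_sub c1 c2).
Qed.

Let D_du i j z : cylT `[0, T[%classic z ->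
  is_derive z (axis (Some j)) (du (Some j) i) (ddu j i z).
Proof.
move=> zT; have [_ _ _ _ c1] := C2W zT i j None; have [_ _ _ _ c2] := C2V zT i j None.
exact: (is_derive_sub c1 c2).
Qed.

Let D_q (t : R) x i : 0 <= t < T -> cyl x -> is_derive x (e_ i) (q t) (pg i (t, x)).
Proof.
move=> tT cx; have zT := cz tT cx.
case: (NSv) => _ nsv _ _ _; case: (NSw) => _ nsw _ _ _.
have [dP _ _] := nsv t x tT cx; have [dQ _ _] := nsw t x tT cx.
have DP : is_derive x (e_ i) (P t) ('D_(e_ i) (P t) x).
  by apply: derivableP; exact: diff_derivable.
have DQ : is_derive x (e_ i) (Q t) ('D_(e_ i) (Q t) x).
  by apply: derivableP; exact: diff_derivable.
apply: (is_derive_eq (is_derive_sub DQ DP)).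
rewrite (navier_stokes_comp i nsv tT cx) (navier_stokes_comp i nsw tT cx).
have E (A B C D a b c : R) : A - B - a - c - (C - D - b - c) = A - C - (B - D) - (a - b).
  by ring.
rewrite /pg (_ : \sum_(j < 3) ddu j i (t, x) = \sum_(j < 3) ddcomp W j i (t, x)
    - \sum_(j < 3) ddcomp V j i (t, x)); last by rewrite -sumrB.
exact: E.
Qed.

Let cont_q (t : R) x : 0 <= t < T -> cyl x -> {for x, continuous (q t)}.
Proof.
move=> tT cx; case: (NSv) => _ nsv _ _ _; case: (NSw) => _ nsw _ _ _.
have [dP _ _] := nsv t x tT cx; have [dQ _ _] := nsw t x tT cx.
by apply: continuous_sub; exact: differentiable_continuous.
Qed.

Let D_flux j (t : R) x : 0 <= t < T -> cyl x -> is_derive x (e_ j) (flux j t) (dflux j t x).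
Proof.
move=> tT cx; have zT := cz tT cx.
have Hu i := is_derive_space (D_u i (Some j) zT).
have Hdu i := is_derive_space (D_du i j zT).
have [_ _ _ c1 _] := C2W zT j j (Some j); have Hw := is_derive_space c1.
have H1 := is_derive_sum3 (fun i => is_derive_mul (Hu i) (Hdu i)).
have H2 := is_derive_mul (is_derive_mul (is_derive_const (2^-1) x (e_ j))
  (is_derive_sum3 (fun i => is_derive_mul (Hu i) (Hu i)))) Hw.
have H3 := is_derive_mul (D_q j tT cx) (Hu j).
apply: (is_derive_eq (is_derive_sub (is_derive_sub H1 H2) H3)).
by rewrite /dflux !sum_ord3; field.
Qed.

Let cont_dflux j (t : R) x : 0 <= t < T -> cyl x -> {for x, continuous (dflux j t)}.
Proof.
move=> tT cx; have zT := cz tT cx.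
have Hu i := continuous_slice (@cont_u i _ zT).
have Hdu d i := continuous_slice (@cont_du d i _ zT).
have Hddu i := continuous_slice (@cont_ddu j i _ zT).
have [c1 c2 _ _ _] := C2W zT j j (Some j).
apply: continuous_sub; first apply: continuous_sub.
- by apply: continuous_sum3 => i; apply: continuous_add; apply: continuous_mul.
- apply: continuous_add; apply: continuous_mul.
  + exact: continuous_slice c1.
  + by apply: continuous_sum3 => i; exact: continuous_mul.
  + apply: continuous_mul; first exact: continuous_const.
    by apply: continuous_sum3 => i; exact: continuous_mul.
  + exact: continuous_slice c2.
- apply: continuous_add; apply: continuous_mul => //; first exact: cont_q.
  exact: continuous_slice (@cont_pg j _ zT).
Qed.

(** For j = 1, 2 all of u vanishes on the lateral surface; for j = 3, the faces have w_3 = 0,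
    u_3 = 0 and no vertical derivative of u_1 and u_2. *)
Let flux_bdry j (t : R) x : 0 <= t < T -> bdry j x -> flux j t x = 0.
Proof.
move=> tT bx; have cx := bdry_cyl bx; have zT := cz tT cx.
case: (NSv) => _ _ _ nsv tsv; case: (NSw) => _ _ _ nsw tsw.
move: bx; rewrite /bdry; case: eqVneq => [->|j3] bx; last first.
  have u0 i : u i (t, x) = 0.
    by rewrite /u /comp /V /W /spacetime/= nsv// nsw// subrr.
  by rewrite /flux !sum_ord3 !u0; ring.
have w3 : comp W i3 (t, x) = 0.
  have [_] := tsw t x tT bx; rewrite /dotp sum_ord3 !mxE /=.
  by rewrite !mulr0 !add0r mulr1.
have v3 : comp V i3 (t, x) = 0.
  have [_] := tsv t x tT bx; rewrite /dotp sum_ord3 !mxE /=.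
  by rewrite !mulr0 !add0r mulr1.
have u3 : u i3 (t, x) = 0 by rewrite /u w3 v3 subrr.
have du0 i : i != i3 -> du (Some i3) i (t, x) = 0.
  move=> ii3; rewrite /du (total_slip_comp tsw C2W tT bx ii3).
  by rewrite (total_slip_comp tsv C2V tT bx ii3) subrr.
by rewrite /flux !sum_ord3 u3 w3 (du0 i1)// (du0 i2)//; ring.
Qed.

Let int_flux (t : R) : 0 <= t < T -> int_cyl (fun x => \sum_(j < 3) dflux j t x) = 0%E.
Proof.
move=> tT.
have I0 j : int_cyl (dflux j t) = 0%E.
  apply: (@integral_partial_cyl _ (flux j t) (dflux j t) j).
  - by move=> x cx; exact: D_flux.
  - by move=> x cx; exact: cont_dflux.
  - by move=> x bx; exact: flux_bdry.
have C j : continuous_cyl (dflux j t) by move=> x cx; exact: cont_dflux.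
rewrite (_ : (fun x => _) = (fun x => dflux i1 t x + (dflux i2 t x + dflux i3 t x))); last first.
  by apply/funext => x; rewrite sum_ord3.
have C23 : continuous_cyl (fun x => dflux i2 t x + dflux i3 t x).
  by move=> x cx; apply: continuous_add; exact: C.
have E23 := int_cylD (C i2) (C i3); have E := int_cylD (C i1) C23.
by apply: (eq_trans E); rewrite E23 !I0 !adde0.
Qed.

Let energy z := \sum_(i < 3) u i z * u i z.

(** The factor exp(- 6 M t) turns Groenwall's inequality into a sign: the function H below, the
    time derivative of exp(- 6 M t) |u|^2, is at most a multiple of the divergence of the flux,
    which has integral 0. *)
Lemma NS_unique (t : R) x : 0 <= t < T -> cyl x -> w t x = v t x.
Proof.
move=> /andP[t0 tT] cx.
have sub z : cylT `[0, t]%classic z -> cylT `[0, T[%classic z.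
  move=> [z1 z2]; split=> //; move: z1; rewrite /= !in_itv/= => /andP[-> z1].
  exact: le_lt_trans tT.
(* the gradient of [v] may be unbounded near T, hence the restriction to times up to [t] *)
have [M M0 HM] : exists2 M, 0 <= M &
    forall z, cylT `[0, t]%classic z -> forall j i, `|dcomp V (Some j) i z| <= M.
  have B (ji : 'I_3 * 'I_3) : exists M, 0 <= M /\
      forall z, cylT `[0, t]%classic z -> `|dcomp V (Some ji.1) ji.2 z| <= M.
    have [|M M0 HM] := @compact_bound R _ _ (dcomp V (Some ji.1) ji.2) (@compact_cylT R 0 t).
      by move=> z /sub zT; have [_ c _ _ _] := C2V zT ji.2 ji.1 (Some ji.1).
    by exists M.
  have [M HM] := choice B; exists (\sum_ji M ji).
    by apply: sumr_ge0 => ji _; exact: (HM ji).1.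
  move=> z zt j i; apply: (le_trans ((HM (j, i)).2 z zt)).
  by rewrite (bigD1 (j, i))//= lerDl sumr_ge0// => ji _; exact: (HM ji).1.
pose c : R := - (6 * M).
pose G z := expR (c * z.1) * energy z.
pose H z := expR (c * z.1) * (2 * \sum_(i < 3) u i z * du None i z + c * energy z).
have cexp : continuous (fun z : Z => expR (c * z.1)).
  move=> z; apply: (@continuous_comp _ _ _ (fun z : Z => c * z.1) expR).
    by apply: cvgM; [exact: cvg_cst|exact: cvg_fst].
  exact: continuous_expR.
have cen z : cylT `[0, T[%classic z -> {for z, continuous energy}.
  by move=> zT; apply: continuous_sum3 => i; apply: continuous_mul; exact: cont_u.
have cH z : cylT `[0, T[%classic z -> {for z, continuous H}.
  move=> zT.
  have c1 : {for z, continuous (fun z => \sum_(i < 3) u i z * du None i z)}.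
    by apply: continuous_sum3 => i; apply: continuous_mul; [exact: cont_u|exact: cont_du].
  have c2 := continuous_mul (@continuous_const _ _ 2 z) c1.
  have c3 := continuous_mul (@continuous_const _ _ c z) (cen z zT).
  exact: (continuous_mul (cexp z) (continuous_add c2 c3)).
have DG s y : 0 <= s < T -> cyl y -> is_derive s 1 (fun r => G (r, y)) (H (s, y)).
  move=> sT cy; have zT := cz sT cy.
  have D1 : is_derive s 1 (fun r => expR (c * r)) (expR (c * s) * c).
    apply: is_derive1_comp.
    by apply: (is_derive_eq (is_derive_mul (is_derive_const c s 1) (is_derive_id s (1:R)))); ring.
  have D2 i := is_derive_time (D_u i None zT).
  have D3 := is_derive_sum3 (fun i => is_derive_mul (D2 i) (D2 i)).
  apply: (is_derive_eq (is_derive_mul D1 D3)).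
  rewrite /H /energy !sum_ord3 /=; ring.
have int0 : (int_cyl (fun y => G (t, y)) <= 0)%E.
  apply: (@space_time_integral_le0 _ H _ t).
  - by move=> z /sub; exact: cH.
  - move=> s /andP[s0 st]; have sT : 0 <= s < T by rewrite s0 (le_lt_trans st tT).
    have Cs : continuous_cyl (fun y => H (s, y)).
      by move=> y cy; apply: continuous_slice; apply: cH; exact: cz.
    have Cf : continuous_cyl (fun y => \sum_(j < 3) dflux j s y).
      by move=> y cy; apply: continuous_sum3 => j; exact: cont_dflux.
    apply: (@le_trans _ _ (int_cyl (fun y => (2 * expR (c * s)) * \sum_(j < 3) dflux j s y))).
      apply: int_cyl_le => //.
        by move=> y cy; apply: continuous_mul; [exact: continuous_const|exact: Cf].
      move=> y cy; have zT := cz sT cy.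
      rewrite /H /= [2 * expR _]mulrC -[leRHS]mulrA ler_wpM2l ?expR_ge0//.
      have divw : \sum_(j < 3) dcomp W (Some j) j (s, y) = 0.
        by case: (NSw) => _ nsw _ _ _; have [_ _] := nsw s y sT cy; rewrite divergenceE.
      have divv : \sum_(j < 3) dcomp V (Some j) j (s, y) = 0.
        by case: (NSv) => _ nsv _ _ _; have [_ _] := nsv s y sT cy; rewrite divergenceE.
      have divu : \sum_(j < 3) du (Some j) j (s, y) = 0.
        by rewrite /du sumrB divw divv subrr.
      have := @energy_balance R (fun i => u i (s, y)) (fun i => comp V i (s, y))
        (fun i => comp W i (s, y)) (fun i => pg i (s, y)) (fun i => du None i (s, y))
        (fun j i => du (Some j) i (s, y)) (fun j i => dcomp V (Some j) i (s, y))
        (fun j i => dcomp W (Some j) i (s, y)) (fun j i => ddu j i (s, y)) (q s y) M.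
      rewrite -/(energy (s, y)) => EB.
      have : \sum_(i < 3) u i (s, y) * du None i (s, y) <=
          \sum_(j < 3) dflux j s y + 3 * M * energy (s, y).
        apply: EB => //.
        - by move=> i; rewrite /u subrK.
        - by move=> j i; rewrite /du subrK.
        - by move=> j i; apply: HM; split=> //=; rewrite in_itv/= s0.
        - by move=> i; rewrite /pg; ring.
      rewrite /c; lra.
    by rewrite int_cylZ// int_flux// mule0.
  - move=> y cy; rewrite /segm.
    have sT s : 0 <= s <= t -> 0 <= s < T.
      by move=> /andP[-> st]; exact: le_lt_trans tT.
    have D s : 0 <= s <= t -> is_derive s 1 (fun r => G (r, y)) (H (s, y)).
      by move=> /sT ?; exact: DG.
    have C s : 0 <= s <= t -> {for s, continuous (fun r => H (r, y))}.
      by move=> /sT ?; apply: continuous_slice_time; apply: cH; exact: cz.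
    rewrite (integral_derive t0 D C).
    have G0 : G (0, y) = 0.
      have u0 i : u i (0, y) = 0.
        case: (NSv) => _ _ iv _ _; case: (NSw) => _ _ iw _ _.
        by rewrite /u /comp /V /W /spacetime/= iv// iw// subrr.
      by rewrite /G /energy sum_ord3 !u0; ring.
    by rewrite G0 subr0.
have tT' : 0 <= t < T by rewrite t0.
have en0 y : cyl y -> 0 <= energy (t, y).
  by move=> _; apply: sumr_ge0 => i _; rewrite -expr2 sqr_ge0.
have Gx : G (t, x) = 0.
  apply: (@int_cyl_eq0 _ (fun y => G (t, y))) => //.
  - move=> y cy; apply: continuous_slice; apply: continuous_mul; first exact: cexp.
    by apply: cen; exact: cz.
  - by move=> y cy; rewrite mulr_ge0 ?expR_ge0 ?en0.
have E0 : energy (t, x) = 0.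
  by move/eqP: Gx; rewrite mulf_eq0 gt_eqF ?expR_gt0//= => /eqP.
apply/rowP => i; apply/eqP; rewrite -subr_eq0 -sqrf_eq0 expr2.
have := @psumr_eq0P _ _ xpredT (fun i : 'I_3 => u i (t, x) * u i (t, x)).
by move=> ->//; [move=> k _; rewrite -expr2 sqr_ge0].
Qed.

End Uniqueness.

(** * Weak derivatives *)

Section WeakDerivative.
Context {R : realType}.
Local Notation X := 'rV[R]_3.

Lemma interior_cyl_upd (x : X) i : (@cyl R)^° x ->
  exists2 e : R, 0 < e & forall s, `|s - x 0 i| < e -> cyl (upd i x s).
Proof.
move=> ix; have xE : upd i x (x 0 i) = x.
  by apply/rowP => j; rewrite !mxE; case: eqVneq => // ->.
have /nbhs_ballP[e /= e0 eP] : nbhs (x 0 i) [set s | cyl (upd i x s)].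
  by apply: (@continuous_upd _ i x (x 0 i)); rewrite xE.
by exists e => // s sx; apply: eP; rewrite /ball/= distrC.
Qed.

Lemma bdry_not_interior j (x : X) : bdry j x -> ~ (@cyl R)^° x.
Proof.
rewrite /bdry; case: ifP => _ [r1 H] ix.
  have [e e0 eP] := interior_cyl_upd i3 ix; case: H => x3.
    have /cylP[_] : cyl (upd i3 x (- (e / 2))).
      by apply: eP; rewrite x3 subr0 normrN gtr0_norm; lra.
    by rewrite !mxE /= => /andP[]; lra.
  have /cylP[_] : cyl (upd i3 x (1 + e / 2)).
    by apply: eP; rewrite x3 addrAC subrr add0r gtr0_norm; lra.
  by rewrite !mxE /= => /andP[]; lra.
have [e e0 eP] := interior_cyl_upd i1 ix.
have r2 : x 0 i1 ^+ 2 + x 0 i2 ^+ 2 = 1.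
  rewrite -[LHS]sqr_sqrtr ?addr_ge0 ?sqr_ge0//.
  by rewrite -[Num.sqrt _]/(Defs.radius x) r1 expr1n.
have [x1|x1] := leP 0 (x 0 i1).
  have /cylP[+ _] : cyl (upd i1 x (x 0 i1 + e / 2)).
    by apply: eP; rewrite addrAC subrr add0r gtr0_norm; lra.
  by rewrite !mxE /=; nra.
have /cylP[+ _] : cyl (upd i1 x (x 0 i1 - e / 2)).
  by apply: eP; rewrite addrAC subrr add0r normrN gtr0_norm; lra.
by rewrite !mxE /=; nra.
Qed.

(** The product of u with a test function vanishes on [bdry j], so [integral_partial_cyl]
    applies to it. *)
Lemma weak_partial_C1 j (u g : X -> R) :
  (forall x, cyl x -> is_derive x (e_ j) u (g x)) ->
  continuous_cyl u -> continuous_cyl g -> weak_partial j u g.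
Proof.
move=> Du cu cg phi [[U [oU sU CU]] [K [cK Kint phi0]]].
have [Cphi Dphi] := CU 1%N.
have cphi : continuous_cyl phi by move=> x cx; exact: (Cphi [::] x isT (sU x I)).
have cdphi : continuous_cyl ('D_(e_ j) phi).
  by move=> x cx; exact: (Cphi [:: e_ j] x isT (sU x I)).
have dphi x : is_derive x (e_ j) phi ('D_(e_ j) phi x).
  by apply: derivableP; exact: (Dphi [::] (e_ j) x isT (sU x I)).
have c1 : continuous_cyl (fun x => u x * 'D_(e_ j) phi x).
  by move=> x cx; exact: (continuous_mul (cu x cx) (cdphi x cx)).
have c2 : continuous_cyl (fun x => g x * phi x).
  by move=> x cx; exact: (continuous_mul (cg x cx) (cphi x cx)).
have : int_cyl (fun x => u x * 'D_(e_ j) phi x + g x * phi x) = 0%E.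
  apply: (@integral_partial_cyl _ (fun x => u x * phi x) _ j).
  - move=> x cx; apply: (is_derive_eq (is_derive_mul (Du x cx) (dphi x))).
    by rewrite [phi x * _]mulrC.
  - by move=> x cx; exact: (continuous_add (c1 x cx) (c2 x cx)).
  - move=> x bx; rewrite phi0 ?mulr0// => /Kint; exact: bdry_not_interior bx.
have -> := int_cylD c1 c2.
rewrite -/(int_cyl (fun x => u x * 'D_(e_ j) phi x)) -/(int_cyl (fun x => g x * phi x)).
have f1 : int_cyl (fun x => u x * 'D_(e_ j) phi x) \is a fin_num.
  exact: (integrable_fin_num (@measurable_cyl3 R) (integrable_cyl c1)).
have f2 : int_cyl (fun x => g x * phi x) \is a fin_num.
  exact: (integrable_fin_num (@measurable_cyl3 R) (integrable_cyl c2)).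
rewrite -(fineK f1) -(fineK f2) -EFinD -EFinN => -[h]; congr EFin.
by move: h; move: (fine _) (fine _) => a b; lra.
Qed.

End WeakDerivative.

(** * Blow-up *)

Section BlowUp.
Context {R : realType}.
Notation mR := (measurableTypeR R).
Local Notation X := 'rV[R]_3.
Local Notation Z := (R * 'rV[R]_3)%type.

(** The essential supremum dominates the value at a point, even at the boundary, because the
    superlevel sets of a continuous function have positive volume in the cylinder. *)
Lemma Lp_norm_oo_ge (g h : X -> R) x y : cyl x -> {for x, continuous h} -> y < h x ->
  (forall x', cyl x' -> h x' <= `|g x'|) -> (y%:E <= Lp_norm +oo%E g)%E.
Proof.
move=> cx ch yh hg; have [B [mB B0 Bc Bh]] := cyl_superlevel cx ch yh.
rewrite /Lp_norm unlock /=.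
have T0 : (0 < leb3 [set: mR * mR * mR])%E.
  by apply: (lt_le_trans B0); apply: (@le_measure _ _ _ lebesgue3); rewrite ?inE.
rewrite T0 leNgt; apply/negP => lty.
have [N [mN N0 sN]] := @ess_sup_ge _ _ _ leb3 (abse \o (EFin \o g \o @pt R) \_ cyl3).
have : (lebesgue3 B <= lebesgue3 N)%E.
  apply: le_measure; rewrite ?inE// => b Bb; apply: sN => /= le_b.
  have := le_lt_trans le_b lty; rewrite patchE mem_set; last exact: Bc.
  rewrite /= lte_fin; apply/negP; rewrite -leNgt.
  by apply: (le_trans (ltW (Bh _ Bb))); exact: (hg _ (Bc _ Bb)).
by rewrite [X in (_ <= X)%E]N0 leNgt B0.
Qed.

Lemma nabla_norm_ge m (u : X -> X) x (s : m.-tuple 'I_3) i :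
  `|iter_derive [seq e_ j | j <- s] u x 0 i| <= nabla_norm m u x.
Proof.
rewrite /nabla_norm -sqrtr_sqr ler_wsqrtr// (bigD1 i)//= (bigD1 s)//=.
rewrite -addrA lerDl addr_ge0//; first by apply: sumr_ge0 => s' _; rewrite sqr_ge0.
by apply: sumr_ge0 => i' _; apply: sumr_ge0 => s' _; rewrite sqr_ge0.
Qed.

Variables (T : R) (n : nat).

Definition partials (s : seq 'I_3) (e : @expr R) : @expr R :=
  foldr (fun j => partial n (Some j)) e s.

Lemma iter_derive_partials (e : 'I_3 -> @expr R) t x (s : seq 'I_3) : 0 < scale T n (t, x) ->
  iter_derive [seq e_ j | j <- s] (fun y => field T n e (t, y)) x =
  field T n (fun i => partials s (e i)) (t, x).
Proof.
elim: s x => [//|j s IH] x Az /=.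
rewrite (@near_eq_derive _ _ _ _ (fun y => field T n (fun i => partials s (e i)) (t, y))).
  exact: derive_field_space.
have op : nbhs x [set y | 0 < scale T n (t, y)].
  have := open_nbhs_nbhs (conj (@open_scale_gt0 R T n) Az).
  move=> [[A B] /= [nA nB] sAB]; apply: filterS nB => y By.
  by apply: (sAB (t, y)); split=> //=; exact: nbhs_singleton nA.
by apply: filterS op => y; exact: IH.
Qed.

Lemma continuous_iter_partials (e : 'I_3 -> @expr R) t x (s : seq 'I_3) i : 0 < scale T n (t, x) ->
  {for x, continuous (fun y => iter_derive [seq e_ j | j <- s] (fun y => field T n e (t, y)) y 0 i)}.
Proof.
move=> Az; pose g (z : Z) : R := iter_derive [seq ((0, w) : Z) | w <- [seq e_ j | j <- s]]
  (field T n e) z 0 i.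
rewrite (_ : (fun y => _) = (fun y => g (t, y))); last first.
  by apply/funext => y; rewrite iter_derive_space.
apply: (@continuous_slice _ g).
by apply: continuous_comp_at; exact: continuous_iter_field.
Qed.

(** One component of one derivative, large at a single point at each time, is enough. The
    coefficient c adjusts its sign. *)
Lemma blow_up_of_lower_bound (e : 'I_3 -> @expr R) k (s : k.-tuple 'I_3) (i : 'I_3) (c eps K : R) :
  (0 < n)%N -> `|c| <= 1 -> 0 < eps -> 0 < K ->
  (forall t, t < T -> (T - t) ^+ n <= 16^-1 -> exists2 x : X, cyl x &
     K * ((T - t) ^+ n) `^ (- eps) <= c * sem T n (partials s (e i)) (t, x)) ->
  Lp_norm +oo%E (nabla_norm k (fun x => field T n e (t, x))) @[t --> T^'-] --> +oo%E.
Proof.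
move=> n0 c1 e0 K0 H; apply/cvgeyPge => M.
pose a := (`|M| + 1) / K; have a0 : 0 < a by rewrite divr_gt0// ltr_wpDl.
pose d := Num.min (16^-1) (a `^ (- eps^-1)).
have d0 : 0 < d by rewrite lt_min invr_gt0 ltr0n powR_gt0.
near=> t.
have tT : t < T by near: t; exact: nbhs_left_lt.
have dt : T - d < t by near: t; apply: nbhs_left_gt; rewrite ltrBlDr ltrDl.
have tau0 : 0 < T - t by rewrite subr_gt0.
have taud : T - t <= d by lra.
have d16 : d <= 16^-1 by rewrite ge_min lexx.
have taun : (T - t) ^+ n <= d.
  apply: le_trans taud; rewrite -[leRHS]expr1 ler_wiXn2l ?ltW//.
  lra.
have [x cx lb] := H t tT (le_trans taun d16).
have Az := scale_gt0 n x tT.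
apply: (@Lp_norm_oo_ge _ (fun y => c * iter_derive [seq e_ j | j <- s]
    (fun y => field T n e (t, y)) y 0 i) x) => //.
- by apply: continuous_mul; [exact: continuous_const|exact: continuous_iter_partials].
- rewrite iter_derive_partials// mxE; apply: lt_le_trans lb.
  apply: (@lt_le_trans _ _ (K * a)).
    rewrite /a mulrC divfK ?gt_eqF//; apply: (le_lt_trans (ler_norm M)); lra.
  rewrite ler_pM2l//.
  have -> : a = (a `^ (- eps^-1)) `^ (- eps).
    by rewrite -powRrM mulrNN mulVf ?gt_eqF// powRr1// ltW.
  apply: ler_powRN; [exact: exprn_gt0| |exact: ltW].
  by apply: (le_trans taun); rewrite ge_min lexx orbT.
- move=> y cy; apply: (le_trans (ler_norm _)); rewrite normrM.
  rewrite [leRHS]ger0_norm; last exact: sqrtr_ge0.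
  apply: le_trans (nabla_norm_ge _ _ s i).
  by rewrite ler_piMl.
Unshelve. all: by end_near. Qed.

End BlowUp.

Section LowerBounds.
Context {R : realType}.
Variables (T : R) (n : nat) (eps : R).
Hypotheses (n0 : (0 < n)%N) (e0 : 0 < eps) (e4 : eps <= 4^-1).
Local Notation X := 'rV[R]_3.

(** Where r^2 = (T - t)^n = d one has A = 2 d: this is the size of r A^(- (eps + 1/2)) there. *)
Lemma half_power (d : R) : 0 < d ->
  2^-1 * d `^ (- eps) <= Num.sqrt d * (d + d) `^ (- (eps + 2^-1)).
Proof.
move=> d0.
rewrite -[d + d](_ : 2 * d = _); last by rewrite mulr_natl mulr2n.
rewrite powRM ?(ltW d0)// -powR12_sqrt ?(ltW d0)// mulrCA -powRD; last by rewrite (gt_eqF d0) implybT.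
rewrite (_ : 2^-1 + - (eps + 2^-1) = - eps); last ring.
rewrite ler_wpM2r ?powR_ge0//.
rewrite -[leLHS]powR_inv1// ler_powR ?ler1n//; move: e4; lra.
Qed.

Lemma cyl_pt (a b : R) : a ^+ 2 + b ^+ 2 <= 1 -> cyl (row3 a b (2^-1)).
Proof.
move=> ab; apply/cylP; rewrite !mxE/=; split=> //.
by rewrite invr_ge0 ler0n invf_le1// ler1n.
Qed.

(** The velocity itself, at distance sqrt d from the axis. *)
Lemma lower_bound1 t : t < T -> (T - t) ^+ n <= 16^-1 -> exists2 x : X, cyl x &
  16^-1 * ((T - t) ^+ n) `^ (- eps) <= 1 * sem T n (partials n [::] (swirl (eps + 2^-1) i2)) (t, x).
Proof.
move=> tT d16; set d := (T - t) ^+ n in d16 *.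
have d0 : 0 < d by rewrite exprn_gt0// subr_gt0.
exists (row3 (Num.sqrt d) 0 (2^-1)).
  by apply: cyl_pt; rewrite sqr_sqrtr ?(ltW d0)// expr0n addr0; lra.
have sd : Num.sqrt d * Num.sqrt d = d by rewrite -expr2 sqr_sqrtr// ltW.
rewrite /= /scale /= !mxE/= -/d !expr2 sd !mulr0 !addr0 !mul1r.
have := half_power d0; set A := d `^ (- eps); set B := _ `^ _ => hp.
have A0 : 0 <= A by exact: powR_ge0.
nra.
Qed.

(** On the axis the first derivative of - x_2 (1 - r^2) A^(- eps) in x_2 is - A^(- eps). *)
Lemma lower_bound2 t : t < T -> (T - t) ^+ n <= 16^-1 -> exists2 x : X, cyl x &
  16^-1 * ((T - t) ^+ n) `^ (- eps) <= (-1) * sem T n (partials n [:: i2] (swirl eps i1)) (t, x).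
Proof.
move=> tT d16; set d := (T - t) ^+ n in d16 *.
have d0 : 0 < d by rewrite exprn_gt0// subr_gt0.
exists (row3 0 0 (2^-1)).
  by apply: cyl_pt; rewrite expr0n addr0 ler01.
rewrite /= /scale /= !mxE/= -/d !expr2 !mulr0 !mul0r !addr0 !mulr0 !addr0.
set A := d `^ (- eps).
have A0 : 0 <= A by exact: powR_ge0.
nra.
Qed.

(** The second derivative of - x_2 (1 - r^2) A^(1/2 - eps) in x_1 vanishes on the axis, so the
    point is again at distance sqrt d from it. At x_1 = 0 it is
    - x_2 A^(- (eps + 1/2)) ((1 - d) (1 - 2 eps) - 2 A), and the bounds on d and eps keep the
    last factor above 1/8. *)
Lemma lower_bound3 t : t < T -> (T - t) ^+ n <= 16^-1 -> exists2 x : X, cyl x &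
  16^-1 * ((T - t) ^+ n) `^ (- eps) <=
    (-1) * sem T n (partials n [:: i1; i1] (swirl (eps - 2^-1) i1)) (t, x).
Proof.
move=> tT d16; set d := (T - t) ^+ n in d16 *.
have d0 : 0 < d by rewrite exprn_gt0// subr_gt0.
exists (row3 0 (Num.sqrt d) (2^-1)).
  by apply: cyl_pt; rewrite sqr_sqrtr ?(ltW d0)// expr0n add0r; lra.
have sd : Num.sqrt d * Num.sqrt d = d by rewrite -expr2 sqr_sqrtr// ltW.
rewrite /= /scale /= !mxE/= -/d !expr2 sd.
have -> : d + 0 * 0 + d = d + d by ring.
have -> : - (eps - 2^-1) - 1 = - (eps + 2^-1) by field.
have dd0 : 0 < d + d by rewrite addr_gt0.
have := half_power d0; set B1 := (d + d) `^ (- (eps + 2^-1)).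
have -> : (d + d) `^ (- (eps - 2^-1)) = (d + d) * B1.
  rewrite /B1 -{2}(powRr1 (ltW dd0)) -powRD; last by rewrite (gt_eqF dd0) implybT.
  by congr (_ `^ _); field.
set B2 := _ `^ (- (eps + 2^-1) - 1); set S := Num.sqrt d; set A := d `^ (- eps) => hp.
rewrite [leRHS](_ : _ = (S * B1) * ((1 - d) * (1 - 2 * eps) - 4 * d)); last by field.
have A0 : 0 <= A by exact: powR_ge0.
have key : 8^-1 <= (1 - d) * (1 - 2 * eps) - 4 * d.
  by move: e4 e0 d16 d0 => h1 h2 h3 h4; nra.
apply: (@le_trans _ _ (2^-1 * A * 8^-1)); first lra.
apply: ler_pM => //; lra.
Qed.

End LowerBounds.

(** * Regularity up to the blow-up time *)

Section Regularity.
Context {R : realType}.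
Variables (T m : R).
Local Notation X := 'rV[R]_3.
Local Notation Z := (R * 'rV[R]_3)%type.
Local Notation scale := (scale T 2).
Local Notation sem := (sem T 2).
Local Notation weighs := (weighs 2).

Lemma scale_ge0 z : 0 <= scale z.
Proof. by rewrite scaleE !addr_ge0 ?sqr_ge0. Qed.

Lemma scale_eq0 z : scale z = 0 -> [/\ T - z.1 = 0, z.2 0 i1 = 0 & z.2 0 i2 = 0].
Proof.
move/eqP; rewrite scaleE !paddr_eq0 ?addr_ge0 ?sqr_ge0// !sqrf_eq0.
by move=> /andP[/andP[/eqP ? /eqP ?] /eqP ?].
Qed.

(** A power of 0 is 0, or 1 if the exponent is 0; in all cases the factors x_1 and x_2 make
    the swirl vanish. *)
Lemma swirl_singular j z : scale z = 0 -> sem (swirl m j) z = 0.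
Proof.
move=> /scale_eq0[_ x1 x2]; rewrite /swirl.
by case: ifP => _ /=; [rewrite x2 mulr0 mul0r|case: ifP => _ //=; rewrite x1 mul0r].
Qed.

Lemma near_tame z0 : scale z0 = 0 -> \forall z \near z0, scale z < 1 /\ `|z.2 0 i3| < `|z0.2 0 i3| + 1.
Proof.
move=> s0; apply: filterI.
  have := @continuous_scale R T 2 z0 [set s | s < 1]; apply.
  by apply: lt_nbhsl; rewrite s0.
have cn : {for z0, continuous (fun z : Z => `|z.2 0 i3|)}.
  apply: (@continuous_comp _ _ _ (fun z : Z => z.2 0 i3) (fun s : R => `|s|)).
    exact: continuous_coord.
  exact: norm_continuous.
by apply: (cn [set s | s < `|z0.2 0 i3| + 1]); apply: lt_nbhsl; rewrite ltrDl.
Qed.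

Lemma singular_bound e s z0 : weighs e s -> scale z0 = 0 ->
  exists2 C, 0 < C & \forall z \near z0, 0 < scale z -> `|sem e z| <= C * scale z `^ s.
Proof.
move=> We s0; pose M := `|z0.2 0 i3| + 1.
have M0 : 0 <= M by rewrite addr_ge0.
have M1 : 1 <= M by rewrite lerDr.
have [C C0 HC] := weighs_bound T (ltn0Sn 1) M0 We.
exists (C + 1); first by rewrite ltr_wpDl.
apply: filterS (near_tame s0) => z [zs z3] z0'.
apply: (le_trans (HC z _)); last by rewrite ler_wpM2r ?powR_ge0// lerDl.
split=> //; [by rewrite (le_trans (ltW zs))|by rewrite sqr_ge0|exact: ltW].
Qed.

(** Near a singular point, |f| <= C A^s with s > 0 and A is continuous. *)
Lemma continuous_singular (f : Z -> R) e s z0 : weighs e s -> 0 < s ->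
  (forall z, 0 < scale z -> f z = sem e z) -> (forall z, scale z = 0 -> f z = 0) ->
  scale z0 = 0 -> {for z0, continuous f}.
Proof.
move=> We s0 fe f0 z00.
have [C C0 HC] := singular_bound We z00.
apply/cvgrPdist_lt => /= eps eps0; rewrite (f0 _ z00).
have small : \forall z \near z0, scale z < (eps / C) `^ s^-1.
  have := @continuous_scale R T 2 z0 [set r | r < (eps / C) `^ s^-1]; apply.
  by apply: lt_nbhsl; rewrite z00 powR_gt0// divr_gt0.
near=> z.
rewrite sub0r normrN.
have [zz|zz] := eqVneq (scale z) 0; first by rewrite f0// normr0.
have zp : 0 < scale z by rewrite lt_neqAle eq_sym zz scale_ge0.
rewrite fe//; have /(_ zp) Hz : 0 < scale z -> `|sem e z| <= C * scale z `^ s by near: z.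
apply: (le_lt_trans Hz); rewrite mulrC -ltr_pdivlMr//.
have -> : eps / C = ((eps / C) `^ s^-1) `^ s.
  by rewrite -powRrM mulVf ?gt_eqF// powRr1// divr_ge0 ?ltW.
rewrite gt0_ltr_powR ?nnegrE ?powR_ge0 ?scale_ge0//.
by near: z.
Unshelve. all: by end_near. Qed.

(** On the line z0 + h w one has A = h^2 Q, so that e = O(|h|^(3/2)) = o(h). The
    threshold 3/4 is the weight of the swirl for m = - 1/4. *)
Lemma is_derive_singular e s z0 (w : Z) : weighs e s -> 3 / 4 <= s ->
  (forall z, scale z = 0 -> sem e z = 0) -> scale z0 = 0 -> is_derive z0 w (sem e) 0.
Proof.
move=> We s34 f0 z00.
have [C C0 HC] := singular_bound (weighs_le s34 We) z00.
have [t0 x10 x20] := scale_eq0 z00.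
pose Q := w.1 ^+ 2 + w.2 0 i1 ^+ 2 + w.2 0 i2 ^+ 2.
have Q0 : 0 <= Q by rewrite !addr_ge0 ?sqr_ge0.
have sE (h : R) : scale (h *: w + z0) = h ^+ 2 * Q.
  rewrite scaleE /Q !mxE /= x10 x20 !addr0.
  rewrite (_ : T - (h *: w.1 + z0.1) = - (h * w.1)); last first.
    by rewrite opprD addrCA t0 addr0.
  by rewrite /GRing.scale/=; ring.
pose D := C * Q `^ (3 / 4) + 1.
have D0 : 0 < D by rewrite ltr_wpDl// mulr_ge0 ?powR_ge0 ?ltW.
suff H : h^-1 *: ((sem e \o shift z0) (h *: w) - sem e z0) @[h --> 0^'] --> (0 : R).
  by split; [apply/cvg_ex; exists 0|exact: cvg_lim].
apply/cvgrPdist_lt => /= eps eps0; rewrite (f0 _ z00).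
have line : \forall h \near (0:R)^', 0 < scale (h *: w + z0) ->
    `|sem e (h *: w + z0)| <= C * scale (h *: w + z0) `^ (3 / 4).
  have c : {for (0 : R), continuous (fun h : R => h *: w + z0)}.
    apply: (@continuousD _ _ _ (fun h : R => h *: w) (fun=> z0)); last exact: cvg_cst.
    exact: scalel_continuous.
  apply: nbhs_dnbhs.
  by apply: (c [set z | 0 < scale z -> `|sem e z| <= C * scale z `^ (3 / 4)]); rewrite scale0r add0r.
near=> h.
have h0 : h != 0 by near: h; exact: nbhs_dnbhs_neq.
have hn : 0 < `|h| by rewrite normr_gt0.
have hd : `|h| < (eps / D) ^+ 2.
  by near: h; apply: dnbhs0_lt; rewrite exprn_gt0// divr_gt0.
rewrite sub0r normrN subr0 [_ *: _]/(_ * _) normrM normfV.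
rewrite mulrC ltr_pdivrMr//.
have [zz|zz] := eqVneq (scale (h *: w + z0)) 0.
  by rewrite f0// normr0 mulr_gt0.
have zp : 0 < scale (h *: w + z0) by rewrite lt_neqAle eq_sym zz scale_ge0.
have /(_ zp) Hz : 0 < scale (h *: w + z0) ->
  `|sem e (h *: w + z0)| <= C * scale (h *: w + z0) `^ (3 / 4) by near: h.
apply: (le_lt_trans Hz); rewrite sE powRM ?sqr_ge0//.
have -> : (h ^+ 2) `^ (3 / 4) = `|h| * Num.sqrt `|h|.
  rewrite -real_normK ?num_real// -powR_mulrn// -powRrM -powR12_sqrt//.
  rewrite -{2}(powRr1 (normr_ge0 h)) -powRD; last by rewrite (gt_eqF hn) implybT.
  by congr (_ `^ _); field.
rewrite (_ : C * (`|h| * Num.sqrt `|h| * Q `^ (3 / 4)) = (C * Q `^ (3 / 4)) * Num.sqrt `|h| * `|h|); last ring.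
rewrite ltr_pM2r//.
have sh : Num.sqrt `|h| < eps / D.
  rewrite [ltRHS](_ : _ = Num.sqrt ((eps / D) ^+ 2)); last first.
    by rewrite sqrtr_sqr ger0_norm// (divr_ge0 (ltW eps0) (ltW D0)).
  by rewrite ltr_sqrt// exprn_gt0// divr_gt0.
apply: (@le_lt_trans _ _ (D * Num.sqrt `|h|)); first by rewrite ler_wpM2r ?sqrtr_ge0// lerDl.
by rewrite mulrC -ltr_pdivlMr.
Unshelve. all: by end_near. Qed.

Lemma C0_swirl A : m < 2^-1 -> Cn_on 0 A (field T 2 (swirl m)).
Proof.
move=> m12; exists setT; split; [exact: openT|by []|split=> [ws z|//]].
rewrite leqn0 size_eq0 => /eqP-> _ /=.
have [z0|z0] := eqVneq (scale z) 0; last first.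
  by apply: continuous_field; rewrite lt_neqAle eq_sym z0 scale_ge0.
apply: continuous_row => j.
apply: (@continuous_singular _ (swirl m j) (2^-1 - m)) => //.
- exact: weighs_swirl.
- by rewrite subr_gt0.
- by move=> y _; rewrite mxE.
- by move=> y y0; rewrite mxE swirl_singular.
Qed.

(** With n = 2, all first derivatives, in time as in space, have the positive weight - m. *)
Lemma C1_swirl A : m <= - 4^-1 -> Cn_on 1 A (field T 2 (swirl m)).
Proof.
move=> m14; exists setT; split; [exact: openT|by []|].
have sc z : scale z = 0 \/ 0 < scale z.
  by have [z0|z0] := eqVneq (scale z) 0; [left|right; rewrite lt_neqAle eq_sym z0 scale_ge0].
have W j : weighs (swirl m j) (2^-1 - m) := weighs_swirl 2 m j.
have Dsing z w : scale z = 0 -> is_derive z w (field T 2 (swirl m)) 0.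
  move=> z0.
  have d j : is_derive z w (fun y => field T 2 (swirl m) y 0 j) 0.
    rewrite (_ : (fun y => _) = sem (swirl m j)); last by apply/funext => y; rewrite mxE.
    apply: (@is_derive_singular _ (2^-1 - m)) => //; first by move: m14; lra.
    by move=> y; exact: swirl_singular.
  have df : derivable (field T 2 (swirl m)) z w.
    by apply/derivable_mxP => i j; rewrite ord1; exact: (@ex_derive _ _ _ _ _ _ _ (d j)).
  split=> //; rewrite derive_mx//; apply/matrixP => i j; rewrite ord1 !mxE.
  exact: (@derive_val _ _ _ _ _ _ _ (d j)).
have der z w : derivable (field T 2 (swirl m)) z w.
  by have [z0|z0] := sc z; [case: (Dsing z w z0)|exact: (@derivable_iter_field _ T 2 (swirl m) [::] w z z0)].
split=> [ws z|ws w z]; last by rewrite ltnS leqn0 size_eq0 => /eqP-> _; exact: der.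
case: ws => [_ _|w [|//] _ _] /=.
  have [z0|z0] := sc z; last exact: (@continuous_field _ T 2 (swirl m) z z0).
  apply: continuous_row => j.
  apply: (@continuous_singular _ (swirl m j) (2^-1 - m)) => //; first lra.
  - by move=> y _; rewrite mxE.
  - by move=> y y0; rewrite mxE swirl_singular.
have [z0|z0] := sc z; last exact: (@continuous_iter_field _ T 2 (swirl m) [:: w] z z0).
apply: continuous_row => j.
apply: (@continuous_singular _ (directional 2 w (swirl m j)) (2^-1 - m - 2^-1)) => //.
- have We c d : weighs (Mul (Cst c) (partial 2 d (swirl m j))) (2^-1 - m - 2^-1).
    exists 0, (2^-1 - m - 2^-1); split; [by right| |by rewrite add0r].
    by case: d => [i|]; [exact: weighs_space|exact: (@weighs_time _ 2)].
  by split; [|split; [|split]]; exact: We.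
- lra.
- by move=> y yp; have [_ ->] := is_derive_field (swirl m) w yp; rewrite mxE.
- by move=> y y0; have [_ ->] := Dsing y w y0; rewrite mxE.
Qed.

End Regularity.

(** * Function spaces and choice of the exponents *)

Section FlowProperties.
Context {R : realType}.
Variables (T : R) (n : nat) (m : R).
Hypotheses (T0 : 0 < T) (n0 : (0 < n)%N).
Local Notation X := 'rV[R]_3.

Let v (t : R) (x : X) : X := field T n (swirl m) (t, x).
Let f (t : R) (x : X) : X := field T n (force n m) (t, x).

Lemma smooth_field_vf e : smooth_vf T (fun t x => field T n e (t, x)).
Proof.
rewrite /smooth_vf (_ : (fun z => _) = field T n e); last by apply/funext => -[].
apply: smooth_field => -[t x] [/= + _]; rewrite in_itv/= => /andP[_ tT].
exact: scale_gt0.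
Qed.

Lemma in_LqLp_swirl s p q : 1 <= p -> (1 <= q)%E -> 0 <= s -> - s <= 2^-1 - m ->
  subcritical n s p q -> in_LqLp T q p%:E v.
Proof.
move=> p1 q1 s0 sm sub; apply: (in_LqLp_expr (E := fun _ j => swirl m j) T0 n0 p1 q1 s0) => //.
by move=> _ j; apply: (weighs_le sm); exact: weighs_swirl.
Qed.

Lemma in_LqLp_force s p q : 1 <= p -> (1 <= q)%E -> 0 <= s -> m <= 1 -> - s <= 2^-1 - m - 1 ->
  subcritical n s p q -> in_LqLp T q p%:E f.
Proof.
move=> p1 q1 s0 m1 sm sub; apply: (in_LqLp_expr (E := fun _ j => force n m j) T0 n0 p1 q1 s0) => //.
by move=> _ j; apply: (weighs_le sm); exact: weighs_force.
Qed.

(** Here s and sg are the exponents of the velocity and of its gradient. *)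
Lemma in_L2H1_swirl s sg : 0 <= s -> - s <= 2^-1 - m -> subcritical n s 2 2%:E ->
  0 <= sg -> - sg <= - m -> subcritical n sg 2 2%:E -> in_L2H1 T v.
Proof.
move=> s0 sm sub sg0 sgm subg; have h1 : (1 : R) <= 2 by rewrite ler1n.
split; first by apply: (in_LqLp_swirl (s := s)).
exists (fun t x => \matrix_(i, j) sem T n (partial n (Some j) (swirl m i)) (t, x)); split.
  apply: (in_LqLp_expr (E := fun i j => partial n (Some j) (swirl m i)) T0 n0 h1 _ sg0) => //.
  move=> i j; apply: (weighs_le (s := 2^-1 - m - 2^-1)); first lra.
  by apply: weighs_space; exact: weighs_swirl.
apply: nearW => t; rewrite in_itv/= => /andP[t0 tT] i j.
have -> : (fun x => v t x 0 i) = (fun x => sem T n (swirl m i) (t, x)).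
  by apply/funext => x; rewrite mxE.
under [X in weak_partial _ _ X]eq_fun do rewrite mxE.
apply: (@weak_partial_C1 _ j (fun x => sem T n (swirl m i) (t, x))
  (fun x => sem T n (partial n (Some j) (swirl m i)) (t, x))) => x _;
  have Az := scale_gt0 n x tT.
- apply: is_derive_space; rewrite -sem_axis; exact: is_derive_sem.
- by apply: continuous_slice; exact: continuous_sem.
- by apply: continuous_slice; exact: continuous_sem.
Qed.

Lemma NS_solution_swirl : NS_solution T f (v 0) v (fun _ _ => 0).
Proof.
split => //.
- exact: smooth_field_vf.
- exact: navier_stokes_swirl.
- exact: no_slip_swirl.
- exact: total_slip_swirl.
Qed.

End FlowProperties.

(** The force has the exponent s = eps + 3/2 - k/2, and 2 s <= 3 - alpha as soon as
    2 eps <= k - alpha; then (2 s p - 2) r < 2. For k = 1, this gives (s p - 1) r < 1 <= p. For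
    k = 2, 3, it gives 2 (s p - 1) r < 2, enough if p >= 2; if p < 2, a further bound on eps
    ensures s p <= 1. *)
Lemma exponent_choice (R : realType) (k : nat) (alpha p : R) (q : \bar R) :
  (1 <= k)%N -> alpha < k%:R -> (1 <= q)%E -> 1 <= p -> admissible (3 - alpha) p q ->
  exists eps : R, [/\ 0 < eps, eps <= 4^-1, 2 * eps <= k%:R - alpha &
    subcritical (if k == 1 then 1 else 2) (eps + 3 / 2 - k%:R / 2) p q].
Proof.
move=> k1 ak q1 p1 adm; have p0 : 0 < p by exact: lt_le_trans p1.
pose a := if p < 2 then (2 - p) / (2 * p) else 4^-1.
have a0 : 0 < a by rewrite /a; case: ifP => p2; rewrite ?invr_gt0// divr_gt0 ?mulr_gt0 ?subr_gt0.
pose eps := Num.min (4^-1) (Num.min ((k%:R - alpha) / 2) a).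
have e0 : 0 < eps by rewrite !lt_min invr_gt0 ltr0n a0 divr_gt0// subr_gt0.
have e1 : eps <= 4^-1 by rewrite ge_min lexx.
have e2 : eps <= (k%:R - alpha) / 2 by rewrite !ge_min lexx orbT.
have e3 : eps <= a by rewrite !ge_min lexx !orbT.
exists eps; split=> //; first lra.
have le : (eps + 3 / 2 - k%:R / 2) * p * 2 <= (3 - alpha) * p.
  rewrite mulrAC ler_wpM2r ?(ltW p0)//; lra.
case: q q1 adm => [r| |] //=; last by move=> _; lra.
rewrite lee_fin => r1 adm; have r0 : 0 < r by exact: lt_le_trans r1.
have le2 : ((eps + 3 / 2 - k%:R / 2) * p * 2 - 2) * r < 2.
  by apply: le_lt_trans adm; rewrite ler_wpM2r ?(ltW r0)// lerD2r.
move: le2; set s := _ * p in le *; case: eqVneq => [_|k_1] le2.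
  by move: p1 le2; rewrite mul1r; lra.
have [p2|p2] := ltP p 2; last first.
  by apply: lt_le_trans p2; move: le2; lra.
have s2 : s * 2 <= 2.
  have k2 : (2 : R) <= k%:R by rewrite ler_nat; case: (k) k1 k_1 => [|[|]].
  have : eps * (2 * p) <= 2 - p by rewrite -ler_pdivlMr ?mulr_gt0//; move: e3; rewrite /a p2.
  rewrite /s; nra.
apply: le_lt_trans p0; nra.
Qed.

Theorem theorem4p1 (R : realType) (T : R) (k : nat) (alpha p : R) (q : \bar R)
    (hT : 0 < T) (hk : (1 <= k <= 3)%N)
    (halpha : k%:R - 1 <= alpha < k%:R)
    (hq : (1 <= q)%E) (hp : 1 <= p)
    (hpq : admissible (3 - alpha) p q) :
  exists (f v : R -> 'rV[R]_3 -> 'rV[R]_3) (P : R -> 'rV[R]_3 -> R)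
         (v0 : 'rV[R]_3 -> 'rV[R]_3),
    [/\ in_LqLp T q p%:E f,
        in_LqLp T +oo%E 2%:E v /\ in_L2H1 T v,
        NS_solution T f v0 v P
      & forall w Q, NS_solution T f v0 w Q ->
          forall t x, 0 <= t < T -> cyl x -> w t x = v t x] /\
    [/\ Lp_norm +oo%E (nabla_norm k.-1 (v t)) @[t --> T^'-] --> +oo%E,
        forall (p' : R) (q' : \bar R), 1 <= p' -> (1 <= q')%E ->
          admissible (1 - alpha) p' q' -> in_LqLp T q' p'%:E v,
        smooth_vf T f /\ smooth_vf T v
      & (2 <= k)%N ->
          Cn_on (k - 2) (cylT `[0, T]) (fun z : R * 'rV[R]_3 => v z.1 z.2)].
Proof.
move/andP: hk => [k1 k3]; move/andP: halpha => [ka ak].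
have [eps [e0 e4 ek sub]] := exponent_choice k1 ak hq hp hpq.
pose n := if k == 1 then 1%N else 2%N.
have n0 : (0 < n)%N by rewrite /n; case: ifP.
pose m : R := eps + 1 - k%:R / 2.
(* the velocity weighs at least [- s] and its gradient at least [- sg] *)
pose s : R := if k == 1 then eps else 0.
pose sg : R := if k == 1 then eps + 2^-1 else eps.
have k1R : (1 : R) <= k%:R by rewrite ler1n.
have k2R : k != 1%N -> (2 : R) <= k%:R by rewrite ler_nat; case: (k) k1 => [|[|]].
have k3R : k%:R <= (3 : R) by rewrite ler_nat.
have s0 : 0 <= s by rewrite /s; case: ifP => // _; exact: ltW.
have sm : - s <= 2^-1 - m.
  by rewrite /s /m; case: eqVneq => [_|/k2R]; lra.
have sg0 : 0 <= sg by rewrite /sg; case: ifP => _; lra.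
have sgm : - sg <= - m by rewrite /sg /m; case: eqVneq => [_|/k2R]; lra.
have kP : k = 1%N \/ k = 2%N \/ k = 3%N.
  by case: (k) k1 k3 => [|[|[|[|]]]]//; auto.
pose v (t : R) (x : 'rV[R]_3) := field T n (swirl m) (t, x).
pose f (t : R) (x : 'rV[R]_3) := field T n (force n m) (t, x).
have NSv : NS_solution T f (v 0) v (fun _ _ => 0) := NS_solution_swirl T n m.
exists f, v, (fun _ _ => 0), (v 0); split; split=> //.
- apply: (@in_LqLp_force _ T n m hT n0 (eps + 3 / 2 - k%:R / 2)) => //; rewrite /m; lra.
- split.
    apply: (@in_LqLp_swirl _ T n m hT n0 s) => //.
    + by rewrite ler1n.
    + by rewrite leey.
    + by rewrite /subcritical /s; case: (eqVneq k 1%N) => _; lra.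
  apply: (@in_L2H1_swirl _ T n m hT n0 s sg) => //.
  + by rewrite /subcritical /s /n; case: (eqVneq k 1%N) => _; lra.
  + by rewrite /subcritical /sg /n; case: (eqVneq k 1%N) => _; lra.
- move=> w Q NSw t x tT cx; exact: (NS_unique NSv NSw tT cx).
- rewrite /v; case: kP => [k_1|[k_2|k_3]].
  + have -> : m = eps + 2^-1 by rewrite /m k_1; lra.
    rewrite k_1; apply: (@blow_up_of_lower_bound _ T n _ 0 [tuple] i2 1 eps 16^-1) => //.
      by rewrite normr1.
    by move=> t; exact: lower_bound1.
  + have -> : m = eps by rewrite /m k_2; lra.
    rewrite k_2; apply: (@blow_up_of_lower_bound _ T n _ 1 [tuple i2] i1 (-1) eps 16^-1) => //.
      by rewrite normrN1.
    by move=> t; exact: lower_bound2.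
  + have -> : m = eps - 2^-1 by rewrite /m k_3; lra.
    rewrite k_3; apply: (@blow_up_of_lower_bound _ T n _ 2 [tuple i1; i1] i1 (-1) eps 16^-1) => //.
      by rewrite normrN1.
    by move=> t; exact: lower_bound3.
- move=> p' q' p1' q1' adm; apply: (@in_LqLp_swirl _ T n m hT n0 s) => //.
  rewrite /subcritical /s /n; move: adm; case: (eqVneq k 1%N) => [k_1|_].
    have e2 : 2 * eps <= 1 - alpha by move: ek; rewrite k_1.
    have le : eps * p' * 2 <= (1 - alpha) * p' by have := ler_wpM2r (le_trans ler01 p1') e2; lra.
    case: q' q1' => [r| |]//=; last by move=> _; lra.
    rewrite lee_fin mul1r => r1 adm.
    have : (eps * p' * 2 - 2) * r < 2.
      by apply: le_lt_trans adm; rewrite ler_wpM2r ?lerD2r//; lra.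
    lra.
  case: q' q1' => [r| |]//=; last by move=> _ _; lra.
  by rewrite lee_fin => r1 _; rewrite mul0r; lra.
- by split; exact: smooth_field_vf.
- move=> k2.
  have -> : (fun z : R * 'rV[R]_3 => v z.1 z.2) = field T n (swirl m) by apply/funext => -[].
  rewrite /n; case: kP => [k_1|[k_2|k_3]]; first by rewrite k_1 in k2.
    by rewrite k_2; apply: C0_swirl; rewrite /m k_2; lra.
  by rewrite k_3; apply: C1_swirl; rewrite /m k_3; lra.
Qed.
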